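(* For real $t$ put $\mathfrak m(it)=\int_0^1 e^{ixt}\,\mathrm d ?(x)$, where $?$ is the Minkowski question mark function on $[0,1]$. Let $$\alpha=\frac{\log 2}{2\log\varphi},\qquad \varphi=\frac{1+\sqrt5}{2},\qquad \eta=\frac{3\alpha^2-1}{3(1+\alpha)(3-\alpha)}=0.0472673444\ldots.$$ Then, as $|t|\to\infty$, $|\mathfrak m(it)|\ll|t|^{-\eta}$; that is, there are constants $C,T_0>0$ such that $|\mathfrak m(it)|\le C|t|^{-\eta}$ for all real $t$ with $|t|\ge T_0$.
   Context: The Minkowski question mark function $?:[0,1]\to[0,1]$ is the continuous increasing function defined by $?(0)=0$ and, using the continued fraction $x=[0,a_1,a_2,\ldots]=\cfrac{1}{a_1+\cfrac{1}{a_2+\cdots}}$ with $a_j\in\mathbb N=\{1,2,\ldots\}$, by $$?([0,a_1,a_2,\ldots])=2\sum_{j\ge1}(-1)^{j+1}2^{-(a_1+\cdots+a_j)}$$ (for rational $x$ the continued fraction and the sum are finite). The integral $\int\cdot\,\mathrm d?(x)$ is the Lebesgue–Stieltjes integral, i.e. the integral against the Borel probability measure on $[0,1]$ with distribution function $?$. *)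

(* Defs.v *)
From HB Require Import structures.
From mathcomp Require Import all_boot all_order all_algebra.
From mathcomp Require Import complex ring lra.
From mathcomp Require Import all_classical all_reals all_analysis.

Set Implicit Arguments.
Unset Strict Implicit.
Unset Printing Implicit Defensive.

Import Order.TTheory GRing.Theory Num.Theory.
Import numFieldNormedType.Exports.

Local Open Scope classical_set_scope.
Local Open Scope ring_scope.

Section MinkowskiQuestionMark.
Context {R : realType}.
Implicit Types x y z : R.

(* Regular continued fraction algorithm on [0, 1]: for x != 0 write
   x = 1 / (a_1 + x') with a_1 = floor (1 / x) and 0 <= x' < 1; gauss_map x is
   x' and cf_rem x j is the remainder after j steps.  The expansion
   [0, a_1, a_2, ...] has at most j partial quotients exactly when
   cf_rem x j = 0 (an absorbing value, as 0^-1 = 0); as long as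
   cf_rem x j != 0, cf_digit x j is a_(j+1). *)
Definition gauss_map x : R := x^-1 - (Num.truncn x^-1)%:R.
Definition cf_rem x (j : nat) : R := iter j gauss_map x.
Definition cf_digit x (j : nat) : nat := Num.truncn (cf_rem x j)^-1.

(* Indices start at 0 here, hence the sign (-1) ^+ j. *)
Definition qm_term x (j : nat) : R :=
  if cf_rem x j == 0 then 0
  else (-1) ^+ j * 2 ^- (\sum_(i < j.+1) cf_digit x i).

(* Meaningful for x in [0, 1] only. *)
Definition question_mark x : R := 2 * limn (series (qm_term x)).

Definition clamp01 x : R := Num.min (Num.max x 0) 1.

(* The question mark function extended by 0 on the left and 1 on the right. *)
Definition question_mark_cdf x : R :=
  question_mark (clamp01 x).

Local Notation Q := question_mark.
Local Notation G := gauss_map.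

Lemma gauss_map0 : G 0 = 0.
Proof. by rewrite /gauss_map invr0 truncn0 subrr. Qed.

Lemma gauss_mapP x : 0 <= x -> 0 <= G x < 1.
Proof.
move=> x0; have : 0 <= x^-1 by rewrite invr_ge0.
move=> /truncn_itv /andP[h1 h2]; rewrite /gauss_map subr_ge0 h1/=.
by rewrite ltrBlDl natr1.
Qed.

Lemma gauss_map_inv (a : nat) z : 0 <= z < 1 ->
  Num.truncn ((a%:R + z)^-1)^-1 = a /\ G (a%:R + z)^-1 = z.
Proof.
move=> /andP[z0 z1]; rewrite /gauss_map invrK.
have -> : Num.truncn (a%:R + z) = a.
  by apply: truncn_def; rewrite lerDl z0/= -natr1 ltrD2l.
by split => //; rewrite addrC addKr.
Qed.

Lemma truncnV_gt0 x : 0 < x <= 1 -> (0 < Num.truncn x^-1)%N.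
Proof. by move=> /andP[x0 x1]; rewrite truncn_gt0 invf_ge1. Qed.

Lemma cf_recE x : x = ((Num.truncn x^-1)%:R + G x)^-1.
Proof. by rewrite /gauss_map addrC subrK invrK. Qed.

Lemma qm_term0 j : qm_term 0 j = 0.
Proof.
rewrite /qm_term; suff -> : cf_rem 0 j == 0 by [].
by rewrite /cf_rem; elim: j => //= j /eqP ->; rewrite gauss_map0.
Qed.

Lemma qm_term_0 x : x != 0 -> qm_term x 0 = 2 ^- Num.truncn x^-1.
Proof.
by move=> /negPf x0; rewrite /qm_term /cf_rem /= x0 mul1r big_ord1.
Qed.

Lemma qm_term_S x j : x != 0 ->
  qm_term x j.+1 = - 2 ^- Num.truncn x^-1 * qm_term (G x) j.
Proof.
move=> /negPf x0; rewrite /qm_term.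
have remS i : cf_rem x i.+1 = cf_rem (G x) i by rewrite /cf_rem iterSr.
rewrite remS; case: ifP => _; first by rewrite mulr0.
rewrite big_ord_recl /=.
under eq_bigr do rewrite /bump /= add1n /cf_digit remS.
rewrite exprD invfM [(-1) ^+ _]exprS mulN1r -[cf_digit x _]/(Num.truncn x^-1).
by rewrite !mulNr mulrCA.
Qed.

Lemma normr_qm_term x j : 0 <= x <= 1 -> `|qm_term x j| <= 2^-1 ^+ j.
Proof.
elim: j x => [|j IH] x /andP[x0 x1].
  have [->|xN0] := eqVneq x 0; first by rewrite qm_term0 normr0.
  rewrite qm_term_0// ger0_norm ?invr_ge0 ?exprn_ge0// expr0.
  by rewrite invf_le1 ?exprn_gt0// exprn_ege1// ler1n.
have [->|xN0] := eqVneq x 0; first by rewrite qm_term0 normr0 exprn_ge0.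
have xgt0 : 0 < x by rewrite lt_neqAle eq_sym xN0.
rewrite qm_term_S// normrM normrN (@ger0_norm _ (2 ^- _)) ?invr_ge0 ?exprn_ge0//.
rewrite exprS.
have /andP[Gx0 /ltW Gx1] := gauss_mapP x0.
apply: ler_pM => //; last by apply: IH; rewrite Gx0.
rewrite lef_pV2 ?posrE ?exprn_gt0//.
by rewrite -[leLHS]expr1 ler_eXn2l ?ltr1n// truncnV_gt0// xgt0.
Qed.

Lemma is_cvg_qm x : 0 <= x <= 1 -> cvgn (series (qm_term x)).
Proof.
move=> x01; apply: normed_cvg.
apply: (@series_le_cvg _ _ (geometric 1 2^-1)).
- by move=> n; rewrite /=.
- by move=> n; rewrite /= mul1r exprn_ge0.
- by move=> n; rewrite /= mul1r normr_qm_term.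
- by apply: is_cvg_geometric_series; rewrite ger0_norm ?invf_lt1 ?ltr1n.
Qed.

Definition qm_partial n x : R := 2 * series (qm_term x) n.

Lemma qm_partial0 n : qm_partial n 0 = 0.
Proof. by rewrite /qm_partial /series/= big1 ?mulr0// => i _; rewrite qm_term0. Qed.

Lemma qm_partialS n x : x != 0 ->
  qm_partial n.+1 x = 2 ^- Num.truncn x^-1 * (2 - qm_partial n (G x)).
Proof.
move=> x0; rewrite /qm_partial /series/= big_nat_recl// qm_term_0//.
under eq_bigr do rewrite qm_term_S//.
by rewrite -mulr_sumr; ring.
Qed.

Lemma cvg_qm_partial x : 0 <= x <= 1 -> (fun n => qm_partial n x) @ \oo --> Q x.
Proof. by move=> x01; apply: cvgM; [exact: cvg_cst|exact: is_cvg_qm]. Qed.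

Lemma invX2_le (a : nat) : (0 < a)%N -> (2:R) ^- a <= 2^-1.
Proof.
move=> a0; rewrite lef_pV2 ?posrE ?exprn_gt0//.
by rewrite -[leLHS]expr1 ler_eXn2l// ltr1n.
Qed.

Lemma invX2_gt0 (a : nat) : (0:R) < 2 ^- a.
Proof. by rewrite invr_gt0 exprn_gt0. Qed.

Lemma qm_partial_itv n x : 0 <= x <= 1 -> 0 <= qm_partial n x <= 1.
Proof.
elim: n x => [|n IH] x /andP[x0 x1].
  by rewrite /qm_partial /series/= big_geq// mulr0 lexx/=.
have [->|xN0] := eqVneq x 0; first by rewrite qm_partial0 lexx/=.
have xgt0 : 0 < x by rewrite lt_neqAle eq_sym xN0.
have /andP[Gx0 /ltW Gx1] := gauss_mapP x0.
have /andP[q0 q1] := IH (G x) ltac:(by rewrite Gx0).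
rewrite qm_partialS//.
have := invX2_le (truncnV_gt0 (x := x) ltac:(by rewrite xgt0)).
have := invX2_gt0 (Num.truncn x^-1).
by move: (2 ^- _) => a a0 a1; apply/andP; split; nra.
Qed.

Lemma qm_partial_homo n x y : 0 <= x -> x <= y -> y <= 1 -> qm_partial n x <= qm_partial n y.
Proof.
elim: n x y => [|n IH] x y x0 xy y1.
  by rewrite /qm_partial /series/= !big_geq.
have [->|xN0] := eqVneq x 0.
  by rewrite qm_partial0; have /andP[] := @qm_partial_itv n.+1 y ltac:(by rewrite (le_trans x0)).
have xgt0 : 0 < x by rewrite lt_neqAle eq_sym xN0.
have ygt0 := lt_le_trans xgt0 xy.
have yN0 := lt0r_neq0 ygt0.
rewrite !qm_partialS//.
have /andP[Gx0 Gx1] := gauss_mapP x0.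
have /andP[Gy0 Gy1] := gauss_mapP (ltW ygt0).
have /andP[qx0 qx1] := @qm_partial_itv n (G x) ltac:(by rewrite Gx0 ltW).
have /andP[qy0 qy1] := @qm_partial_itv n (G y) ltac:(by rewrite Gy0 ltW).
have yVx : y^-1 <= x^-1 by rewrite lef_pV2.
have := le_truncn yVx; rewrite leq_eqVlt => /orP[/eqP aE|alt].
  rewrite aE ler_pM2l// lerD2l lerN2; apply: IH => //; last exact: ltW.
  by rewrite /gauss_map aE lerD2r.
have : (2:R) ^- Num.truncn x^-1 <= 2^-1 * 2 ^- Num.truncn y^-1.
  by rewrite -invfM -exprS lef_pV2 ?posrE ?exprn_gt0// ler_eXn2l// ltr1n.
have := invX2_gt0 (Num.truncn x^-1); have := invX2_gt0 (Num.truncn y^-1).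
by move: (2 ^- _) (2 ^- _) => a b a0 b0 ab; nra.
Qed.

Lemma question_mark0 : Q 0 = 0.
Proof.
rewrite /question_mark [X in limn X](_ : _ = cst 0) ?lim_cst ?mulr0//.
by apply/funext => n; rewrite /series/= big1// => i _; rewrite qm_term0.
Qed.

Lemma question_mark_rec x : 0 < x <= 1 ->
  Q x = 2 ^- Num.truncn x^-1 * (2 - Q (G x)).
Proof.
move=> /andP[x0 x1]; have /andP[Gx0 Gx1] := gauss_mapP (ltW x0).
have h : (fun n => qm_partial n.+1 x) @ \oo --> Q x.
  by rewrite (@cvg_shiftS _ (qm_partial ^~ x)); apply: cvg_qm_partial; rewrite ltW.
apply: (cvg_unique _ h) => //.
rewrite (_ : (fun n => _) = (fun n => 2 ^- Num.truncn x^-1 * (2 - qm_partial n (G x)))).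
  2: by apply/funext => n; rewrite qm_partialS ?lt0r_neq0.
apply: cvgM; first exact: cvg_cst.
by apply: cvgB; [exact: cvg_cst|apply: cvg_qm_partial; rewrite Gx0 ltW].
Qed.

Lemma question_mark1 : Q 1 = 1.
Proof.
rewrite question_mark_rec ?ltr01 ?lexx// /gauss_map invr1 truncn1 subrr.
by rewrite question_mark0 subr0 expr1 mulVf.
Qed.

Lemma question_mark_homo x y : 0 <= x -> x <= y -> y <= 1 -> Q x <= Q y.
Proof.
move=> x0 xy y1.
have x01 : 0 <= x <= 1 by rewrite x0 (le_trans xy).
have y01 : 0 <= y <= 1 by rewrite y1 (le_trans x0).
apply: (ler_cvg_to (cvg_qm_partial x01) (cvg_qm_partial y01)).
by apply: nearW => n; exact: qm_partial_homo.
Qed.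

Lemma qm_modulus n :
  (forall x, 0 <= x < 1 -> exists2 y, x < y <= 1 & Q y - Q x <= 2 ^- n) /\
  (forall x, 0 < x <= 1 -> exists2 y, 0 <= y < x & Q x - Q y <= 2 ^- n).
Proof.
elim: n => [|n [IHr IHl]].
  rewrite expr0 invr1; split=> x /andP[x0 x1].
    exists 1; first by rewrite x1 lexx.
    rewrite question_mark1 lerBlDl lerDr -question_mark0.
    by apply: question_mark_homo => //; exact: ltW.
  exists 0; first by rewrite x0 lexx.
  rewrite question_mark0 subr0 -question_mark1.
  by apply: question_mark_homo => //; exact: ltW.
have invS z (a : nat) : (0 < a)%N -> 0 <= z -> 0 < (a%:R + z)^-1 <= 1.
  move=> a0 z0; have a1 : 1 <= a%:R + z :> R by rewrite ler_wpDr// ler1n.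
  by rewrite invr_gt0 (lt_le_trans ltr01 a1)/= invf_le1// (lt_le_trans ltr01).
have posD z (a : nat) : (0 < a)%N -> 0 <= z -> a%:R + z \is Num.pos.
  by move=> a0 z0; rewrite posrE ltr_wpDr// ltr0n.
have QinvS z (a : nat) : (0 < a)%N -> 0 <= z < 1 ->
    Q (a%:R + z)^-1 = 2 ^- a * (2 - Q z).
  move=> a0 /andP[z0 z1]; rewrite question_mark_rec; last exact: invS.
  by have [-> ->] := @gauss_map_inv a z ltac:(by rewrite z0).
have shrink (a : nat) (d : R) : (0 < a)%N -> 0 <= d -> d <= 2 ^- n ->
    2 ^- a * d <= 2 ^- n.+1.
  move=> a0 d0 dn; rewrite exprS invfM.
  by apply: ler_pM => //; exact: invX2_le.
split=> x /andP[x0 x1].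
  have [->|xN0] := eqVneq x 0.
    exists (n.+2%:R + 0)^-1.
      by apply: invS.
    rewrite QinvS ?lexx ?ltr01// question_mark0 !subr0.
    by rewrite [X in X^-1]exprS invfM mulrAC mulVf ?mul1r.
  have xgt0 : 0 < x by rewrite lt_neqAle eq_sym xN0.
  have /andP[Gx0 Gx1] := gauss_mapP x0.
  set a := Num.truncn x^-1.
  have a0 : (0 < a)%N by rewrite truncnV_gt0// xgt0 ltW.
  have xE : x = (a%:R + G x)^-1 := cf_recE x.
  have [G0|GN0] := eqVneq (G x) 0.
    have a1 : (1 < a)%N.
      rewrite ltn_neqAle a0 andbT; apply: contraTN x1 => /eqP a1.
      by rewrite xE -a1 G0 addr0 invr1 ltxx.
    have a10 : (0 < a.-1)%N by rewrite -ltnS prednK.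
    have [z /andP[z0 z1] hz] := IHl 1 ltac:(by rewrite ltr01 lexx).
    exists (a.-1%:R + z)^-1.
      have /andP[_ ->] := @invS z a.-1 a10 z0; rewrite andbT.
      rewrite {1}xE G0 addr0 ltf_pV2 ?posrE ?ltr0n//.
        by rewrite -[X in _ < X%:R](prednK a0) -natr1 ltrD2l.
      by rewrite ltr_wpDr// ltr0n.
    rewrite QinvS ?z0//.
    rewrite (question_mark_rec (x := x)) ?xgt0 ?(ltW x1)// -/a G0 question_mark0 subr0.
    rewrite question_mark1 in hz.
    have <- : 2 ^- a.-1 = 2 ^- a * 2 :> R.
      by rewrite -[in RHS](prednK a0) exprS invfM mulrAC mulVf ?mul1r.
    rewrite (_ : _ - _ = 2 ^- a.-1 * (1 - Q z)); last by ring.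
    have Qz1 : Q z <= Q 1 := question_mark_homo z0 (ltW z1) (lexx 1).
    by apply: shrink hz => //; rewrite subr_ge0 -question_mark1.
  have Gxgt0 : 0 < G x by rewrite lt_neqAle eq_sym GN0.
  have [z /andP[z0 z1] hz] := IHl (G x) ltac:(by rewrite Gxgt0 ltW).
  have zlt1 := lt_trans z1 Gx1.
  exists (a%:R + z)^-1.
    have /andP[_ ->] := @invS z a a0 z0; rewrite andbT.
    by rewrite {1}xE ltf_pV2 ?ltrD2l ?posD.
  rewrite QinvS ?z0//.
  rewrite (question_mark_rec (x := x)) ?x0 ?xgt0 ?x1 ?(ltW x1)// -/a.
  rewrite -mulrBr opprD addrACA subrr add0r opprK addrC.
  apply: shrink => //; rewrite subr_ge0.
  exact: question_mark_homo (ltW z1) (ltW Gx1).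
have /andP[Gx0 Gx1] := gauss_mapP (ltW x0).
set a := Num.truncn x^-1.
have a0 : (0 < a)%N by rewrite truncnV_gt0// x0.
have xE : x = (a%:R + G x)^-1 := cf_recE x.
have [z /andP[z0 z1] hz] := IHr (G x) ltac:(by rewrite Gx0).
(* z may be 1; the midpoint of G x and z is < 1 *)
pose w := (G x + z) / 2.
have w0 : G x < w by rewrite /w; lra.
have w1 : w < 1 by rewrite /w; lra.
have wz : w <= z by rewrite /w; lra.
have wge0 : 0 <= w by rewrite (le_trans Gx0)// ltW.
exists (a%:R + w)^-1.
  have /andP[/ltW -> _] := @invS w a a0 wge0.
  by rewrite /= {1}xE ltf_pV2 ?ltrD2l ?posD.
rewrite QinvS ?wge0//.
rewrite (question_mark_rec (x := x)) ?x0 ?xgt0 ?x1 ?(ltW x1)// -/a.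
rewrite -mulrBr opprD addrACA subrr add0r opprK addrC.
apply: shrink => //.
  by rewrite subr_ge0; apply: question_mark_homo (ltW w0) (ltW w1).
apply: le_trans hz; rewrite lerD2r.
exact: question_mark_homo.
Qed.

Local Notation F := question_mark_cdf.

Lemma clamp01_itv x : 0 <= clamp01 x <= 1.
Proof. by rewrite /clamp01 le_min ge_min lexx ler01 le_max lexx !orbT. Qed.

Lemma clamp01_homo x y : x <= y -> clamp01 x <= clamp01 y.
Proof.
move=> xy; rewrite /clamp01 le_min !ge_min lexx orbT andbT.
by rewrite ge_max !le_max xy lexx/= orbT.
Qed.

Lemma question_mark_cdf_le0 x : x <= 0 -> F x = 0.
Proof.
by move=> x0; rewrite /question_mark_cdf /clamp01 max_r// min_l// question_mark0.
Qed.

Lemma question_mark_cdf_ge1 x : 1 <= x -> F x = 1.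
Proof.
move=> x1; rewrite /question_mark_cdf /clamp01 max_l ?min_r ?question_mark1//.
exact: le_trans x1.
Qed.

Lemma question_mark_cdfE x : 0 <= x <= 1 -> F x = Q x.
Proof. by move=> /andP[x0 x1]; rewrite /question_mark_cdf /clamp01 max_l// min_l. Qed.

Lemma question_mark_cdf_nd : nondecreasing F.
Proof.
move=> x y xy; have /andP[? _] := clamp01_itv x; have /andP[_ ?] := clamp01_itv y.
by apply: question_mark_homo => //; exact: clamp01_homo.
Qed.

Lemma question_mark_cdf_rc : right_continuous F.
Proof.
move=> x; apply/cvgrPdist_le => e e0.
have [y xy ye] : exists2 y, x < y & F y - F x <= e.
  have [x1|x1] := leP 1 x.
    exists (x + 1); first by rewrite ltrDl.
    by rewrite !question_mark_cdf_ge1 ?subrr ?(ltW e0)// ler_wpDr.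
  have [x0|x0] := ltP x 0.
    by exists 0 => //; rewrite !question_mark_cdf_le0 ?subrr ?(ltW x0) ?(ltW e0).
  have [n _ ne] : \forall n \near \oo, 2^-1 ^+ n <= e.
    have h : `|2^-1 : R| < 1 by rewrite ger0_norm// invf_lt1// ltr1n.
    move/cvgrPdist_le : (cvg_expr h) => /(_ _ e0).
    by apply: filterS => n /=; rewrite sub0r normrN ger0_norm// exprn_ge0.
  have [y /andP[xy y1] hy] := (qm_modulus n).1 x ltac:(by rewrite x0).
  exists y => //.
  rewrite !question_mark_cdfE ?x0 ?(ltW x1) ?y1 ?(le_trans x0 (ltW xy))//.
  by rewrite (le_trans hy)// -exprVn; apply: ne => /=.
near=> z.
have xz : x <= z by near: z; apply: nbhs_right_ge.
have zy : z <= y by near: z; apply: nbhs_right_le.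
rewrite distrC ger0_norm ?subr_ge0 ?question_mark_cdf_nd//.
by apply: le_trans ye; rewrite lerD2r question_mark_cdf_nd.
Unshelve. all: by end_near. Qed.

Lemma question_mark_cdf_Ny : F @ -oo --> (0:R).
Proof.
apply: cvg_near_cst; near=> x; apply: question_mark_cdf_le0.
by near: x; apply: nbhs_ninfty_le; rewrite num_real.
Unshelve. all: by end_near. Qed.

Lemma question_mark_cdf_y : F @ +oo --> (1:R).
Proof.
apply: cvg_near_cst; near=> x; apply: question_mark_cdf_ge1.
by near: x; apply: nbhs_pinfty_ge; rewrite num_real.
Unshelve. all: by end_near. Qed.

HB.instance Definition _ := isCumulative.Build R _ R question_mark_cdf
  question_mark_cdf_nd question_mark_cdf_rc.
HB.instance Definition _ := isCumulativeBounded.Build R 0 1 question_mark_cdf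
  question_mark_cdf_Ny question_mark_cdf_y.

Definition question_mark_measure : probability (measurableTypeR R) R :=
  lebesgue_stieltjes_measure (question_mark_cdf : cumulativeBounded 0 1).

(* e^(iu) for real u *)
Definition expi (u : R) : R[i] := Complex (cos u) (sin u).

Definition Cintegral (mu : {measure set (measurableTypeR R) -> \bar R})
    (D : set R) (f : R -> R[i]) : R[i] :=
  Complex (\int[mu]_(x in D) complex.Re (f x))
          (\int[mu]_(x in D) complex.Im (f x)).

(* t |-> m(it) *)
Definition question_mark_fourier (t : R) : R[i] :=
  Cintegral question_mark_measure `[0, 1] (fun x => expi (x * t)).

End MinkowskiQuestionMark.

Definition golden_ratio (R : realType) : R := (1 + Num.sqrt 5) / 2.

Definition decay_alpha (R : realType) : R := ln 2 / (2 * ln (golden_ratio R)).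

Definition decay_eta (R : realType) : R :=
  let a := decay_alpha R in (3 * a ^+ 2 - 1) / (3 * (1 + a) * (3 - a)).

(* Main.v *)
From HB Require Import structures.
Require Import Defs.
From mathcomp Require Import all_boot all_order all_algebra.
From mathcomp Require Import complex ring lra zify.
From mathcomp Require Import all_classical all_reals all_analysis.
From mathcomp Require Import measurable_realfun.

(** Let [mu] be the measure with distribution function [?].  It is invariant under
    the two branches [x / (1 + x)] and [1 / (1 + x)], each taken with probability
    1/2.  Composing branches along the words [w] of a stopping time, namely until the
    denominator [c x + d] of the composite [f_w] reaches size [Q], writes [m(it)] as
    the integral against [mu] of [F = \sum_w 2^-|w| e^(i t f_w)].  Up to a negligible
    set of words, [F] has frequency at most [M = |t| / D^2] with [D] close to [Q], so
    a Sobolev inequality on intervals of length [1 / M] together with Salem's bound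
    [mu (I) << |I|^alpha] gives
      [|m(it)|^2 << M^(1 - alpha) \int_0^1 |F|^2 dx].
    In the last integral the diagonal contributes [max_w 2^-|w| << Q^(-2 alpha)]; the
    pair [w, w'] has a phase whose derivative vanishes only with the linear function
    [(c - c') x + (d - d')], and since a word is determined by its denominator the
    van der Corput bounds can be summed over the lattice points [(c, d)].  With
    [|t| = Q^(3 (1 + alpha))] both contributions are [Q^(-2 alpha)], which gives the
    exponent [(3 alpha^2 - 1) / (6 (1 + alpha))].  It exceeds [decay_eta] because
    [alpha < 1], and this leaves room for the loss between [D] and [Q]. *)

Set Implicit Arguments.
Unset Strict Implicit.
Unset Printing Implicit Defensive.

Import Order.TTheory GRing.Theory Num.Theory.
Import numFieldNormedType.Exports.

Local Open Scope classical_set_scope.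
Local Open Scope ring_scope.

(** * Primitives on [[0, 1]] *)

Section Calculus.
Context {R : realType}.
Implicit Types (x y a b h : R) (f g p P G : R -> R).

(** The obstacle is the neutral fixed point 0 of x / (1 + x). Along a run of the letter [false] the
    denominator c x + d grows only through c, so c + d >= Q says nothing about its value d at x = 0,
    and |f_w'| may be as large as d^-2. Words with d < D are therefore set aside and estimated
    trivially. They end with a run of [false] whose length is comparable to A = Q / D, so their
    total weight is exponentially small in A, and A may be taken as a small power of |t|. Two
    splittings prepare the pair estimate. The first letter is separated because x / (1 + x) and 1 /
    (1 + x) have the same denominator, so that only the remaining letters can be recovered from (c,
    d). The other words are then divided by the sign of f_w'. Within one class the derivative of the
    phase of a pair is a multiple of the difference of l^-2 and l'^-2, which contains the factor l'
    - l, and the product of the two derivatives in |F'|^2 is positive. *)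

Definition primitive_on a b P p :=
  forall x, a <= x <= b -> is_derive x (1 : R) P (p x).

(** Continuity is two-sided even at 0 and 1, in agreement with the derivatives in [primitive_on].
    Precomposition with [clamp01] then gives a function continuous on the whole line, to which the
    fundamental theorem of calculus and measurability results apply. *)
Definition continuous01 f := forall x, 0 <= x <= 1 -> {for x, continuous f}.

Lemma clamp01_continuous : continuous (@clamp01 R).
Proof.
move=> x; rewrite /clamp01.
apply: (@continuous_min R R (fun x => Num.max x 0) (fun=> 1)); last exact: cvg_cst.
apply: (@continuous_max R R (fun x => x) (fun=> 0)); last exact: cvg_cst.
exact: cvg_id.
Qed.

Lemma clamp01_id x : 0 <= x <= 1 -> clamp01 x = x.
Proof. by case/andP=> x0 x1; rewrite /clamp01 max_l// min_l. Qed.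

Lemma continuous01_clamp f : continuous01 f -> continuous (f \o clamp01).
Proof.
move=> cf x; apply: continuous_comp; first exact: clamp01_continuous.
exact/cf/clamp01_itv.
Qed.

Lemma is_derive_continuous f df x : is_derive x (1 : R) f df -> {for x, continuous f}.
Proof.
by move=> h; apply/differentiable_continuous/derivable1_diffP; case: h.
Qed.

Lemma exists_primitive f : continuous01 f -> exists P, primitive_on 0 1 P f.
Proof.
move=> cf; have cfc := continuous01_clamp cf.
pose mu := @lebesgue_measure R.
(* Integrating from -1, on a range that extends to 2, makes every point of [0, 1] interior, so the
   derivative is two-sided at the end points as well. *)
exists (fun x => (\int[mu]_(t in [set` `[-1, x]]) (f \o clamp01) t)%R).
move=> x /andP[x0 x1].
have int : mu.-integrable `[(-1 : R), 2] (EFin \o (f \o clamp01)).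
  apply: continuous_compact_integrable; first exact: segment_compact.
  exact: continuous_subspaceT.
have x2 : x < 2 by lra.
have ax : -1 < x by lra.
have [dF eF] := continuous_FTC1_closed x2 int ax (cfc x).
split; first exact: dF.
by rewrite -derive1E eF /= clamp01_id// x0.
Qed.

(** Monotonicity of the integral in terms of primitives: the mean value theorem for [G - P].
    Lebesgue integrals over subintervals of [0, 1] appear from here on as increments of
    primitives. *)
Lemma ler_increment a b P p G g : a <= b ->
  primitive_on a b P p -> primitive_on a b G g ->
  (forall x, a <= x <= b -> p x <= g x) -> P b - P a <= G b - G a.
Proof.
move=> ab dP dG pg.
have dH x : a <= x <= b -> is_derive x (1 : R) (G - P) (g x - p x).
  by move=> xab; have := dP x xab; have := dG x xab => *; apply: is_deriveB.
have [|//|c cab] := @MVT_segment _ (G - P) (fun x => g x - p x) a b ab.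
- by move=> x; rewrite in_itv /= => /andP[? ?]; apply: dH; apply/andP; split; exact: ltW.
- apply: derivable_within_continuous => x; rewrite in_itv /= => xab.
  by have := dH x xab; case.
- move: cab; rewrite in_itv /= => /pg; rewrite -subr_ge0 => h.
  have : 0 <= (g c - p c) * (b - a) by apply: mulr_ge0 => //; rewrite subr_ge0.
  move=> h2 e; move: h2; rewrite -e /=.
  rewrite -[(G - P) b]/(G b - P b) -[(G - P) a]/(G a - P a); lra.
Qed.

Lemma norm_increment a b P p G g : a <= b ->
  primitive_on a b P p -> primitive_on a b G g ->
  (forall x, a <= x <= b -> `|p x| <= g x) -> `|P b - P a| <= G b - G a.
Proof.
move=> ab dP dG pg; rewrite ler_norml; apply/andP; split; last first.
  by apply: (ler_increment ab dP dG) => x /pg; apply: le_trans; exact: ler_norm.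
rewrite lerNl opprB.
have -> : P a - P b = (- P) b - (- P) a.
  by rewrite -[(- P) b]/(- P b) -[(- P) a]/(- P a) opprK addrC.
apply: (ler_increment (p := fun x => - p x) ab _ dG).
  by move=> x /dP d; exact: is_deriveN.
by move=> x /pg; apply: le_trans; rewrite -normrN ler_norm.
Qed.

End Calculus.

(** * A Sobolev inequality on short intervals *)

Section Osc.
Context {R : realType}.
Implicit Types (x y a b h : R) (f g p P G : R -> R).

Lemma primitive_onS a b a' b' P p : a <= a' -> b' <= b ->
  primitive_on a b P p -> primitive_on a' b' P p.
Proof.
by move=> aa bb dP x /andP[h1 h2]; apply: dP; rewrite (le_trans aa)//= (le_trans h2).
Qed.

(* Sobolev's inequality [sup |F|^2 <= (2/h) \int |F|^2 + h \int |F'|^2] on an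
   interval of length [h], for [F = U + iV]. *)
Lemma sqr_le_increment a h U V u v E1 E2 x : 0 < h ->
  primitive_on a (a + h) U u -> primitive_on a (a + h) V v ->
  primitive_on a (a + h) E1 (fun z => U z ^+ 2 + V z ^+ 2) ->
  primitive_on a (a + h) E2 (fun z => u z ^+ 2 + v z ^+ 2) ->
  a <= x <= a + h ->
  U x ^+ 2 + V x ^+ 2 <=
    2 / h * (E1 (a + h) - E1 a) + h * (E2 (a + h) - E2 a).
Proof.
move=> h0 dU dV dE1 dE2 xab; set b := a + h.
have ab : a <= b by rewrite lerDl ltW.
pose E z := U z ^+ 2 + V z ^+ 2.
pose J z := h^-1 * E1 z + h * E2 z.
have dE : primitive_on a b E (fun z => 2 * (U z * u z) + 2 * (V z * v z)).
  move=> z zab; have := dU _ zab; have := dV _ zab => dVz dUz.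
  by apply: is_derive_eq; rewrite /GRing.scale /=; ring.
pose j z := h^-1 * E z + h * (u z ^+ 2 + v z ^+ 2).
have dJ : primitive_on a b J j.
  move=> z zab; have := dE1 _ zab; have := dE2 _ zab => d2 d1.
  by apply: is_derive_eq; rewrite /GRing.scale /= /j/E; ring.
have Ej z : a <= z <= b -> `|2 * (U z * u z) + 2 * (V z * v z)| <= j z.
  move=> _; have hh : h^-1 * h = 1 by rewrite mulVf// gt_eqF.
  have hp : 0 < h^-1 by rewrite invr_gt0.
  have key (A B : R) : `|2 * (A * B)| <= h^-1 * A ^+ 2 + h * B ^+ 2.
    have e1 : 0 <= h^-1 * (A - h * B) ^+ 2 by rewrite mulr_ge0 ?sqr_ge0// ltW.
    have e2 : 0 <= h^-1 * (A + h * B) ^+ 2 by rewrite mulr_ge0 ?sqr_ge0// ltW.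
    have q1 : h^-1 * (A - h * B) ^+ 2 = h^-1 * A ^+ 2 + (h^-1 * h) * (h * B ^+ 2 - 2 * (A * B)) by ring.
    have q2 : h^-1 * (A + h * B) ^+ 2 = h^-1 * A ^+ 2 + (h^-1 * h) * (h * B ^+ 2 + 2 * (A * B)) by ring.
    move: e1 e2; rewrite q1 q2 hh !mul1r => e1 e2.
    by rewrite ler_norml; apply/andP; split; lra.
  apply: le_trans (ler_normD _ _) _.
  apply: le_trans (lerD (key _ _) (key _ _)) _; rewrite /j /E le_eqVlt; apply/orP; left.
  by apply/eqP; ring.
have jge0 z : 0 <= j z.
  by rewrite /j/E addr_ge0// mulr_ge0 ?invr_ge0 ?addr_ge0 ?sqr_ge0// ltW.
have J_homo y z : a <= y -> y <= z -> z <= b -> J y <= J z.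
  move=> ay yz zb; rewrite -subr_ge0.
  have := @ler_increment R y z (cst 0) (cst 0) J j yz _ (primitive_onS ay zb dJ).
  by rewrite /= subrr; apply => // w _; exact: is_derive_cst.
(* [J] majorizes the variation of [E], hence this lower bound at every [z]. Integrated over the
   interval, it bounds [E x] by the mean of [E] plus [J b - J a]; the mean and the first term of [J]
   together give the factor 2. *)
have Ediff z : a <= z <= b -> E x - (J b - J a) <= E z.
  move: xab => /andP[ax xb] /andP[az zb].
  have [xz|/ltW zx] := leP x z.
    have := @norm_increment R x z _ _ _ _ xz (primitive_onS ax zb dE) (primitive_onS ax zb dJ).
    move=> /(_ (fun w hw => Ej w ltac:(case/andP: hw => ? ?; rewrite (le_trans ax)//= (le_trans _ zb)//))).
    have := J_homo _ _ (lexx a) ax xb; have := J_homo _ _ az zb (lexx b).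
    by rewrite ler_norml => ? ? /andP[? _]; lra.
  have := @norm_increment R z x _ _ _ _ zx (primitive_onS az xb dE) (primitive_onS az xb dJ).
  move=> /(_ (fun w hw => Ej w ltac:(case/andP: hw => ? ?; rewrite (le_trans az)//= (le_trans _ xb)//))).
  have := J_homo _ _ (lexx a) az zb; have := J_homo _ _ ax xb (lexx b).
  by rewrite ler_norml => ? ? /andP[_ ?]; lra.
have : (E x - (J b - J a)) * h <= E1 b - E1 a.
  have := @ler_increment R a b (fun z => (E x - (J b - J a)) * z) _ _ _ ab _ dE1 Ediff.
  have -> : (E x - (J b - J a)) * b - (E x - (J b - J a)) * a = (E x - (J b - J a)) * h.
    by rewrite /b; ring.
  apply; move=> z _; apply: is_derive_eq; rewrite /GRing.scale /=; ring.
rewrite -ler_pdivlMr// => hE.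
rewrite -[leLHS]/(E x).
have -> : 2 / h * (E1 b - E1 a) + h * (E2 b - E2 a) =
   (E1 b - E1 a) / h + (J b - J a) by rewrite /J; ring.
by move: hE; lra.
Qed.
End Osc.

(** * Oscillatory integrals *)

Section Split.
Context {R : realType}.

(* Away from a neighbourhood of radius [delta / |u|] of the zero of [u x + v] the
   first bound applies, and [delta] balances the two contributions. *)
Lemma stationary_phase (Psi : R -> R) (u v a0 X w : R) :
  0 < a0 -> 0 < X -> 0 < w ->
  (forall delta x1 x2 : R, 0 < delta -> 0 <= x1 -> x1 <= x2 -> x2 <= 1 ->
    (forall x : R, x1 <= x <= x2 -> delta <= `|u * x + v|) ->
    `|Psi x2 - Psi x1| <= 5 * X / delta) ->
  (forall x1 x2 : R, 0 <= x1 -> x1 <= x2 -> x2 <= 1 ->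
    `|Psi x2 - Psi x1| <= a0 * (x2 - x1)) ->
  2 * `|u| <= `|v| /\ w <= `|v| \/ `|v| < 2 * `|u| /\ w <= `|u| ->
  `|Psi 1 - Psi 0| <= 12 * Num.sqrt (a0 * X / w).
Proof.
move=> a00 X0 w0 H1 H2 uvw.
have sqr_bd (Z Y : R) : 0 <= Z -> Z ^+ 2 <= 144 * Y -> Z <= 12 * Num.sqrt Y.
  move=> Z0 ZY; rewrite -(ger0_norm Z0) -sqrtr_sqr.
  have -> : 12 = Num.sqrt (12 ^+ 2) :> R by rewrite sqrtr_sqr ger0_norm.
  rewrite -sqrtrM ?sqr_ge0// ler_wsqrtr//; move: ZY; lra.
have aX0 : 0 < a0 * X by rewrite mulr_gt0.
have wmono (z : R) : w <= z -> a0 * X / z <= a0 * X / w.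
  by move=> wz; rewrite ler_pM2l// lef_pV2// posrE// (lt_le_trans w0).
case: uvw => [[uv wv]|[uv wu]].
  (* Here |u x + v| >= |v| / 2 on all of [0, 1]. The square is bounded by the product of [H1] for
     delta = |v| / 2 and the trivial bound [a0]. *)
  have v0 : 0 < `|v| by exact: lt_le_trans wv.
  have b1 : `|Psi 1 - Psi 0| <= 5 * X / (`|v| / 2).
    apply: H1 => //; first by rewrite divr_gt0.
    move=> x /andP[x0 x1]; have ux : `|u * x| <= `|u| by rewrite normrM ler_piMr// ger0_norm.
    have h1 : `|v| - `|u * x| <= `|u * x + v| by rewrite [u * x + v]addrC lerB_normD.
    by have := normr_ge0 u; lra.
  have b2 : `|Psi 1 - Psi 0| <= a0 by have := H2 0 1; rewrite subr0 mulr1; apply.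
  apply: sqr_bd => //; apply: (@le_trans _ _ (a0 * (5 * X / (`|v| / 2)))).
    by rewrite expr2 ler_pM.
  apply: (@le_trans _ _ (10 * (a0 * X / `|v|))).
    rewrite le_eqVlt; apply/orP; left; apply/eqP; field; by rewrite gt_eqF.
  apply: (@le_trans _ _ (10 * (a0 * X / w))); first by rewrite ler_wpM2l// wmono.
  have : 0 < a0 * X / w by rewrite divr_gt0.
  lra.
have u0 : 0 < `|u| by exact: lt_le_trans wu.
have uN0 : u != 0 by rewrite -normr_gt0.
pose delta := Num.sqrt (X * `|u| / a0).
have de2 : delta ^+ 2 = X * `|u| / a0.
  by rewrite sqr_sqrtr// ltW// divr_gt0// mulr_gt0.
have de0 : 0 < delta by rewrite sqrtr_gt0 divr_gt0// mulr_gt0.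
pose r := delta / `|u|.
have r0 : 0 < r by rewrite divr_gt0.
pose x0 := - v / u.
have LE (x : R) : `|u * x + v| = `|u| * `|x - x0|.
  rewrite -normrM; congr `|_|; rewrite /x0; field; exact: uN0.
(* Clamping both ends of the neighbourhood to [0, 1] treats all positions of the zero [x0] at once;
   a piece that falls outside becomes trivial. *)
have /andP[y10 y11] := clamp01_itv (x0 - r).
have /andP[y20 y21] := clamp01_itv (x0 + r).
have y12 : clamp01 (x0 - r) <= clamp01 (x0 + r) by apply: clamp01_homo; lra.
have A1 : `|Psi (clamp01 (x0 - r)) - Psi 0| <= 5 * X / delta.
  have [neg|pos] := leP (x0 - r) 0.
    rewrite (_ : clamp01 _ = 0) ?subrr ?normr0; last by rewrite /clamp01 max_r// min_l.
    by rewrite divr_ge0// ?mulr_ge0// ltW.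
  apply: H1 => // x /andP[x0' x1']; rewrite LE.
  have xx : x <= x0 - r.
    apply: (le_trans x1'); rewrite /clamp01 max_l; last exact: ltW.
    by rewrite ge_min lexx.
  rewrite -ler_pdivrMl// mulrC -/r distrC ger0_norm; lra.
have A2 : `|Psi 1 - Psi (clamp01 (x0 + r))| <= 5 * X / delta.
  have [pos|neg] := leP 1 (x0 + r).
    rewrite (_ : clamp01 _ = 1) ?subrr ?normr0; last first.
      by rewrite /clamp01 max_l ?min_r// (le_trans _ pos).
    by rewrite divr_ge0// ?mulr_ge0// ltW.
  apply: H1 => // x /andP[x0' x1']; rewrite LE.
  have xx : x0 + r <= x.
    apply: (le_trans _ x0'); rewrite /clamp01 min_l; first by rewrite le_max lexx.
    by rewrite ge_max (ltW neg) ler01.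
  rewrite -ler_pdivrMl// mulrC -/r ger0_norm; lra.
have A3 : `|Psi (clamp01 (x0 + r)) - Psi (clamp01 (x0 - r))| <= a0 * (2 * r).
  apply: (le_trans (H2 _ _ y10 y12 y21)); rewrite ler_pM2l//.
  have [h|/ltW h] := leP 0 (x0 + r); last first.
    have e : clamp01 (x0 + r) = 0 by rewrite /clamp01 max_r// min_l.
    by rewrite e; lra.
  have h1 : clamp01 (x0 + r) <= x0 + r by rewrite /clamp01 max_l// ge_min lexx.
  have [k|/ltW k] := leP (x0 - r) 1; last first.
    have e : clamp01 (x0 - r) = 1.
      by rewrite /clamp01 max_l ?min_r// (le_trans _ k).
    by rewrite e; lra.
  have h2 : x0 - r <= clamp01 (x0 - r).
    by rewrite /clamp01 le_min k andbT le_max lexx.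
  by lra.
(* By the choice of [delta], X / delta = a0 r: the outer pieces cost 5 a0 r each and the middle one
   2 a0 r. *)
apply: (@le_trans _ _ (12 * a0 * r)).
  have e : X / delta = a0 * r.
    rewrite /r; have -> : X = delta ^+ 2 * a0 / `|u|.
      by rewrite de2; field; rewrite !gt_eqF.
    by field; rewrite !gt_eqF.
  move: A1 A2 A3; rewrite -!mulrA e !mulrA => A1 A2 A3.
  have := ler_normD (Psi 1 - Psi (clamp01 (x0 + r))) (Psi (clamp01 (x0 + r)) - Psi (clamp01 (x0 - r))).
  have := ler_normD (Psi 1 - Psi (clamp01 (x0 - r))) (Psi (clamp01 (x0 - r)) - Psi 0).
  rewrite !subrKA => B1 B2.
  move: A1 A2 A3 B1 B2; lra.
apply: sqr_bd; first by rewrite !mulr_ge0// ltW.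
apply: (@le_trans _ _ (144 * (a0 * X / `|u|))); last by rewrite ler_wpM2l// wmono.
rewrite /r !exprMn exprVn de2 le_eqVlt; apply/orP; left; apply/eqP.
by field; rewrite !gt_eqF.
Qed.
End Split.

Section Pair.
Context {R : realType}.

(* Van der Corput's estimate for a phase [psi] with
   [psi' = s (l^-2 - l'^-2) = s (l' - l) (l' + l) / (l l')^2], which is stationary
   only at the zero of the linear function [l' - l = u x + v]. *)
Lemma oscillatory_pair (c d c' d' Q D s t a0 N0 w : R) (psi Psi amp N n : R -> R)
  (u := c' - c) (v := d' - d) :
  0 < D -> D <= Q -> t != 0 -> s * s = 1 -> 0 < N0 -> 0 < a0 ->
  0 <= c <= 2 * Q -> 0 <= c' <= 2 * Q ->
  (forall x : R, 0 <= x <= 1 -> D <= c * x + d) ->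
  (forall x : R, 0 <= x <= 1 -> D <= c' * x + d') ->
  primitive_on 0 1 psi (fun x : R => s * (((c * x + d) ^+ 2)^-1 - ((c' * x + d') ^+ 2)^-1)) ->
  primitive_on 0 1 N n ->
  (forall x : R, 0 <= x <= 1 -> `|N x| <= N0) ->
  (forall x : R, 0 <= x <= 1 -> `|n x| <= 4 * N0) ->
  (forall x : R, 0 <= x <= 1 -> amp x = N x / ((c * x + d) * (c' * x + d')) ^+ 2) ->
  (forall x : R, 0 <= x <= 1 -> `|amp x| <= a0) ->
  primitive_on 0 1 Psi (fun x => amp x * cos (t * psi x)) ->
  0 < w ->
  2 * `|u| <= `|v| /\ w <= `|v| \/ `|v| < 2 * `|u| /\ w <= `|u| ->
  `|Psi 1 - Psi 0| <= 12 * Num.sqrt (a0 * (N0 * Q / (D ^+ 2 * `|t|)) / w).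
Proof.
move=> D0 DQ t0 ss N00 a00 cb c'b lD l'D dpsi dN Nb nb ampE ampb dPsi w0 uvw.
pose l (x : R) : R := c * x + d.
pose l' (x : R) : R := c' * x + d'.
pose X := N0 * Q / (D ^+ 2 * `|t|).
have Q0 : 0 < Q by exact: lt_le_trans DQ.
have at0 : 0 < `|t| by rewrite normr_gt0.
(* Integration by parts: [amp cos (t psi) = (k sin (t psi) / t)' - k' sin (t psi) / t]
   for [k = amp / psi' = N / (s (l' - l) (l' + l))]. *)
have lD' (x : R) : 0 <= x <= 1 -> D <= l x by exact: lD.
have l'D' (x : R) : 0 <= x <= 1 -> D <= l' x by exact: l'D.
have nonstationary (delta x1 x2 : R) : 0 < delta -> 0 <= x1 -> x1 <= x2 -> x2 <= 1 ->
    (forall x : R, x1 <= x <= x2 -> delta <= `|u * x + v|) ->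
    `|Psi x2 - Psi x1| <= 5 * X / delta.
  move=> de0 x10 x12 x21 hL.
  have in01 x : x1 <= x <= x2 -> 0 <= x <= 1.
    by case/andP=> ? ?; rewrite (le_trans x10)//= (le_trans _ x21).
  pose L (x : R) : R := u * x + v.
  pose S (x : R) : R := (c + c') * x + (d + d').
  have LE x : L x = l' x - l x by rewrite /L /l /l' /u /v; ring.
  have SE x : S x = l x + l' x by rewrite /S /l /l'; ring.
  have S2D x : x1 <= x <= x2 -> 2 * D <= S x.
    by move=> /in01 xx; rewrite SE; have := lD' _ xx; have := l'D' _ xx; lra.
  have L0 x : x1 <= x <= x2 -> L x != 0.
    by move=> /hL; rewrite -normr_gt0; apply: lt_le_trans.
  have S0 x : x1 <= x <= x2 -> S x != 0.
    by move=> /S2D h; rewrite gt_eqF//; lra.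
  have l0 (x : R) : 0 <= x <= 1 -> l x != 0.
    by move=> /lD' h; rewrite gt_eqF//; lra.
  have l'0 (x : R) : 0 <= x <= 1 -> l' x != 0.
    by move=> /l'D' h; rewrite gt_eqF//; lra.
  pose k (x : R) : R := N x * s * (L x)^-1 * (S x)^-1.
  pose k' (x : R) : R := n x * s * (L x)^-1 * (S x)^-1 - N x * s * (u / L x ^+ 2) * (S x)^-1
     - N x * s * (L x)^-1 * ((c + c') / S x ^+ 2).
  (* A pointwise bound |u| / delta^2 for the term u / L^2 of [k'] would be too weak. As L has no
     zero here, -sg(u) / L is a primitive of |u| / L^2, and its increment is at most 2 / delta
     whatever the size of u. *)
  pose G (x : R) : R := `|t|^-1 * ((2 * N0 / (delta * D) + N0 * Q / (delta * D ^+ 2)) * x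
        - (N0 / (2 * D)) * (Num.sg u * (L x)^-1)).
  pose g (x : R) : R := `|t|^-1 * ((2 * N0 / (delta * D) + N0 * Q / (delta * D ^+ 2))
        + (N0 / (2 * D)) * (`|u| / L x ^+ 2)).
  pose Theta (x : R) : R := t^-1 * (k x * sin (t * psi x)).
  have dL x : is_derive x (1 : R) L u.
    by apply: is_derive_eq; rewrite /GRing.scale/=; ring.
  have dS x : is_derive x (1 : R) S (c + c').
    by apply: is_derive_eq; rewrite /GRing.scale/=; ring.
  have dH : primitive_on x1 x2 (Psi - Theta) (fun x => - (t^-1 * (k' x * sin (t * psi x)))).
    move=> x xx; have x01 := in01 _ xx; have h1 := dPsi _ x01; have h2 := dN _ x01; have h3 := dpsi _ x01.
    have h4 := is_deriveV (L0 _ xx); have h5 := is_deriveV (S0 _ xx).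
    have h6 : is_derive x (1 : R) (fun y => sin (t * psi y))
        (cos (t * psi x) * (t * (s * ((l x ^+ 2)^-1 - (l' x ^+ 2)^-1)))).
      exact: (@is_derive1_comp _ sin (fun y => t * psi y)).
    have hk : is_derive x (1 : R) k (k' x).
      by rewrite /k; apply: is_derive_eq; rewrite /GRing.scale/= /k'; ring.
    have hT : is_derive x (1 : R) Theta
        (t^-1 * (k' x * sin (t * psi x) +
         k x * (cos (t * psi x) * (t * (s * ((l x ^+ 2)^-1 - (l' x ^+ 2)^-1)))))).
      rewrite /Theta; apply: is_derive_eq; rewrite /GRing.scale/=; ring.
    apply: (is_derive_eq (is_deriveB h1 hT)).
    have -> : amp x = k x * (s * ((l x ^+ 2)^-1 - (l' x ^+ 2)^-1)).
      have e : (l x ^+ 2)^-1 - (l' x ^+ 2)^-1 = L x * S x / (l x * l' x) ^+ 2.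
        rewrite LE SE; field; rewrite ?l0 ?l'0//.
      rewrite ampE// e /k.
      transitivity (N x * (s * s) / (l x * l' x) ^+ 2); first by rewrite ss mulr1.
      by field; rewrite ?L0 ?S0 ?l0 ?l'0.
    by set q := s * _; field; rewrite t0.
  have dG : primitive_on x1 x2 G g.
    move=> x xx; have h4 := is_deriveV (L0 _ xx); rewrite /G.
    by apply: is_derive_eq; rewrite /GRing.scale/= /g [`|u|]normrEsg; ring.
  have s1 : `|s| = 1.
    by apply/eqP; rewrite -(@eqrXn2 _ 2)// expr1n expr2 -normrM ss normr1.
  have D2 : 0 < 2 * D by rewrite mulr_gt0.
  have iL (x : R) : x1 <= x <= x2 -> `|(L x)^-1| <= delta^-1.
    by move=> /hL h; rewrite normfV lef_pV2 ?posrE// (lt_le_trans de0).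
  have iS (x : R) : x1 <= x <= x2 -> 0 < (S x)^-1 <= (2 * D)^-1.
    by move=> /S2D h; rewrite invr_gt0 lef_pV2 ?posrE// (lt_le_trans D2) ?h.
  have k_le (x : R) : x1 <= x <= x2 -> `|k x| <= N0 * delta^-1 * (2 * D)^-1.
    move=> xx; rewrite /k !normrM s1 mulr1.
    have /andP[iS0 iS1] := iS x xx; rewrite (ger0_norm (ltW iS0)).
    apply: ler_pM; rewrite ?(ltW iS0) ?mulr_ge0 ?invr_ge0 ?sqr_ge0 ?normr_ge0 //.
    by apply: ler_pM => //; [exact/Nb/in01|exact: iL].
  have k'_le (x : R) : x1 <= x <= x2 ->
      `|k' x| <= 2 * N0 / (delta * D) + N0 * Q / (delta * D ^+ 2) +
        (N0 / (2 * D)) * (`|u| / L x ^+ 2).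
    move=> xx; have x01 := in01 _ xx.
    have /andP[iS0 iS1] := iS x xx; have iLx := iL x xx.
    have Nx := Nb _ x01; have nx := nb _ x01.
    have e1 : `|n x * s * (L x)^-1 * (S x)^-1| <= 4 * N0 * delta^-1 * (2 * D)^-1.
      rewrite !normrM s1 mulr1 (ger0_norm (ltW iS0)).
      by apply: ler_pM; rewrite ?(ltW iS0) ?mulr_ge0 ?invr_ge0 ?sqr_ge0 ?normr_ge0 //; apply: ler_pM.
    have e2 : `|N x * s * (u / L x ^+ 2) * (S x)^-1| <= N0 * (`|u| / L x ^+ 2) * (2 * D)^-1.
      rewrite !normrM s1 mulr1 (ger0_norm (ltW iS0)) (@ger0_norm _ (_ ^- 2)) ?invr_ge0 ?sqr_ge0//.
      by apply: ler_pM; rewrite ?(ltW iS0) ?mulr_ge0 ?invr_ge0 ?sqr_ge0 ?normr_ge0 //; apply: ler_pM; rewrite ?mulr_ge0 ?invr_ge0 ?sqr_ge0 ?(ltW iS0) ?normr_ge0 //.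
    have e3 : `|N x * s * (L x)^-1 * ((c + c') / S x ^+ 2)| <=
        N0 * delta^-1 * (4 * Q * (2 * D)^-1 ^+ 2).
      rewrite !normrM s1 mulr1.
      have cc0 : 0 <= c + c' by move: cb c'b => /andP[? ?] /andP[? ?]; lra.
      have cc4 : c + c' <= 4 * Q by move: cb c'b => /andP[? ?] /andP[? ?]; lra.
      rewrite (ger0_norm cc0) (@ger0_norm _ (_ ^- 2)) ?invr_ge0 ?sqr_ge0//.
      apply: ler_pM; rewrite ?(ltW iS0) ?mulr_ge0 ?invr_ge0 ?sqr_ge0 ?normr_ge0 //; first exact: ler_pM.
      apply: ler_pM; rewrite ?(ltW iS0) ?mulr_ge0 ?invr_ge0 ?sqr_ge0 ?normr_ge0 //.
      by rewrite -exprVn ler_pXn2r// nnegrE ltW// invr_gt0.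
    rewrite /k' -addrA -opprD; apply: (le_trans (ler_normB _ _)).
    apply: (le_trans (lerD e1 (le_trans (ler_normD _ _) (lerD e2 e3)))).
    rewrite le_eqVlt; apply/orP; left; apply/eqP.
    have -> : (2 * D)^-1 = 2^-1 * D^-1 by rewrite invfM.
    have -> : (delta * D ^+ 2)^-1 = delta^-1 * D^-1 ^+ 2 by rewrite invfM exprVn.
    have -> : (delta * D)^-1 = delta^-1 * D^-1 by rewrite invfM.
    by field; rewrite ?L0 ?(gt_eqF D0) ?(gt_eqF de0) ?(gt_eqF at0).
  have h1 : `|(Psi - Theta) x2 - (Psi - Theta) x1| <= G x2 - G x1.
    apply: (norm_increment x12 dH dG) => x xx.
    rewrite normrN normrM normfV /g ler_wpM2l ?invr_ge0 ?(ltW at0)// normrM.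
    apply: (le_trans _ (k'_le x xx)); rewrite -[leRHS]mulr1 ler_wpM2l//.
    by rewrite ler_norml sin_geN1 sin_le1.
  have x1x : x1 <= x1 <= x2 by rewrite lexx.
  have x2x : x1 <= x2 <= x2 by rewrite lexx x12.
  have sgL (x : R) : x1 <= x <= x2 -> `|Num.sg u * (L x)^-1| <= delta^-1.
    move=> xx; rewrite normrM; apply: (le_trans _ (iL x xx)).
    by rewrite -[leRHS]mul1r ler_wpM2r// normr_sg; case: (u != 0).
  have Theta_le (x : R) : x1 <= x <= x2 -> `|Theta x| <= `|t|^-1 * (N0 * delta^-1 * (2 * D)^-1).
    move=> xx; rewrite /Theta normrM normfV ler_wpM2l ?invr_ge0 ?(ltW at0)// normrM.
    apply: (le_trans _ (k_le x xx)); rewrite -[leRHS]mulr1 ler_wpM2l//.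
    by rewrite ler_norml sin_geN1 sin_le1.
  have := sgL x1 x1x; have := sgL x2 x2x; have := Theta_le _ x1x; have := Theta_le _ x2x.
  move: h1; rewrite -[(Psi - Theta) x2]/(Psi x2 - Theta x2) -[(Psi - Theta) x1]/(Psi x1 - Theta x1).
  rewrite !ler_norml => /andP[a1 a2] /andP[b1 b2] /andP[c1 c2] /andP[d1 d2] /andP[e1 e2].
  have hG : G x2 - G x1 <= `|t|^-1 *
      ((2 * N0 / (delta * D) + N0 * Q / (delta * D ^+ 2)) + N0 / (2 * D) * (2 * delta^-1)).
    rewrite /G -mulrBr ler_wpM2l ?invr_ge0 ?(ltW at0)//.
    have A0 : 0 <= 2 * N0 / (delta * D) + N0 * Q / (delta * D ^+ 2).
      by rewrite addr_ge0// !mulr_ge0 ?invr_ge0 ?mulr_ge0 ?exprn_ge0// ltW.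
    have B0 : 0 <= N0 / (2 * D) by rewrite mulr_ge0 ?invr_ge0 ?mulr_ge0// ltW.
    move: A0 B0 d1 d2 e1 e2.
    move: (_ + N0 * Q / _) (N0 / (2 * D)) (_ / L x1) (_ / L x2) (delta^-1) => A B y z p.
    by nra.
  (* [D <= Q] absorbs four terms N0 / (delta D) into N0 Q / (delta D^2), which already occurs once:
     hence the constant 5. *)
  have key : `|t|^-1 * ((2 * N0 / (delta * D) + N0 * Q / (delta * D ^+ 2)) +
      N0 / (2 * D) * (2 * delta^-1)) + 2 * (`|t|^-1 * (N0 * delta^-1 * (2 * D)^-1)) <= 5 * X / delta.
    have -> : X = N0 * Q * (D^-1 ^+ 2 * `|t|^-1) by rewrite /X invfM exprVn.
    have -> : (2 * D)^-1 = 2^-1 * D^-1 by rewrite invfM.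
    have -> : (delta * D ^+ 2)^-1 = delta^-1 * D^-1 ^+ 2 by rewrite invfM exprVn.
    have -> : (delta * D)^-1 = delta^-1 * D^-1 by rewrite invfM.
    have q1 : 1 <= Q * D^-1 by rewrite ler_pdivlMr ?mul1r.
    have c0 : 0 <= 4 * `|t|^-1 * N0 * delta^-1 * D^-1 * (Q * D^-1 - 1).
      by rewrite mulr_ge0 ?subr_ge0// !mulr_ge0 ?invr_ge0// ltW.
    rewrite -subr_ge0; apply: (le_trans c0); rewrite le_eqVlt; apply/orP; left; apply/eqP.
    by field; rewrite ?L0 ?(gt_eqF D0) ?(gt_eqF de0) ?(gt_eqF at0).
  by apply/andP; split; lra.
have X0 : 0 < X by rewrite divr_gt0 ?mulr_gt0 ?exprn_gt0.
apply: (@stationary_phase R Psi u v a0 X w) => //.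
move=> x1 x2 x10 x12 x21.
rewrite mulrBr.
apply: (@norm_increment R x1 x2 Psi _ (fun y => a0 * y) (cst a0) x12 (primitive_onS x10 x21 dPsi)).
  by move=> x _; apply: is_derive_eq; rewrite /GRing.scale/=; ring.
move=> x /andP[h1 h2]; rewrite normrM -[leRHS]mulr1.
apply: ler_pM => //; first by apply: ampb; rewrite (le_trans x10)//= (le_trans h2).
by rewrite ler_norml cos_geN1 cos_le1.
Qed.
End Pair.

(** * Salem's Hoelder bound *)

Section Hoelder.
Context {R : realType}.
Local Notation Q := (@question_mark R).
Local Notation phi := (golden_ratio R).
Local Notation alpha := (decay_alpha R).

(** The inverse branches of the Farey map. On continued fractions, [false] adds 1 to the first
    partial quotient and [true] inserts a quotient 1 in front. *)
Definition mob (e : bool) (x : R) : R := if e then (1 + x)^-1 else x / (1 + x).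

Lemma golden_ratio_eq : phi ^+ 2 = phi + 1.
Proof.
rewrite /golden_ratio; have : Num.sqrt 5 ^+ 2 = 5 :> R by rewrite sqr_sqrtr.
by move: (Num.sqrt 5) => z h; apply/eqP; rewrite -subr_eq0; apply/eqP; field : h => //; nra.
Qed.

Lemma golden_ratio_itv : 1618/1000 < phi < 1619/1000.
Proof.
have h := golden_ratio_eq.
have : 0 < phi by rewrite /golden_ratio divr_gt0// addr_gt0// sqrtr_gt0.
by move: h; move: phi => z h z0; apply/andP; split; nra.
Qed.

Lemma golden_ratio_gt1 : 1 < phi.
Proof. by have /andP[h _] := golden_ratio_itv; lra. Qed.

Lemma ln_golden_gt0 : 0 < ln phi.
Proof. by rewrite ln_gt0// golden_ratio_gt1. Qed.

Lemma alpha_gt0 : 0 < alpha.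
Proof.
by rewrite /decay_alpha divr_gt0 ?ln_gt0 ?ltr1n// mulr_gt0// ln_golden_gt0.
Qed.

Lemma golden_powR : phi `^ (2 * alpha) = 2.
Proof.
rewrite /powR gt_eqF; last by have := golden_ratio_gt1; lra.
have -> : 2 * alpha * ln phi = ln 2.
  by rewrite /decay_alpha; field; rewrite gt_eqF// ln_golden_gt0.
by rewrite lnK// posrE.
Qed.

(** Equivalent to phi^6 <= 2^5, where phi^6 = 8 phi + 5. A lower bound above 1 / sqrt 3 is what
    makes 3 alpha^2 - 1 positive. *)
Lemma alpha_ge : 3/5 <= alpha.
Proof.
have l0 := ln_golden_gt0.
rewrite /decay_alpha ler_pdivlMr ?mulr_gt0//.
suff : 6 * ln phi <= 5 * ln 2 by lra.
have p0 : 0 < phi by have := golden_ratio_gt1; lra.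
rewrite !mulr_natl -!lnXn// ler_ln ?posrE ?exprn_gt0//.
have h := golden_ratio_eq; have /andP[h1 h2] := golden_ratio_itv.
have -> : phi ^+ 6 = (phi ^+ 2) ^+ 3 by rewrite -exprM.
rewrite h.
have -> : (phi + 1) ^+ 3 = phi ^+ 2 * phi + 3 * phi ^+ 2 + 3 * phi + 1 by ring.
rewrite h; have -> : (phi + 1) * phi = phi ^+ 2 + phi by ring.
by rewrite h; lra.
Qed.

Lemma alpha_lt1 : alpha < 1.
Proof.
have l0 := ln_golden_gt0.
have p0 : 0 < phi by have := golden_ratio_gt1; lra.
rewrite /decay_alpha ltr_pdivrMr ?mulr_gt0// mul1r mulr_natl -lnXn//.
rewrite ltr_ln ?posrE ?exprn_gt0// golden_ratio_eq.
by have /andP[h1 h2] := golden_ratio_itv; lra.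
Qed.

Lemma question_mark_mob (e : bool) (x : R) : 0 <= x <= 1 ->
  Q (mob e x) = if e then 1 - Q x / 2 else Q x / 2.
Proof.
move=> /andP[x0 x1]; case: e => /=; last first.
  have [->|xN0] := eqVneq x 0; first by rewrite mul0r question_mark0 mul0r.
  have xgt0 : 0 < x by rewrite lt_neqAle eq_sym xN0.
  rewrite (@question_mark_rec _ x) ?xgt0// (@question_mark_rec _ (x / (1 + x))); last first.
    by rewrite divr_gt0 ?addr_gt0//= ler_pdivrMr ?addr_gt0// mul1r lerDr.
  have -> : (x / (1 + x))^-1 = 1 + x^-1 by field; rewrite xN0 gt_eqF// addr_gt0.
  have tE : Num.truncn (1 + x^-1) = (Num.truncn x^-1).+1.
    have /truncn_itv /andP[h1 h2] : 0 <= x^-1 by rewrite invr_ge0.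
    apply: truncn_def; move: h1 h2; rewrite -!natr1; lra.
  have -> : gauss_map (x / (1 + x)) = gauss_map x.
    rewrite /gauss_map.
    have -> : (x / (1 + x))^-1 = 1 + x^-1 by field; rewrite xN0 gt_eqF// addr_gt0.
    by rewrite tE -natr1; ring.
  by rewrite tE exprS; field; rewrite expf_neq0.
(* For x = 1 the image 1/2 has the expansion [0, 2] and not [0, 1, 1], so [gauss_map_inv] does not
   apply. *)
have [->|xN1] := eqVneq x 1.
  rewrite (@question_mark_rec _ (1 + 1)^-1); last first.
    by rewrite invr_gt0 invf_le1//; lra.
  rewrite question_mark1 invrK.
  have -> : (1 + 1 : R) = 2%:R by ring.
  rewrite natrK /gauss_map invrK natrK subrr question_mark0; lra.
have x1' : x < 1 by rewrite lt_neqAle xN1.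
rewrite (@question_mark_rec _ (1 + x)^-1); last first.
  by rewrite invr_gt0 invf_le1; lra.
have [-> ->] := @gauss_map_inv R 1 x ltac:(by rewrite x0).
by rewrite expr1; field.
Qed.

Lemma mob_itv (e : bool) (x : R) : 0 <= x <= 1 -> 0 <= mob e x <= 1.
Proof.
move=> /andP[x0 x1]; have h : 0 < 1 + x by lra.
case: e => /=; first by rewrite invr_ge0 invf_le1// lerDl x0 ltW.
by rewrite divr_ge0 ?(ltW h)//= ler_pdivrMr// mul1r lerDr.
Qed.

Lemma question_mark_itv (x : R) : 0 <= x <= 1 -> 0 <= Q x <= 1.
Proof.
move=> /andP[x0 x1]; rewrite -{1}question_mark0 -question_mark1.
by rewrite !question_mark_homo.
Qed.

(* The Moebius coordinate in which both branches [mob] contract by at most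
   [kappa ^+ 2 = phi ^- 2]. *)
Let kappa : R := phi - 1.
Let adapted (x : R) : R := x / (1 + kappa * x).

Lemma kappa_eq : kappa ^+ 2 = 1 - kappa.
Proof. by rewrite /kappa; have := golden_ratio_eq; nra. Qed.

Lemma kappa_itv : 0 < kappa < 1.
Proof. by have /andP[? ?] := golden_ratio_itv; rewrite /kappa; apply/andP; split; lra. Qed.

Lemma adaptedB (a b : R) : 0 <= a -> 0 <= b ->
  adapted b - adapted a = (b - a) / ((1 + kappa * a) * (1 + kappa * b)).
Proof.
move=> a0 b0; have /andP[k0 k1] := kappa_itv; rewrite /adapted; field.
by rewrite !gt_eqF// ltr_wpDr// mulr_ge0// ltW.
Qed.

(** The pole -1 / kappa of [adapted] is the second fixed point of 1 / (1 + x), so in this coordinate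
    [mob true] is affine of ratio -kappa^2 and equality holds. For [mob false] the inequality
    reduces to (1 - kappa)(1 - x) >= 0. The sign accounts for the reversed orientation of
    [mob true]. *)
Lemma adapted_mob (e : bool) (a b : R) : 0 <= a -> a <= b -> b <= 1 ->
  kappa ^+ 2 * (adapted b - adapted a) <=
  (-1) ^+ e * (adapted (mob e b) - adapted (mob e a)).
Proof.
move=> a0 ab b1; have b0 := le_trans a0 ab.
have /andP[k0 k1] := kappa_itv; have kE := kappa_eq.
have h (x : R) : 0 <= x -> 0 < 1 + kappa * x.
  by move=> x0; have := mulr_ge0 (ltW k0) x0; lra.
have h' (x : R) : 0 <= x -> 0 < 1 + x by move=> x0; lra.
have a01 : 0 <= a <= 1 by lra.
have b01 : 0 <= b <= 1 by lra.
have /andP[ma _] := mob_itv e a01; have /andP[mb _] := mob_itv e b01.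
have gE (x : R) : 0 <= x -> adapted (mob e x) = if e then (1 + x + kappa)^-1 else x / (1 + x + kappa * x).
  move=> x0; have := h x x0; have := h' x x0; rewrite /adapted; case: e {ma mb} => /= ? ?.
    by field; rewrite !gt_eqF//; lra.
  by have ? := mulr_ge0 (ltW k0) x0; field; rewrite !gt_eqF//; lra.
have key (A B C E : R) : 0 < A -> 0 < B -> 0 < C -> 0 < E -> kappa * C <= A -> kappa * E <= B ->
   kappa ^+ 2 * ((b - a) / (A * B)) <= (b - a) / (C * E).
  move=> A0 B0 C0 E0 AC BE.
  rewrite ler_pdivlMr ?mulr_gt0//.
  have -> : kappa ^+ 2 * ((b - a) / (A * B)) * (C * E) = (b - a) * ((kappa * C) * (kappa * E) / (A * B)).
    by field; rewrite !gt_eqF.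
  rewrite -[leRHS]mulr1 ler_wpM2l ?subr_ge0// ler_pdivrMr ?mulr_gt0// mul1r.
  by apply: ler_pM => //; apply: mulr_ge0; apply: ltW.
rewrite (adaptedB a0 b0) !gE//; case: e {ma mb gE} => /=.
  have -> : (-1) ^+ true * ((1 + b + kappa)^-1 - (1 + a + kappa)^-1) = (b - a) / ((1 + a + kappa) * (1 + b + kappa)).
    by rewrite expr1; field; rewrite !gt_eqF//; lra.
  have ka : kappa * (1 + a + kappa) = 1 + kappa * a.
    have -> : kappa * (1 + a + kappa) = kappa + kappa * a + kappa ^+ 2 by ring.
    by rewrite kE; ring.
  have kb : kappa * (1 + b + kappa) = 1 + kappa * b.
    have -> : kappa * (1 + b + kappa) = kappa + kappa * b + kappa ^+ 2 by ring.
    by rewrite kE; ring.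
  by apply: key; rewrite ?h ?ka ?kb//; lra.
have ka := mulr_ge0 (ltW k0) a0; have kb := mulr_ge0 (ltW k0) b0.
have -> : (-1) ^+ false * (b / (1 + b + kappa * b) - a / (1 + a + kappa * a)) = (b - a) / ((1 + a + kappa * a) * (1 + b + kappa * b)).
  by rewrite expr0; field; rewrite !gt_eqF//; lra.
have k2 (x : R) : 0 <= x <= 1 -> kappa * (1 + x + kappa * x) <= 1 + kappa * x.
  move=> x01; have -> : kappa * (1 + x + kappa * x) = kappa + kappa * x + kappa ^+ 2 * x by ring.
  rewrite kE; have : 0 <= (1 - kappa) * (1 - x) by rewrite mulr_ge0//; lra.
  lra.
by apply: key; rewrite ?h ?k2//; lra.
Qed.

Lemma kappa_powR : (kappa ^+ 2) `^ alpha = 2^-1.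
Proof.
have kphi : kappa = phi^-1.
  have /andP[h _] := golden_ratio_itv; have := golden_ratio_eq; rewrite /kappa => e.
  by apply: (@mulIf _ phi); [rewrite gt_eqF//; lra|rewrite mulVf ?gt_eqF//; [lra|lra]].
have p0 : 0 <= phi by have := golden_ratio_gt1; lra.
rewrite -powR_mulrn; last by rewrite kphi invr_ge0.
by rewrite -powRrM kphi -powR_inv1// -powRrM mulN1r powRN golden_powR.
Qed.

Lemma adapted_homo (a b : R) : 0 <= a -> a <= b -> adapted a <= adapted b.
Proof.
move=> a0 ab; have b0 := le_trans a0 ab; rewrite -subr_ge0 adaptedB//.
have /andP[/ltW k0 k1] := kappa_itv.
by rewrite divr_ge0 ?subr_ge0// mulr_ge0// addr_ge0// mulr_ge0.
Qed.

(** A branch exactly halves the mass of an interval, and since (kappa^2)^alpha = 1/2 it at most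
    halves the power alpha of its adapted length. A Hoelder bound thus passes from an interval to
    its image with the same constant. *)
Lemma half_powR_mob (e : bool) (a b : R) : 0 <= a -> a <= b -> b <= 1 ->
  (adapted b - adapted a) `^ alpha / 2 <=
  ((-1) ^+ e * (adapted (mob e b) - adapted (mob e a))) `^ alpha.
Proof.
move=> a0 ab b1; rewrite mulrC -kappa_powR -powRM ?sqr_ge0 ?subr_ge0 ?adapted_homo//.
have ag := ltW alpha_gt0.
have h := adapted_mob e a0 ab b1.
have h0 : 0 <= kappa ^+ 2 * (adapted b - adapted a).
  by rewrite mulr_ge0 ?sqr_ge0// subr_ge0 adapted_homo.
by apply: ge0_ler_powR => //; rewrite nnegrE// (le_trans h0).
Qed.

Lemma ler_addgeo (x y : R) : (forall n : nat, x <= y + 2 ^- n) -> x <= y.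
Proof.
move=> h; apply/ler_addgt0Pr => e e0.
have [n _ ne] : \forall n \near \oo, (2^-1 : R) ^+ n <= e.
  have h1 : `|2^-1 : R| < 1 by rewrite ger0_norm// invf_lt1// ltr1n.
  move/cvgrPdist_le : (cvg_expr h1) => /(_ _ e0).
  by apply: filterS => n /=; rewrite sub0r normrN ger0_norm// exprn_ge0.
by apply: (le_trans (h n)); rewrite lerD2l -exprVn; apply: ne => /=.
Qed.

Lemma mob_surj (x : R) : 0 <= x <= 1 -> exists e y, [/\ 0 <= y <= 1, x = mob e y & e = (1/2 < x)].
Proof.
move=> /andP[x0 x1]; have [h|h] := leP x (1/2).
  exists false, (x / (1 - x)); split => //=.
    by rewrite divr_ge0// ?ler_pdivrMr; lra.
  by field; lra.
exists true, (x^-1 - 1); split => //=; last by field; rewrite gt_eqF; lra.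
have x0' : 0 < x by lra.
apply/andP; split; first by rewrite subr_ge0 invf_ge1.
rewrite lerBlDr (_ : 1 + 1 = (1/2)^-1); last by field.
by rewrite lef_pV2 ?posrE//; lra.
Qed.

Lemma adapted_ge (a b : R) : 0 <= a -> a <= b -> b <= 1 ->
  (b - a) / 4 <= adapted b - adapted a <= b - a.
Proof.
move=> a0 ab b1; have b0 := le_trans a0 ab; have a1 := le_trans ab b1.
have /andP[k0 k1] := kappa_itv; rewrite adaptedB//.
have h (x : R) : 0 <= x -> x <= 1 -> 1 <= 1 + kappa * x <= 2.
  move=> x0 x1; have := mulr_ge0 (ltW k0) x0.
  have : kappa * x <= 1 * 1 by apply: ler_pM => //; apply: ltW.
  lra.
have /andP[a2 a3] := h a a0 a1; have /andP[b2 b3] := h b b0 b1.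
set A := 1 + _ in a2 a3 *; set B := 1 + _ in b2 b3 *.
have A0 : 0 < A by lra.
have B0 : 0 < B by lra.
have AB4 : A * B <= 2 * 2 by apply: ler_pM => //; lra.
have AB1 : 1 * 1 <= A * B by apply: ler_pM => //; lra.
apply/andP; split.
  by rewrite ler_wpM2l ?subr_ge0// lef_pV2 ?posrE ?mulr_gt0//; lra.
by rewrite ler_pdivrMr ?mulr_gt0// -[leLHS]mulr1 ler_wpM2l ?subr_ge0//; lra.
Qed.

(** Origin of the constant 8: an interval of length at least 1/2 has adapted length at least 1/8,
    while a mass is at most 1. *)
Lemma adapted_large (a b z : R) : 0 <= a -> a + 1/2 <= b -> b <= 1 -> z <= 1 ->
  z <= 8 `^ alpha * (adapted b - adapted a) `^ alpha.
Proof.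
move=> a0 ab b1 z1; have ab' : a <= b by lra.
have /andP[h _] := adapted_ge a0 ab' b1.
apply: (le_trans z1); rewrite -powRM//; last by lra.
apply: (@le_trans _ _ (1 `^ alpha)); first by rewrite powR1.
by apply: ge0_ler_powR; rewrite ?nnegrE ?(ltW alpha_gt0)//; lra.
Qed.

(** Both [0, y] for y <= 1/2 and [y, 1] for y > 1/2 are images of an interval [0, x] under one
    branch; the other intervals are long and fall under [adapted_large]. The induction carries an
    error 2^-n, trivial for n = 0 and halved at each descent. *)
Lemma Hoelder_endpoint (x : R) : 0 <= x <= 1 ->
  Q x <= 8 `^ alpha * (adapted x - adapted 0) `^ alpha /\
  1 - Q x <= 8 `^ alpha * (adapted 1 - adapted x) `^ alpha.
Proof.
suff H (n : nat) (y : R) : 0 <= y <= 1 ->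
    Q y <= 8 `^ alpha * (adapted y - adapted 0) `^ alpha + 2 ^- n /\
    1 - Q y <= 8 `^ alpha * (adapted 1 - adapted y) `^ alpha + 2 ^- n.
  by move=> x01; split; apply: ler_addgeo => n; case: (H n x x01).
clear x; elim: n y => [|n IH] y y01.
  have /andP[q0 q1] := question_mark_itv y01; rewrite expr0 invr1.
  have c0 z : 0 <= 8 `^ alpha * z `^ alpha :> R by rewrite mulr_ge0// powR_ge0.
  by have := c0 (adapted y - adapted 0); have := c0 (adapted 1 - adapted y); lra.
have /andP[q0 q1] := question_mark_itv y01.
have e0 : 0 <= 2 ^- n.+1 :> R by rewrite invr_ge0 exprn_ge0.
have [y0 y1] := andP y01.
have h2 : 2 ^- n / 2 = 2 ^- n.+1 :> R by rewrite exprSr invfM.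
have [e [x [x01 yE eE]]] := mob_surj y01.
have [x0 x1] := andP x01.
have [IH1 IH2] := IH x x01.
have hp := half_powR_mob e (lexx 0) x0 x1.
have c8 : 0 <= 8 `^ alpha :> R by rewrite powR_ge0.
have {}hp : 8 `^ alpha * (adapted x - adapted 0) `^ alpha / 2 <=
    8 `^ alpha * ((-1) ^+ e * (adapted y - adapted (mob e 0))) `^ alpha.
  by rewrite -mulrA ler_wpM2l// yE.
case: e yE eE hp => yE /esym eE.
  rewrite expr1 mulN1r opprB /= addr0 invr1 => hp; split.
    have : Q y <= 8 `^ alpha * (adapted y - adapted 0) `^ alpha.
      by apply: adapted_large => //; rewrite add0r ltW// eE.
    lra.
  have -> : 1 - Q y = Q x / 2 by rewrite yE question_mark_mob//; ring.
  by lra.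
rewrite expr0 mul1r /= mul0r => hp; split.
  have -> : Q y = Q x / 2 by rewrite yE question_mark_mob.
  by lra.
have : 1 - Q y <= 8 `^ alpha * (adapted 1 - adapted y) `^ alpha.
  by apply: adapted_large => //; move/negbT: eE; rewrite -leNgt; lra.
lra.
Qed.

Theorem question_mark_Hoelder (a b : R) : 0 <= a -> a <= b -> b <= 1 ->
  Q b - Q a <= 2 * 8 `^ alpha * (b - a) `^ alpha.
Proof.
move=> a0 ab b1; have ag := ltW alpha_gt0.
have c8 : 0 <= 8 `^ alpha :> R by rewrite powR_ge0.
apply: (@le_trans _ _ (2 * 8 `^ alpha * (adapted b - adapted a) `^ alpha)); last first.
  have /andP[_ h] := adapted_ge a0 ab b1.
  rewrite ler_wpM2l ?mulr_ge0//; apply: ge0_ler_powR; rewrite ?nnegrE ?subr_ge0//.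
  exact: adapted_homo.
apply: ler_addgeo => n; elim: n a b a0 ab b1 => [|n IH] a b a0 ab b1.
  have c0 z : 0 <= 2 * 8 `^ alpha * z `^ alpha :> R by rewrite !mulr_ge0// powR_ge0.
  have b01 : 0 <= b <= 1 by rewrite (le_trans a0).
  have a01 : 0 <= a <= 1 by rewrite a0 (le_trans ab).
  have /andP[_ q1] := question_mark_itv b01.
  have /andP[q0 _] := question_mark_itv a01.
  by have := c0 (adapted b - adapted a); rewrite expr0 invr1; lra.
have e0 : 0 <= 2 ^- n.+1 :> R by rewrite invr_ge0 exprn_ge0.
have h2 : 2 ^- n / 2 = 2 ^- n.+1 :> R by rewrite exprSr invfM.
have a01 : 0 <= a <= 1 by rewrite a0 (le_trans ab).
have b01 : 0 <= b <= 1 by rewrite b1 (le_trans a0).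
have [e [x [x01 aE eE]]] := mob_surj a01.
have [e' [y [y01 bE eE']]] := mob_surj b01.
have [x0 x1] := andP x01; have [y0 y1] := andP y01.
case: e aE eE => aE /esym eE; case: e' bE eE' => bE /esym eE'.
- have yx : y <= x by move: ab; rewrite aE bE /= lef_pV2 ?posrE; lra.
  have hI := IH y x y0 yx x1.
  have := half_powR_mob true y0 yx x1.
  rewrite -aE -bE expr1 mulN1r opprB => hp.
  have {}hp : 2 * 8 `^ alpha * (adapted x - adapted y) `^ alpha / 2 <=
    2 * 8 `^ alpha * (adapted b - adapted a) `^ alpha.
    by rewrite -mulrA ler_wpM2l// mulr_ge0.
  have -> : Q b - Q a = (Q x - Q y) / 2 by rewrite aE bE !question_mark_mob//; ring.
  by lra.
- by move/negbT: eE'; rewrite -leNgt; lra.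
(* The interval straddles 1/2, the image of 1 under both branches. Its two parts are images of
   [x, 1] and [y, 1], and the end point bound applies to each: this is the origin of the factor
   2. *)
- have [h1 _] := Hoelder_endpoint x01; have [_ h3] := Hoelder_endpoint x01.
  have [_ h4] := Hoelder_endpoint y01.
  have hx := half_powR_mob false x0 x1 (lexx 1).
  have hy := half_powR_mob true y0 y1 (lexx 1).
  move/negbT: eE; rewrite -leNgt => eE.
  have m1 e : mob e 1 = 1/2 by case: e => /=; field.
  move: hx hy; rewrite !m1 -aE -bE expr0 mul1r expr1 mulN1r opprB => hx hy.
  have hh : 0 <= 1/2 :> R by lra.
  have half1 : adapted (1/2) - adapted a <= adapted b - adapted a.
    by rewrite lerD2r adapted_homo// ltW.
  have half2 : adapted b - adapted (1/2) <= adapted b - adapted a.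
    by rewrite lerD2l lerN2 adapted_homo.
  have p1 : (adapted (1/2) - adapted a) `^ alpha <= (adapted b - adapted a) `^ alpha.
    by apply: ge0_ler_powR; rewrite ?nnegrE ?subr_ge0 ?adapted_homo// ?(le_trans _ half1)//.
  have p2 : (adapted b - adapted (1/2)) `^ alpha <= (adapted b - adapted a) `^ alpha.
    by apply: ge0_ler_powR; rewrite ?nnegrE ?subr_ge0 ?adapted_homo// ltW.
  have -> : Q b - Q a = (1 - Q x) / 2 + (1 - Q y) / 2.
    by rewrite aE bE !question_mark_mob//; field.
  have l1 : (1 - Q x) / 2 <= 8 `^ alpha * (adapted b - adapted a) `^ alpha.
    apply: (le_trans _ (ler_wpM2l c8 (le_trans hx p1))).
    by rewrite mulrA ler_pM2r.
  have l2 : (1 - Q y) / 2 <= 8 `^ alpha * (adapted b - adapted a) `^ alpha.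
    apply: (le_trans _ (ler_wpM2l c8 (le_trans hy p2))).
    by rewrite mulrA ler_pM2r.
  by lra.
- have xy : x <= y.
    move: ab; rewrite aE bE /= ler_pdivrMr ?ltr_wpDr//.
    rewrite mulrAC ler_pdivlMr ?ltr_wpDr//; lra.
  have hI := IH x y x0 xy y1.
  have := half_powR_mob false x0 xy y1.
  rewrite -aE -bE expr0 mul1r => hp.
  have {}hp : 2 * 8 `^ alpha * (adapted y - adapted x) `^ alpha / 2 <=
    2 * 8 `^ alpha * (adapted b - adapted a) `^ alpha.
    by rewrite -mulrA ler_wpM2l// mulr_ge0.
  have -> : Q b - Q a = (Q y - Q x) / 2 by rewrite aE bE !question_mark_mob//; ring.
  by lra.
Qed.

End Hoelder.

(** * Self-similarity of the question mark measure *)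

Section Measure.
Context {R : realType}.
Local Notation Q := (@question_mark R).
Local Notation F := (@question_mark_cdf R).
Local Notation mu := (@question_mark_measure R).
Local Notation alpha := (decay_alpha R).

Definition qm_int (g : R -> R) : R := \int[mu]_(x in `[0, 1]) g x.

Lemma question_mark_measure_itv (a b : R) : a <= b ->
  mu `]a, b]%classic = (F b - F a)%:E.
Proof.
move=> ab.
rewrite /question_mark_measure /= /lebesgue_stieltjes_measure /measure_extension/=.
by rewrite measurable_mu_extE/= ?wlength_itv_bnd//; exact: is_ocitv.
Qed.

Lemma question_mark_measure_Ny (r : R) : mu `]-oo, r]%classic = (F r)%:E.
Proof. exact: (cdf_lebesgue_stieltjes_id (F : cumulativeBounded 0 1) r). Qed.

Lemma question_mark_measure_set1 (r : R) : mu [set r] = 0%E.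
Proof.
apply/eqP; rewrite eq_le measure_ge0 andbT; apply/lee_addgt0Pr => e e0; rewrite add0e.
have [n _ ne] : \forall n \near \oo, (2^-1 : R) ^+ n <= e.
  have h1 : `|2^-1 : R| < 1 by rewrite ger0_norm// invf_lt1// ltr1n.
  move/cvgrPdist_le : (cvg_expr h1) => /(_ _ e0).
  by apply: filterS => n /=; rewrite sub0r normrN ger0_norm// exprn_ge0.
have {}ne : 2 ^- n <= e by rewrite -exprVn; apply: ne => /=.
have [y yr ye] : exists2 y, y < r & F r - F y <= e.
  have [r0|r0] := leP r 0.
    by exists (r - 1); [rewrite ltrBlDr ltrDl|rewrite (question_mark_cdf_le0 r0) question_mark_cdf_le0 ?subrr ?(ltW e0)//; lra].
  have [r1|r1] := leP r 1.
    have [y /andP[y0 yr] hy] := (@qm_modulus R n).2 r ltac:(by rewrite r0).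
    exists y => //; rewrite !question_mark_cdfE ?y0 ?(ltW r0)//.
      exact: (le_trans hy).
    exact: le_trans (ltW yr) r1.
  by exists 1 => //; rewrite !question_mark_cdf_ge1 ?subrr ?(ltW r1) ?(ltW e0).
apply: (@le_trans _ _ (mu `]y, r]%classic)).
  apply: le_measure; rewrite ?inE//=.
  by move=> x /= ->; rewrite in_itv/= yr lexx.
by rewrite question_mark_measure_itv ?lee_fin// ltW.
Qed.

Lemma question_mark_measure_y (r : R) : mu `[r, +oo[%classic = (1 - F r)%:E.
Proof.
have -> : `[r, +oo[%classic = [set r] `|` ~` `]-oo, r]%classic.
  apply/seteqP; split => x /=; rewrite !in_itv/= andbT.
    by rewrite le_eqVlt => /orP[/eqP ->|h]; [left|right; apply/negP; rewrite -ltNge].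
  by move=> [->//|/negP]; rewrite -ltNge; exact: ltW.
rewrite measureU//; first last.
- by apply/seteqP; split => // x /= [->]; rewrite in_itv/= lexx; exact.
- exact: measurableC.
transitivity (0 + (1 - F r)%:E)%E; last by rewrite add0e.
congr (_ + _)%E; first exact: question_mark_measure_set1.
transitivity (1 - mu `]-oo, r]%classic)%E; first exact: probability_setC.
by rewrite question_mark_measure_Ny.
Qed.

Lemma continuous01_measurable (g : R -> R) : continuous01 g ->
  measurable_fun [set: measurableTypeR R] (g \o clamp01 : measurableTypeR R -> R).
Proof. by move=> cg; apply: continuous_measurable_fun; exact: continuous01_clamp. Qed.

Lemma continuous01_bounded (g : R -> R) : continuous01 g ->
  exists M : R, forall x : R, `|g (clamp01 x)| <= M.
Proof.
move=> cg; have cgc := continuous01_clamp cg.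
have cn : continuous (fun x : R => `|(g \o clamp01) x|).
  move=> x; apply: (@continuous_comp _ _ _ (g \o clamp01) Num.norm); first exact: cgc.
  exact: norm_continuous.
have [c _ hc] := @EVT_max R (fun x => `|(g \o clamp01) x|) 0 1 ler01 (continuous_subspaceT cn).
exists (`|g (clamp01 c)|) => x.
have := hc (clamp01 x); rewrite in_itv/= clamp01_itv => /(_ isT).
by rewrite /= (@clamp01_id _ (clamp01 x)) ?clamp01_itv.
Qed.

Lemma continuous01_integrable (P : probability (measurableTypeR R) R) (g : R -> R) :
  continuous01 g -> P.-integrable setT (EFin \o (g \o clamp01)).
Proof.
move=> cg; have [M hM] := continuous01_bounded cg.
apply: measurable_bounded_integrable => //.
- by rewrite (le_lt_trans (probability_le1 _ _))// ltry.
- exact: continuous01_measurable.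
- exists M; split; first exact: num_real.
  by move=> y My x _ /=; rewrite (le_trans (hM x))// ltW.
Qed.

Lemma question_mark_measure_setC01 : mu (~` `[0, 1]%classic) = 0%E.
Proof.
have h0 : mu `[0, 1]%classic = 1%E.
  have -> : `[(0:R), 1]%classic = [set 0] `|` `]0, 1]%classic.
    apply/seteqP; split => x /=; rewrite !in_itv/=.
      by move=> /andP[]; rewrite le_eqVlt => /orP[/eqP <-|->]; [left|right].
    by move=> [->|/andP[/ltW -> ->]//]; rewrite lexx ler01.
  rewrite measureU//; first last.
  - by apply/seteqP; split => // x /= [->]; rewrite in_itv/= ltxx.
  transitivity (0 + (F 1 - F 0)%:E)%E; last first.
    by rewrite add0e (@question_mark_cdf_le0 R 0)// (@question_mark_cdf_ge1 R 1)// subr0.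
  congr (_ + _)%E; first exact: question_mark_measure_set1.
  exact: question_mark_measure_itv.
transitivity (1 - mu `[0%R, 1%R]%classic)%E; first exact: probability_setC.
by rewrite h0 subee.
Qed.

Lemma qm_intE (g : R -> R) : continuous01 g -> qm_int g = \int[mu]_x g (clamp01 x).
Proof.
move=> cg; rewrite /qm_int /Rintegral; congr fine.
rewrite (@negligible_integral _ _ _ mu setT (~` `[0, 1]%classic) (fun x => (g (clamp01 x))%:E))//.
- rewrite setTD setCK; apply: eq_integral => x; rewrite inE /= in_itv/= => h.
  by rewrite clamp01_id.
- exact: measurableC.
- exact: continuous01_integrable.
- exact: question_mark_measure_setC01.
Qed.

Lemma is_derive_mob (e : bool) (x : R) : 0 <= x ->
  is_derive x (1 : R) (mob e) ((-1) ^+ e * (1 + x) ^- 2).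
Proof.
move=> x0; have h : 1 + x != 0 by rewrite gt_eqF//; lra.
have d1 : is_derive x (1 : R) (fun y : R => 1 + y) 1.
  apply: is_derive_eq; rewrite /GRing.scale /=; ring.
have d2 := is_deriveV h d1; case: e => /=.
  by apply: (is_derive_eq d2); rewrite /GRing.scale /=; ring.
have -> : mob false = (fun y : R => y * (1 + y)^-1) by [].
by apply: is_derive_eq; rewrite /GRing.scale /=; field.
Qed.

Lemma continuous01_mob (e : bool) : continuous01 (@mob R e).
Proof. by move=> x /andP[x0 _]; apply: is_derive_continuous; exact: is_derive_mob. Qed.

(** Clamping makes the branch a measurable map of the whole line, as a pushforward requires; the
    measure lives on [0, 1]. *)
Definition mobc (e : bool) (x : measurableTypeR R) : measurableTypeR R :=
  mob e (clamp01 x).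

Lemma mobc_measurable (e : bool) : measurable_fun setT (mobc e).
Proof. exact: (continuous01_measurable (@continuous01_mob e)). Qed.

HB.instance Definition _ (e : bool) :=
  isMeasurableFun.Build _ _ _ _ (mobc e) (@mobc_measurable e).

Lemma mobc_preimage_true (b : R) : 1/2 <= b < 1 ->
  mobc true @^-1` `]-oo, b]%classic = `[b^-1 - 1, +oo[%classic.
Proof.
move=> /andP[b0 b1]; apply/seteqP.
have h (x : R) : (mobc true x <= b) = (b^-1 - 1 <= x).
  have /andP[c0 c1] := clamp01_itv x.
  have b0' : 0 < b by lra.
  have i1 : 1 <= b^-1 by rewrite invf_ge1//; lra.
  have i2 : b^-1 <= 2.
    by rewrite (_ : 2 = (1/2)^-1); [rewrite lef_pV2 ?posrE//; lra|field].
  have i3 : 1 < b^-1 by rewrite invf_gt1.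
  have p0 : 0 < 1 + clamp01 x by lra.
  rewrite /mobc /= -[b in LHS]invrK lef_pV2 ?posrE ?invr_gt0//.
  rewrite addrC -lerBlDr /clamp01 le_min le_max.
  have -> : b^-1 - 1 <= 1 by lra.
  by rewrite andbT (_ : (b^-1 - 1 <= 0) = false) ?orbF//; apply/negbTE; rewrite -ltNge; lra.
by split=> x; rewrite /= !in_itv/= andbT h.
Qed.

Lemma mobc_preimage_false (b : R) : 0 <= b < 1/2 ->
  mobc false @^-1` `]-oo, b]%classic = `]-oo, b / (1 - b)]%classic.
Proof.
move=> /andP[b0 b1]; apply/seteqP.
have h (x : R) : (mobc false x <= b) = (x <= b / (1 - b)).
  have /andP[c0 c1] := clamp01_itv x.
  have i0 : 0 <= b / (1 - b) by rewrite divr_ge0//; lra.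
  have i1 : b / (1 - b) < 1 by rewrite ltr_pdivrMr; lra.
  have p0 : 0 < 1 + clamp01 x by lra.
  rewrite /mobc /= ler_pdivrMr//.
  have -> : (clamp01 x <= b * (1 + clamp01 x)) = (clamp01 x <= b / (1 - b)).
    rewrite ler_pdivlMr; last by lra.
    by apply/idP/idP; lra.
  rewrite /clamp01 ge_min ge_max i0 andbT (_ : (1 <= b / (1 - b)) = false) ?orbF//.
  by apply/negbTE; rewrite -ltNge.
by split=> x; rewrite /= !in_itv/= h.
Qed.

(** For 0 <= b < 1/2 only the branch [false] contributes, namely F (b / (1 - b)). For 1/2 <= b < 1
    it contributes its full mass 1, and [true] contributes 1 - F (1 / b - 1). Both totals are 2 F b
    by [question_mark_mob]. *)
Lemma distribution_mobc_Ny (b : R) :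
  (distribution mu (mobc false) `]-oo, b]%classic +
   distribution mu (mobc true) `]-oo, b]%classic = (2 * F b)%:E)%E.
Proof.
rewrite /distribution /pushforward.
have full (e : bool) : 1 - (~~ e)%:R / 2 <= b -> mobc e @^-1` `]-oo, b]%classic = setT.
  move=> hb; apply/seteqP; split => // x _ /=; rewrite in_itv/=.
  have /andP[c0 c1] := clamp01_itv x; apply: (le_trans _ hb); rewrite /mobc.
  case: e {hb} => /=; first by rewrite mul0r subr0 invf_le1; lra.
  by rewrite ler_pdivrMr; lra.
have void (e : bool) : b < (e : nat)%:R / 2 -> mobc e @^-1` `]-oo, b]%classic = set0.
  move=> hb; apply/seteqP; split => // x /=; rewrite in_itv/=.
  have /andP[c0 c1] := clamp01_itv x; apply/negP; rewrite -ltNge; apply: (lt_le_trans hb); rewrite /mobc.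
  case: e {hb} => /=; last by rewrite mul0r divr_ge0//; lra.
  rewrite (_ : 1 / 2 = 2^-1); last by field.
  by rewrite lef_pV2 ?posrE; lra.
have [b0|b0] := ltP b 0.
  rewrite !void /=; [|lra|lra].
  by rewrite measure0 add0e question_mark_cdf_le0 ?mulr0// ltW.
have [b1|b1] := ltP b (1/2).
  rewrite (void true) ?measure0 ?adde0; last by rewrite /=; lra.
  rewrite mobc_preimage_false ?b0// question_mark_measure_Ny; congr EFin.
  have i0 : 0 <= b / (1 - b) by rewrite divr_ge0//; lra.
  have i1 : b / (1 - b) <= 1 by rewrite ler_pdivrMr; lra.
  have bE : b = mob false (b / (1 - b)) by rewrite /=; field; lra.
  rewrite !question_mark_cdfE ?i0//; last by lra.
  rewrite [in RHS]bE question_mark_mob ?i0//.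
  by rewrite /=; field.
rewrite (full false); last by rewrite /=; lra.
have [b2|b2] := ltP b 1.
  rewrite mobc_preimage_true ?b1// question_mark_measure_y.
  transitivity (1 + (1 - F (b^-1 - 1))%:E)%E; first by congr (_ + _)%E; exact: probability_setT.
  rewrite -EFinD; congr EFin.
  have b0' : 0 < b by lra.
  have i1 : 1 <= b^-1 by rewrite invf_ge1//; lra.
  have i2 : b^-1 <= 2.
    by rewrite (_ : 2 = (1/2)^-1); [rewrite lef_pV2 ?posrE//; lra|field].
  have bE : b = mob true (b^-1 - 1) by rewrite /=; field; rewrite gt_eqF//; lra.
  rewrite !question_mark_cdfE; [|lra|lra].
  rewrite [in RHS]bE question_mark_mob; last by lra.
  by field.
rewrite (full true) /=; last by rewrite mul0r subr0.
transitivity (1 + 1 : \bar R)%E; first by congr (_ + _)%E; exact: probability_setT.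
by rewrite question_mark_cdf_ge1// mulr1.
Qed.

End Measure.

Section SelfSim.
Context {R : realType}.
Local Notation Q := (@question_mark R).
Local Notation F := (@question_mark_cdf R).
Local Notation mu := (@question_mark_measure R).
Local Notation alpha := (decay_alpha R).

Lemma probability_itv_oc (P : probability (measurableTypeR R) R) (a b : R) : a <= b ->
  P `]a, b]%classic = (P `]-oo, b]%classic - P `]-oo, a]%classic)%E.
Proof.
move=> ab; have -> : `]a, b]%classic = `]-oo, b] `\` `]-oo, a].
  by rewrite -[RHS]setCK setCD setCitvl setUC -[LHS]setCK setCitv.
rewrite measureD ?setIidr//; first exact: subset_itvl.
by rewrite -ge0_fin_numE// fin_num_measure.
Qed.

(** The invariance of the measure, multiplied by 2 so that only sums of measures occur. Agreement on
    half-open intervals comes from the distribution functions, and uniqueness of measures does the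
    rest. *)
Lemma question_mark_measure_double (A : set (measurableTypeR R)) : measurable A ->
  measure_add mu mu A = measure_add (distribution mu (@mobc R false)) (distribution mu (@mobc R true)) A.
Proof.
move=> mA.
apply: (@measure_unique _ R (measurableTypeR R) (@ocitv R)
  (fun n => `](- n%:R : R), n%:R]%classic) _ _ _ _ (measure_add mu mu)
  (measure_add (distribution mu (@mobc R false)) (distribution mu (@mobc R true)))) => //.
- exact: ocitvI.
- by move=> n; exact: is_ocitv.
- apply/seteqP; split => // x _; exists (Num.truncn `|x|).+1 => //=.
  rewrite in_itv/=; have := truncnS_gt `|x|.
  by rewrite ltr_norml => /andP[-> /ltW].
- move=> _ [[a b] _ <-].
  pose D0 : probability (measurableTypeR R) R := distribution mu (@mobc R false).
  pose D1 : probability (measurableTypeR R) R := distribution mu (@mobc R true).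
  suff : (mu `]a, b]%classic + mu `]a, b]%classic = D0 `]a, b]%classic + D1 `]a, b]%classic)%E.
    by move=> h; transitivity (mu `]a, b]%classic + mu `]a, b]%classic)%E;
      [exact: measure_addE|rewrite h; exact/esym/measure_addE].
  have [ab|ba] := leP a b; last first.
    by rewrite set_itv_ge ?measure0 ?bnd_simp -?leNgt ?ltW.
  rewrite !probability_itv_oc//.
  have fin (P : probability (measurableTypeR R) R) r : P `]-oo, r]%classic \is a fin_num.
    exact: fin_num_measure.
  have : (D0 `]-oo, a]%classic + D1 `]-oo, a]%classic = (2 * F a)%:E)%E by exact: distribution_mobc_Ny.
  have : (D0 `]-oo, b]%classic + D1 `]-oo, b]%classic = (2 * F b)%:E)%E by exact: distribution_mobc_Ny.
  rewrite !question_mark_measure_Ny.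
  rewrite -(fineK (fin D0 a)) -(fineK (fin D0 b)) -(fineK (fin D1 a)) -(fineK (fin D1 b)).
  rewrite -!EFinB -!EFinD => -[hb] [ha].
  by congr EFin; lra.
- move=> n; set I := `]_, _]%classic.
  apply: (@le_lt_trans _ _ (mu I + mu I)%E); last first.
    apply: (@le_lt_trans _ _ (1 + 1)%E); last by rewrite -EFinD ltry.
    by apply: leeD; rewrite /I; exact: probability_le1.
  by rewrite le_eqVlt; apply/orP; left; apply/eqP; exact: measure_addE.
Qed.

Lemma qm_int_mob (g : R -> R) : continuous01 g ->
  qm_int g = (qm_int (g \o mob false) + qm_int (g \o mob true)) / 2.
Proof.
move=> cg.
have cgm (e : bool) : continuous01 (g \o mob e).
  move=> x x01; apply: continuous_comp; first exact: continuous01_mob.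
  exact/cg/mob_itv.
have mg : measurable_fun setT (EFin \o (g \o clamp01 : measurableTypeR R -> R)).
  by apply/measurable_EFinP; exact: continuous01_measurable.
rewrite !qm_intE//.
have dE (e : bool) : (\int[distribution mu (@mobc R e)]_x (g (clamp01 x))%:E =
    \int[mu]_x ((g \o mob e) (clamp01 x))%:E)%E.
  have gE (x : R) : g (clamp01 (mobc e x)) = (g \o mob e) (clamp01 x).
    rewrite /mobc (@clamp01_id _ (mob e (clamp01 x)))//.
    by apply: mob_itv; exact: clamp01_itv.
  rewrite integral_pushforward//; last first.
    rewrite preimage_setT (_ : _ \o _ = EFin \o ((g \o mob e) \o clamp01)).
      exact: (@continuous01_integrable R mu _ (cgm e)).
    by apply/funext => x /=; rewrite gE.
  by apply: eq_integral => x _ /=; rewrite gE.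
have fin (e : bool) : (\int[mu]_x ((g \o mob e) (clamp01 x))%:E)%E \is a fin_num.
  by apply: integrable_fin_num => //; exact: (@continuous01_integrable R mu _ (cgm e)).
have fing : (\int[mu]_x (g (clamp01 x))%:E)%E \is a fin_num.
  by apply: integrable_fin_num => //; exact: (@continuous01_integrable R mu _ cg).
have : (\int[mu]_x (g (clamp01 x))%:E + \int[mu]_x (g (clamp01 x))%:E =
   \int[mu]_x ((g \o mob false) (clamp01 x))%:E + \int[mu]_x ((g \o mob true) (clamp01 x))%:E)%E.
  rewrite -!dE.
  rewrite -!integral_measure_add//; [|exact: continuous01_integrable..].
  apply: eq_measure_integral => A mA _; exact: question_mark_measure_double.
rewrite /Rintegral -(fineK fing) -(fineK (fin false)) -(fineK (fin true)) -!EFinD => -[h].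
by rewrite !fineK// in h *; move: h; lra.
Qed.
End SelfSim.

(** * Linearity of the integral against the question mark measure, and upper sums *)

Section Functional.
Context {R : realType}.
Local Notation Q := (@question_mark R).
Local Notation F := (@question_mark_cdf R).
Local Notation mu := (@question_mark_measure R).

Lemma continuous01D (f g : R -> R) : continuous01 f -> continuous01 g ->
  continuous01 (fun x => f x + g x).
Proof. by move=> cf cg x x01; apply: continuousD; [exact: cf|exact: cg]. Qed.

Lemma continuous01M (f g : R -> R) : continuous01 f -> continuous01 g ->
  continuous01 (fun x => f x * g x).
Proof. by move=> cf cg x x01; apply: continuousM; [exact: cf|exact: cg]. Qed.

Lemma continuous01_cst (a : R) : continuous01 (fun=> a).
Proof. by move=> x _; exact: cst_continuous. Qed.

Lemma continuous01_sum (I : Type) (s : seq I) (f : I -> R -> R) :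
  (forall i, continuous01 (f i)) -> continuous01 (fun x => \sum_(i <- s) f i x).
Proof.
move=> cf; elim: s => [|i s IH].
  by under eq_fun do rewrite big_nil; exact: continuous01_cst.
by under eq_fun do rewrite big_cons; exact: continuous01D.
Qed.

Lemma qm_int_cst (a : R) : qm_int (fun=> a) = a.
Proof.
rewrite qm_intE; last exact: continuous01_cst.
rewrite Rintegral_cst//= (_ : fine _ = 1) ?mulr1//.
by have -> : mu setT = 1%E by exact: probability_setT.
Qed.

Lemma qm_intD (f g : R -> R) : continuous01 f -> continuous01 g ->
  qm_int (fun x => f x + g x) = qm_int f + qm_int g.
Proof.
move=> cf cg; rewrite !qm_intE//; last exact: continuous01D.
by rewrite RintegralD//; exact: (@continuous01_integrable R mu).
Qed.

Lemma qm_intZ (a : R) (f : R -> R) : continuous01 f ->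
  qm_int (fun x => a * f x) = a * qm_int f.
Proof.
move=> cf; rewrite !qm_intE//; last by apply: continuous01M => //; exact: continuous01_cst.
by rewrite RintegralZl//; exact: (@continuous01_integrable R mu).
Qed.

Lemma qm_int_sum (I : Type) (s : seq I) (f : I -> R -> R) :
  (forall i, continuous01 (f i)) ->
  qm_int (fun x => \sum_(i <- s) f i x) = \sum_(i <- s) qm_int (f i).
Proof.
move=> cf; elim: s => [|i s IH].
  by under eq_fun do rewrite big_nil; rewrite big_nil qm_int_cst.
under eq_fun do rewrite big_cons; rewrite big_cons qm_intD ?IH//.
exact: continuous01_sum.
Qed.

Lemma qm_int_oc (g : R -> R) : continuous01 g ->
  qm_int g = \int[mu]_(x in `]0, 1]) g (clamp01 x).
Proof.
move=> cg; rewrite qm_intE// /Rintegral; congr fine.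
rewrite (@negligible_integral _ _ _ mu setT (~` `]0, 1]%classic) (fun x => (g (clamp01 x))%:E))//.
- by rewrite setTD setCK.
- exact: measurableC.
- exact: (@continuous01_integrable R mu).
transitivity (1 - mu `]0%R, 1%R]%classic)%E; first exact: probability_setC.
rewrite question_mark_measure_itv// (@question_mark_cdf_le0 R 0)// (@question_mark_cdf_ge1 R 1)//.
by rewrite subr0 subee.
Qed.

(** An upper Riemann-Stieltjes sum. The half-open pieces are disjoint and have mass Q (x k.+1) - Q
    (x k); the point 0, which they miss, carries no mass by [qm_int_oc]. *)
Lemma qm_int_partition (g : R -> R) (s x : nat -> R) (N : nat) : continuous01 g ->
  x 0 = 0 -> x N = 1 -> (forall k, x k <= x k.+1) ->
  (forall k (y : R), (k < N)%N -> x k <= y <= x k.+1 -> `|g y| <= s k) ->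
  `|qm_int g| <= \sum_(k < N) s k * (Q (x k.+1) - Q (x k)).
Proof.
move=> cg x0 xN xS gs.
have ig (D : set (measurableTypeR R)) : measurable D -> mu.-integrable D (EFin \o (g \o clamp01)).
  by move=> mD; apply: (@integrableS _ _ _ mu setT) => //; exact: (@continuous01_integrable R mu).
have ign (D : set (measurableTypeR R)) : measurable D -> mu.-integrable D (EFin \o (fun x => `|g (clamp01 x)|)).
  by move=> mD; have := integrable_abse (ig _ mD).
have x_homo (i j : nat) : (i <= j)%N -> x i <= x j.
  by move=> ij; apply: (@homo_leq _ x <=%R) => //; exact: le_trans.
have x01 (i : nat) : (i <= N)%N -> 0 <= x i <= 1.
  by move=> iN; rewrite -{1}x0 -xN !x_homo.
rewrite qm_int_oc//; apply: (le_trans (le_normr_Rintegral _ _)) => //.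
  exact: ig.
rewrite -xN.
suff H (j : nat) : (j <= N)%N -> \int[mu]_(y in `]0, x j]) `|g (clamp01 y)| <=
    \sum_(k < j) s k * (Q (x k.+1) - Q (x k)) by exact: H.
elim: j => [|j IH] jN.
  by rewrite x0 big_ord0 set_itv_ge ?Rintegral_set0 ?lexx// bnd_simp ltxx.
have jN' := ltnW jN.
have [xj0 xj1] := andP (x01 j jN').
have [xs0 xs1] := andP (x01 j.+1 jN).
have -> : `]0, x j.+1]%classic = `]0, x j] `|` `]x j, x j.+1]%classic.
  apply/seteqP; split => y /=; rewrite !in_itv/=.
    by move=> /andP[y0 y1]; have [h|h] := leP y (x j); [left; rewrite y0|right; rewrite y1].
  move=> [/andP[-> h]|/andP[h ->]]; first by rewrite (le_trans h) ?xS.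
  by rewrite (le_lt_trans _ h).
rewrite Rintegral_setU//; last 2 first.
- by apply: ign; exact: measurableU.
- apply/disj_setPS => y /= []; rewrite !in_itv/= => /andP[_ h] /andP[h' _].
  by move: (lt_le_trans h' h); rewrite ltxx.
rewrite big_ord_recr/= lerD ?IH//.
apply: (@le_trans _ _ (\int[mu]_(y in `]x j, x j.+1]) s j)).
  apply: le_Rintegral => //; first exact: ign.
    apply: measurable_bounded_integrable => //.
    - by rewrite (le_lt_trans (probability_le1 _ _))// ltry.
    - by exists `|s j|; split; [exact: num_real|move=> y jy z _ /=; exact: ltW].
  move=> y /=; rewrite in_itv/= => /andP[h1 h2].
  rewrite clamp01_id; first by apply: gs => //; rewrite (ltW h1).
  by rewrite (le_trans xj0 (ltW h1)) (le_trans h2).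
have -> : Q (x j.+1) - Q (x j) = F (x j.+1) - F (x j) by rewrite !question_mark_cdfE ?xj0 ?xs0.
rewrite Rintegral_cst//= (_ : fine _ = F (x j.+1) - F (x j))//.
by rewrite -[RHS]/(fine (F (x j.+1) - F (x j))%:E); congr fine; exact: question_mark_measure_itv.
Qed.

Lemma qm_int_le (g : R -> R) (M : R) : continuous01 g ->
  (forall x : R, 0 <= x <= 1 -> `|g x| <= M) -> `|qm_int g| <= M.
Proof.
move=> cg gM.
have := @qm_int_partition g (fun=> M) (fun k => (0 < k)%N%:R) 1 cg erefl erefl.
rewrite big_ord1 /= question_mark1 question_mark0 subr0 mulr1; apply.
- by move=> k; rewrite ler_nat; case: k.
- by move=> [|//] y _ y01; exact: gM.
Qed.
End Functional.

(** * Words and their denominators *)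

Section Words.
Context {R : realType}.
Local Notation phi := (golden_ratio R).
Local Notation alpha := (decay_alpha R).

(** The row (c, d) times the matrix of [mob e], with rows (1, 0), (1, 1) for [false] and (0, 1), (1,
    1) for [true]: appending a letter composes with a branch on the inside. *)
Definition row_step (p : nat * nat) (e : bool) : nat * nat :=
  if e then (p.2, (p.1 + p.2)%N) else ((p.1 + p.2)%N, p.2).

Definition row_word (p : nat * nat) (w : seq bool) : nat * nat := foldl row_step p w.

Lemma row_word_rcons p w e : row_word p (rcons w e) = row_step (row_word p w) e.
Proof. by rewrite /row_word foldl_rcons. Qed.

(** The start (1, 1) is the denominator row of both branches, so this is the denominator of the
    words [false :: w] and [true :: w] alike; only the numerators depend on the first letter. *)
Definition den (w : seq bool) : nat * nat := row_word (1, 1)%N w.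
Definition num (b : bool) (w : seq bool) : nat * nat :=
  row_word (if b then (0, 1) else (1, 0))%N w.
Definition height (w : seq bool) : nat := ((den w).1 + (den w).2)%N.

Definition linden (w : seq bool) (x : R) : R := (den w).1%:R * x + (den w).2%:R.

(* [branch b w] is the composition of the branches [mob] coded by [b :: w]. *)
Definition branch (b : bool) (w : seq bool) (x : R) : R :=
  ((num b w).1%:R * x + (num b w).2%:R) / linden w x.

Lemma den_rcons w e : den (rcons w e) = row_step (den w) e.
Proof. exact: row_word_rcons. Qed.

Lemma den_gt0 w : (0 < (den w).1)%N /\ (0 < (den w).2)%N.
Proof.
elim/last_ind: w => [//|w e [h1 h2]].
by rewrite den_rcons; case: e => /=; split; rewrite ?addn_gt0 ?h1 ?h2.
Qed.

Lemma linden_ge w (x : R) : 0 <= x -> (den w).2%:R <= linden w x.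
Proof. by move=> x0; rewrite /linden lerDr mulr_ge0. Qed.

Lemma linden_gt0 w (x : R) : 0 <= x -> 0 < linden w x.
Proof.
move=> x0; apply: (lt_le_trans _ (linden_ge w x0)).
by rewrite ltr0n; case: (den_gt0 w).
Qed.

Lemma branch_nil b (x : R) : branch b [::] x = mob b x.
Proof.
by rewrite /branch /linden /=; case: b; rewrite /= ?mul0r ?mul1r ?add0r ?addr0 addrC// mul1r.
Qed.

Lemma branch_rcons b w e (x : R) : 0 <= x ->
  branch b (rcons w e) x = branch b w (mob e x).
Proof.
move=> x0; have l0 := linden_gt0 (rcons w e) x0; move: l0.
rewrite /branch /linden den_rcons /num row_word_rcons -/(num b w).
have x1 : 1 + x != 0 by rewrite gt_eqF//; lra.
case: e => /=; rewrite natrD => l0.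
  have e1 (p q : R) : p * (1 + x)^-1 + q = (q * x + (p + q)) / (1 + x) by field.
  by rewrite !e1 natrD -mulf_div divff ?invr_eq0// mulr1.
have e1 (p q : R) : p * (x / (1 + x)) + q = ((p + q) * x + q) / (1 + x) by field.
by rewrite !e1 natrD -mulf_div divff ?invr_eq0// mulr1.
Qed.

Lemma det_word b w :
  (num b w).1%:R * (den w).2%:R - (num b w).2%:R * (den w).1%:R
    = (-1) ^+ (b + count id w) :> R.
Proof.
elim/last_ind: w => [|w e IH].
  by case: b; rewrite /= ?mul0r ?mulr1 ?mulr0 ?add0r ?sub0r ?subr0 ?expr1 ?expr0.
rewrite -cats1 count_cat cats1 den_rcons /num row_word_rcons -/(num b w) /= addn0 addnA exprD -IH.
by case: e => /=; rewrite !natrD ?expr1 ?expr0; ring.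
Qed.

Lemma is_derive_branch b w (x : R) : 0 <= x ->
  is_derive x (1 : R) (branch b w) ((-1) ^+ (b + count id w) / linden w x ^+ 2).
Proof.
move=> x0; have l0 : linden w x != 0 by rewrite gt_eqF ?linden_gt0.
have d1 : is_derive x (1 : R) (linden w) (den w).1%:R.
  by rewrite /linden; apply: is_derive_eq; rewrite /GRing.scale /=; ring.
have d2 := is_deriveV l0 d1.
rewrite /branch -det_word; apply: is_derive_eq; rewrite /GRing.scale /=.
by move: l0; rewrite /linden => l0; field.
Qed.

Lemma continuous01_branch b w : continuous01 (branch b w).
Proof. by move=> x /andP[x0 _]; apply: is_derive_continuous; exact: is_derive_branch. Qed.

(** The subtractive Euclidean algorithm: entries are positive, so c > d if the last letter is
    [false], c < d if it is [true], and c = d only for the empty word. The last letter can be read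
    off and removed. *)
Lemma den_inj : injective den.
Proof.
elim/last_ind => [|w e IH] w'.
  elim/last_ind: w' => [//|w' e _]; rewrite den_rcons.
  have [h1 h2] := den_gt0 w'; move: h1 h2; case: (den w') => c d /= h1 h2.
  by case: e => /= -[]; lia.
elim/last_ind: w' => [|w' e' _].
  rewrite den_rcons; have [h1 h2] := den_gt0 w; move: h1 h2; case: (den w) => c d /= h1 h2.
  by case: e => /= -[]; lia.
rewrite !den_rcons; have [h1 h2] := den_gt0 w; have [h3 h4] := den_gt0 w'.
move=> h.
suff [eE dE] : e = e' /\ den w = den w' by rewrite eE (IH _ dE).
move: h1 h2 h3 h4 h {IH}; case: (den w) => c d; case: (den w') => c' d' /=.
by case: e; case: e' => /= h1 h2 h3 h4 [] ? ?; split=> //; try congr pair; lia.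
Qed.

(** The form d + (phi - 1) c is multiplied by exactly phi under [true] and by at most phi under
    [false], so Fibonacci growth is extremal. It equals phi for the empty word, and one more factor
    phi compares it with c + d. *)
Lemma height_le w : (height w)%:R <= phi ^+ (size w + 2).
Proof.
have p1 := golden_ratio_gt1 (R := R); have pE := golden_ratio_eq (R := R).
have H : (den w).2%:R + (phi - 1) * (den w).1%:R <= phi ^+ (size w).+1.
  elim/last_ind: w => [|w e IH]; first by rewrite /= expr1; lra.
  rewrite den_rcons size_rcons exprS; move: IH; case: (den w) => c d /= IH.
  have IH' := ler_wpM2l (ltW (lt_trans ltr01 p1)) IH.
  apply: le_trans IH'.
  have -> : phi * (d%:R + (phi - 1) * c%:R) = phi * d%:R + (phi ^+ 2 - phi) * c%:R by ring.
  rewrite pE; case: e => /=; rewrite natrD; first by lra.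
  have -> : (phi + 1 - phi) * c%:R = (phi - 1) * c%:R + (2 - phi) * c%:R by ring.
  have : 0 <= (2 - phi) * c%:R.
    by rewrite mulr_ge0//; have /andP[_ ?] := golden_ratio_itv (R := R); lra.
  lra.
rewrite addn2 exprS; have {}H := ler_wpM2l (ltW (lt_trans ltr01 p1)) H.
apply: le_trans H; rewrite /height natrD.
have -> : phi * ((den w).2%:R + (phi - 1) * (den w).1%:R) = phi * (den w).2%:R + (phi ^+ 2 - phi) * (den w).1%:R by ring.
rewrite pE; have : 0 <= (phi - 1) * (den w).2%:R by rewrite mulr_ge0//; lra.
lra.
Qed.

(** Since phi^(2 alpha) = 2, the power 2 alpha of [height_le] reads Q^(2 alpha) <= 2^(size w +
    2). *)
Lemma weight_le w (Q : nat) : (0 < Q)%N -> (Q <= height w)%N ->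
  2 ^- size w <= 4 * Q%:R `^ (- (2 * alpha)) :> R.
Proof.
move=> Q0 Qh; have ag := alpha_gt0 (R := R).
have p1 := golden_ratio_gt1 (R := R); have p0 : 0 <= phi by lra.
have : Q%:R <= phi ^+ (size w + 2) by apply: (le_trans _ (height_le w)); rewrite ler_nat.
move=> /(@ge0_ler_powR _ (2 * alpha)); rewrite !nnegrE => /(_ ltac:(lra) ltac:(by []) ltac:(by apply: exprn_ge0)).
rewrite -powR_mulrn// powRAC golden_powR powR_mulrn// => h.
rewrite powRN -ler_pdivrMl// -[2 ^- _]mul1r mulrA mulr1 -exprVn.
have -> : 4^-1 * 2^-1 ^+ size w = (2 ^+ (size w + 2))^-1 :> R.
  by rewrite exprD invfM mulrC -exprVn; congr (_ * _); field.
by rewrite lef_pV2 ?posrE ?powR_gt0 ?exprn_gt0 ?ltr0n.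
Qed.
End Words.

(** * The stopping time and the weight of its exceptional words *)

Section Leaves.
Context {R : realType}.

(* The minimal words below [w] of height at least [Q] ([k] is fuel). *)
Fixpoint leaves (Q k : nat) (w : seq bool) : seq (seq bool) :=
  if (Q <= height w)%N then [:: w] else
  if k is k'.+1 then leaves Q k' (rcons w false) ++ leaves Q k' (rcons w true)
  else [:: w].

Lemma height_rcons w e : height (rcons w e) = (height w + (den w).2)%N.
Proof. by rewrite /height den_rcons; case: e => /=; lia. Qed.

(** A letter adds d to the height c + d. This is at least 1, so the fuel suffices, and less than the
    height itself, so a word that crosses Q stays below 2 Q. *)
Lemma leaves_height Q k w v : (Q <= k + height w)%N -> (height w < 2 * Q)%N ->
  v \in leaves Q k w -> (Q <= height v < 2 * Q)%N.
Proof.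
elim: k w => [|k IH] w /= hk hw.
  by rewrite add0n in hk; rewrite hk inE => /eqP ->; rewrite hk.
have [d1 d2] := den_gt0 w.
case: ifPn => [hQ|]; first by rewrite inE => /eqP ->; rewrite hQ.
rewrite -ltnNge => hQ; rewrite mem_cat => /orP[] /IH; apply; rewrite height_rcons;
  move: hk hQ d1 d2; rewrite /height; case: (den w) => c d /=; lia.
Qed.

Lemma leaves_prefix Q k w v : v \in leaves Q k w -> prefix w v.
Proof.
elim: k w => [|k IH] w /=; first by case: ifP => _; rewrite inE => /eqP ->; exact: prefix_refl.
case: ifP => _; first by rewrite inE => /eqP ->; exact: prefix_refl.
by rewrite mem_cat => /orP[] /IH; apply: prefix_trans; exact: prefix_rcons.
Qed.

Lemma leaves_uniq Q k w : uniq (leaves Q k w).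
Proof.
elim: k w => [|k IH] w /=; first by case: ifP.
case: ifP => // _; rewrite cat_uniq !IH andbT /=.
apply/hasPn => v /leaves_prefix /prefixP[s ->]; apply/negP => /leaves_prefix /prefixP[s'].
by rewrite !cat_rcons => /eqP; rewrite eqseq_cat// eqxx.
Qed.

Lemma leaves_sum (Phi : seq bool -> R) Q k w :
  (forall w, Phi w = Phi (rcons w false) + Phi (rcons w true)) ->
  \sum_(v <- leaves Q k w) Phi v = Phi w.
Proof.
move=> PhiE; elim: k w => [|k IH] w /=; first by case: ifP => _; rewrite big_seq1.
case: ifP => _; first by rewrite big_seq1.
by rewrite big_cat /= !IH -PhiE.
Qed.

Lemma leaves_weight Q k w : \sum_(v <- leaves Q k w) 2 ^- size v = 2 ^- size w :> R.
Proof.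
apply: leaves_sum => u; rewrite !size_rcons exprS invfM; field.
by rewrite expf_neq0.
Qed.

Lemma qm_int_eq (f g : R -> R) : (forall x, 0 <= x <= 1 -> f x = g x) ->
  qm_int f = qm_int g.
Proof.
move=> fg; rewrite /qm_int; apply: eq_Rintegral => x; rewrite inE /= in_itv /=.
exact: fg.
Qed.

Lemma qm_int_leaves (g : R -> R) b Q k : continuous g ->
  qm_int (g \o mob b) = \sum_(v <- leaves Q k [::]) 2 ^- size v * qm_int (g \o branch b v).
Proof.
move=> cg; rewrite (leaves_sum (Phi := fun v => 2 ^- size v * qm_int (g \o branch b v))).
  by rewrite expr0 invr1 mul1r; apply: qm_int_eq => x _ /=; rewrite branch_nil.
move=> w; rewrite !size_rcons.
have cgb v : continuous01 (g \o branch b v).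
  by move=> x x01; apply: continuous_comp; [exact: continuous01_branch|exact: cg].
rewrite qm_int_mob//.
have e (i : bool) : qm_int ((g \o branch b w) \o mob i) = qm_int (g \o branch b (rcons w i)).
  by apply: qm_int_eq => x /andP[x0 _] /=; rewrite branch_rcons.
by rewrite !e exprS invfM; field; rewrite expf_neq0.
Qed.

(* A word of height at least [Q] ending with a small second denominator ends with
   a long run of the letter [false]. *)
Lemma leaves_bad_weight (A D k : nat) w : (0 < A)%N -> (A * D <= k + height w)%N ->
  \sum_(v <- leaves (A * D) k w | ((den v).2 < D)%N) 2 ^- size v <=
  2 ^- size w * (((den w).2 < D)%N%:R * 2 * 2 ^- ((A * D - (den w).1) %/ (den w).2)
     + k%:R * 2 ^- A.-1) :> R.
Proof.
move=> A0; set Q := (A * D)%N.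
have i0 n : 0 <= 2 ^- n :> R by rewrite invr_ge0 exprn_ge0.
(* At a stopping word the remaining run has length at most 1, and the factor 2 in front of the first
   term covers the weight. *)
have stop u (z : R) : 0 <= z -> (Q <= height u)%N -> \sum_(v <- [:: u] | ((den v).2 < D)%N) 2 ^- size v <=
    2 ^- size u * (((den u).2 < D)%N%:R * 2 * 2 ^- ((Q - (den u).1) %/ (den u).2) + z) :> R.
  move=> z0 hu; rewrite big_mkcond big_seq1.
  have [d1 d2] := den_gt0 u.
  case: ifP => hd; last by rewrite mulr_ge0// !mul0r add0r.
  rewrite -[leLHS]mulr1 ler_wpM2l// mul1r ler_wpDr// -ler_pdivrMl// mulr1.
  have : ((Q - (den u).1) %/ (den u).2 <= 1)%N.
    have : (Q - (den u).1 <= (den u).2)%N by move: hu; rewrite /height; lia.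
    by move=> /(leq_div2r (den u).2); rewrite divnn d2.
  by case: (_ %/ _)%N => [|[|//]] _; rewrite ?expr0 ?expr1 ?invr1//; lra.
elim: k w => [|k IH] w /= hk.
  rewrite add0n in hk; rewrite hk; apply: stop => //.
have [d1 d2] := den_gt0 w.
case: ifPn => hQ; first by apply: stop => //; rewrite mulr_ge0.
rewrite -ltnNge in hQ.
rewrite big_cat /=.
have hk' e : (Q <= k + height (rcons w e))%N.
  by rewrite height_rcons; move: hk d2; rewrite /height; case: (den w) => c d /=; lia.
apply: (le_trans (lerD (IH _ (hk' false)) (IH _ (hk' true)))).
rewrite !den_rcons !size_rcons /=.
move: d1 d2 hQ; rewrite /height; case: (den w) => c d /= d1 d2 hQ.
have -> : 2 ^- (size w).+1 = 2 ^- size w / 2 :> R by rewrite exprSr invfM.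
rewrite -mulrDr -[_ / 2 * _]mulrA ler_wpM2l//.
(* A letter [false] keeps d and shortens the remaining run by one: the doubling compensates the
   factor 1/2 of the letter. *)
have e1 : 2 ^- ((Q - (c + d)) %/ d) = 2 * 2 ^- ((Q - c) %/ d) :> R.
  have -> : ((Q - c) %/ d = ((Q - (c + d)) %/ d).+1)%N.
    have -> : (Q - c = (Q - (c + d)) + d)%N by lia.
    by rewrite divnDr// divnn d2 addn1.
  by rewrite exprS invfM mulrA divff ?mul1r.
rewrite e1.
(* A letter [true] starts a new run, with second entry c + d. If this is below D, at least A - 1
   letters [false] are needed to reach A D. Each level of the recursion adds at most one such term,
   whence the factor [k]. *)
have e2 : ((c + d < D)%N)%:R * 2 * 2 ^- ((Q - d) %/ (c + d)) <= 2 * 2 ^- A.-1 :> R.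
  case: ltnP => h; last by rewrite !mul0r mulr_ge0.
  rewrite mul1r ler_wpM2l// lef_pV2 ?posrE ?exprn_gt0// ler_weXn2l ?ler1n//.
  have cd : (0 < c + d)%N by lia.
  rewrite leq_divRL//; rewrite /Q; case: A A0 @Q {IH stop hk hQ hk' e1} => // A _ _ /=; nia.
have := i0 A.-1; have := i0 ((Q - c) %/ d)%N.
rewrite -[k.+1%:R]natr1; case: (d < D)%N; rewrite ?mul0r ?mul1r; lra.
Qed.

Corollary leaves_bad_weight0 (A D : nat) : (0 < A)%N -> (0 < D)%N ->
  \sum_(v <- leaves (A * D) (A * D) [::] | ((den v).2 < D)%N) 2 ^- size v <=
  ((A * D)%:R + 2) * 2 ^- A.-1 :> R.
Proof.
move=> A0 D0; apply: (le_trans (@leaves_bad_weight A D (A * D) [::] A0 _)).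
  exact: leq_addr.
rewrite /= expr0 invr1 mul1r divn1 mulrDl addrC lerD2l.
have h : (2:R) ^- (A * D - 1) <= 2 ^- A.-1.
  rewrite lef_pV2 ?posrE ?exprn_gt0// ler_weXn2l ?ler1n// -subn1.
  by apply: leq_sub2r; exact: leq_pmulr.
have i0 n : 0 <= 2 ^- n :> R by rewrite invr_ge0 exprn_ge0.
by move: (i0 A.-1) h; case: (1 < D)%N; rewrite ?mul0r ?mul1r; lra.
Qed.

End Leaves.

(** * Sums over words as sums over lattice points *)

Section Lattice.
Context {R : realType}.

Definition ndist (m n : nat) : nat := ((m - n) + (n - m))%N.
Definition den_dist (w v : seq bool) : nat :=
  maxn (ndist (den w).1 (den v).1) (ndist (den w).2 (den v).2).

Lemma ler_sum_uniq (X : eqType) (s T : seq X) (f : X -> R) :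
  uniq s -> uniq T -> {subset s <= T} -> (forall x, 0 <= f x) ->
  \sum_(x <- s) f x <= \sum_(x <- T) f x.
Proof.
move=> us uT sT f0.
have sE : perm_eq s ([seq x <- T | x \in s]).
  apply: uniq_perm => //; first exact: filter_uniq.
  by move=> x; rewrite mem_filter; case: (boolP (x \in s)) => // xs; rewrite sT.
rewrite (perm_big _ sE) big_filter [leRHS](bigID (fun x => x \in s)) /= lerDl.
by apply: sumr_ge0 => x _.
Qed.

Lemma sum_ndist (psi : nat -> R) U :
  \sum_(0 <= i < 2 * U + 1) psi (ndist i U) = psi 0 + 2 * \sum_(j < U) psi j.+1.
Proof.
rewrite (@big_cat_nat _ _ _ U)//=; last by lia.
have -> : \sum_(0 <= i < U) psi (ndist i U) = \sum_(j < U) psi j.+1.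
  rewrite big_mkord (reindex_inj rev_ord_inj); apply: eq_bigr => i _ /=.
  congr psi; rewrite /ndist; have := ltn_ord i; lia.
have -> : \sum_(U <= i < 2 * U + 1) psi (ndist i U) = psi 0 + \sum_(j < U) psi j.+1.
  rewrite big_ltn; last by lia.
  congr (_ + _); first by congr psi; rewrite /ndist; lia.
  rewrite -{1}[U.+1]add0n big_addn (_ : (2 * U + 1 - U.+1 = U)%N); last by lia.
  by rewrite big_mkord; apply: eq_bigr => i _; congr psi; rewrite /ndist; lia.
ring.
Qed.

(** By [den_inj] the words near [v] inject into a square of side 2 U + 1, shifted to have natural
    coordinates. The summand depends on the first coordinate only, and the second one costs the
    factor 2 U + 1. *)
Lemma near_sum (W : seq (seq bool)) (v : seq bool) U (psi : nat -> R) :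
  uniq W -> (forall n, 0 <= psi n) ->
  \sum_(w <- W | (den_dist w v <= U)%N) psi (ndist (den w).1 (den v).1) <=
  (2 * U + 1)%:R * (psi 0 + 2 * \sum_(j < U) psi j.+1).
Proof.
move=> uW psi0.
pose key (w : seq bool) := ((den w).1 + U - (den v).1, (den w).2 + U - (den v).2)%N.
pose near (w : seq bool) := (den_dist w v <= U)%N.
have nearP w : near w -> [/\ ((den v).1 <= (den w).1 + U)%N, ((den w).1 <= (den v).1 + U)%N,
     ((den v).2 <= (den w).2 + U)%N & ((den w).2 <= (den v).2 + U)%N].
  by rewrite /near /den_dist geq_max /ndist => /andP[h1 h2]; split; lia.
have -> : \sum_(w <- W | near w) psi (ndist (den w).1 (den v).1) =
    \sum_(p <- map key [seq w <- W | near w]) psi (ndist p.1 U).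
  rewrite big_map big_filter; apply: eq_bigr => w /nearP[h1 h2 h3 h4].
  by rewrite /key /ndist /=; congr psi; lia.
pose T := [seq (i, j) | i <- iota 0 (2 * U + 1), j <- iota 0 (2 * U + 1)].
apply: (@le_trans _ _ (\sum_(p <- T) psi (ndist p.1 U))).
  apply: ler_sum_uniq => //.
  - rewrite map_inj_in_uniq ?filter_uniq// => w w'.
    rewrite !mem_filter => /andP[/nearP[h1 h2 h3 h4] _] /andP[/nearP[k1 k2 k3 k4] _].
    rewrite /key => -[e1 e2]; apply: den_inj.
    by move: h1 h2 h3 h4 k1 k2 k3 k4 e1 e2; case: (den w) (den w') => ? ? [? ?] /=; intros; congr pair; lia.
  - by apply: allpairs_uniq; rewrite ?iota_uniq// => -[? ?] [? ?] _ _ [-> ->].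
  - move=> p /mapP[w]; rewrite mem_filter => /andP[/nearP[h1 h2 h3 h4] _] ->.
    apply/allpairsP; exists (key w); rewrite !mem_iota /key /=; split=> //; lia.
rewrite /T big_allpairs -sum_ndist /index_iota subn0 mulr_sumr.
rewrite le_eqVlt; apply/orP; left; apply/eqP; apply: eq_bigr => i _ /=.
by rewrite big_const_seq count_predT size_iota iter_addr addr0 mulr_natl.
Qed.

Lemma sum_invsqrt U : \sum_(j < U) (Num.sqrt j.+1%:R)^-1 <= 2 * Num.sqrt U%:R :> R.
Proof.
elim: U => [|U IH]; first by rewrite big_ord0 sqrtr0 mulr0.
rewrite big_ord_recr /=; apply: (le_trans (lerD IH (lexx _))).
set a := Num.sqrt U%:R; set b := Num.sqrt U.+1%:R.
have b0 : 0 < b by rewrite sqrtr_gt0.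
have a0 : 0 <= a by rewrite sqrtr_ge0.
have ab : b ^+ 2 = a ^+ 2 + 1 by rewrite !sqr_sqrtr// natr1.
rewrite -lerBrDl -mulrBr -[leLHS]mul1r ler_pdivrMr//.
nra.
Qed.

Lemma den_dist_gt0 w v : v != w -> (0 < den_dist v w)%N.
Proof.
move=> vw; rewrite lt0n; apply: contra vw => /eqP d0; apply/eqP/den_inj.
move: d0; rewrite /den_dist /ndist; case: (den w) (den v) => ? ? [? ?] /= d0.
by congr pair; lia.
Qed.

(** Words at distance at most U are counted as lattice points, each of weight at most P, which gives
    P U^(3/2). For the others the total weight 1 multiplies U^(-1/2). The constant is 15 = 3 * 5,
    from 2 U + 1 <= 3 U and 1 + 4 sqrt U <= 5 sqrt U. *)
Lemma pair_sum (W : seq (seq bool)) (v : seq bool) U (P : R) :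
  uniq W -> (0 < U)%N -> 0 <= P ->
  (forall w, w \in W -> 2 ^- size w <= P) ->
  \sum_(w <- W) 2 ^- size w <= 1 :> R ->
  \sum_(w <- W | w != v) 2 ^- size w * (Num.sqrt (den_dist w v)%:R)^-1 <=
   15 * P * (U%:R * Num.sqrt U%:R) + (Num.sqrt U%:R)^-1.
Proof.
move=> uW U0 P0 Pw sw.
have i0 n : 0 <= 2 ^- n :> R by rewrite invr_ge0 exprn_ge0.
have s0 : 0 < Num.sqrt U%:R :> R by rewrite sqrtr_gt0 ltr0n.
rewrite (bigID (fun w => (den_dist w v <= U)%N)) /=; apply: lerD; last first.
  apply: (@le_trans _ _ (\sum_(w <- W) 2 ^- size w * (Num.sqrt U%:R)^-1)).
    rewrite [leRHS](bigID (fun w => (w != v) && ~~ (den_dist w v <= U)%N)) /=.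
    apply: ler_wpDr; first by apply: sumr_ge0 => w _; rewrite mulr_ge0// invr_ge0 ltW.
    apply: ler_sum => w /andP[_]; rewrite -ltnNge => h.
    rewrite ler_wpM2l// lef_pV2 ?posrE// ?ler_wsqrtr// ?ler_nat ?(ltnW h)//.
    by rewrite sqrtr_gt0 ltr0n (leq_trans U0 (ltnW h)).
  by rewrite -mulr_suml -[leRHS]mul1r ler_wpM2r// invr_ge0 ltW.
(* Replacing the distance by its first coordinate only enlarges the summand and keeps the order
   U^(3/2); [maxn 1] treats equal first coordinates. *)
pose psi (n : nat) : R := (Num.sqrt (maxn 1 n)%:R)^-1.
have psi0 n : 0 <= psi n by rewrite invr_ge0 sqrtr_ge0.
apply: (@le_trans _ _ (\sum_(w <- W | (den_dist w v <= U)%N) P * psi (ndist (den w).1 (den v).1))).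
  rewrite big_seq_cond [leRHS]big_seq_cond.
  rewrite [leRHS](bigID (fun w => w != v)) /=.
  apply: ler_wpDr; first by apply: sumr_ge0 => w _; rewrite mulr_ge0.
  rewrite [leRHS](eq_bigl (fun w => (w \in W) && ((w != v) && (den_dist w v <= U)%N))); last first.
    by move=> w; rewrite -andbA [_ && (w != v)]andbC.
  apply: ler_sum => w /andP[wW /andP[wv h]].
  have dv := den_dist_gt0 wv.
  apply: ler_pM => //; first exact: Pw.
  rewrite /psi lef_pV2 ?posrE ?sqrtr_gt0 ?ltr0n//; last by rewrite leq_max.
  by rewrite ler_wsqrtr// ler_nat geq_max dv /den_dist leq_maxl.
rewrite -mulr_sumr; apply: (le_trans (ler_wpM2l P0 (near_sum v U uW psi0))).
rewrite [15 * P]mulrC -[leRHS]mulrA ler_wpM2l//.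
have -> : psi 0 = 1 by rewrite /psi maxn0 sqrtr1 invr1.
have h : \sum_(j < U) psi j.+1 <= 2 * Num.sqrt U%:R.
  apply: le_trans (sum_invsqrt U); apply: ler_sum => j _.
  by rewrite /psi (maxn_idPr _).
have s1 : 1 <= Num.sqrt U%:R :> R by rewrite -{1}sqrtr1 ler_wsqrtr// ler1n.
have U1 : 1 <= U%:R :> R by rewrite ler1n.
have S0 : 0 <= \sum_(j < U) psi j.+1 by apply: sumr_ge0.
rewrite natrD natrM.
apply: (@le_trans _ _ (3 * U%:R * (5 * Num.sqrt U%:R))).
  by apply: ler_pM; lra.
by rewrite le_eqVlt; apply/orP; left; apply/eqP; ring.
Qed.
End Lattice.

(** * The mean square of the exponential sum *)

Section Core.
Context {R : realType}.
Local Notation Q01 := (@question_mark R).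
Local Notation alpha := (decay_alpha R).

Lemma primitive_on_sum (I : Type) (s : seq I) (a b : R) (F f : I -> R -> R) (c : I -> R) :
  (forall i, primitive_on a b (F i) (f i)) ->
  primitive_on a b (fun x => \sum_(i <- s) c i * F i x) (fun x => \sum_(i <- s) c i * f i x).
Proof.
move=> dF x xab; elim: s => [|i s IH].
  under eq_fun do rewrite big_nil; rewrite big_nil; exact: is_derive_cst.
under eq_fun do rewrite big_cons; rewrite big_cons.
have di := dF i x xab; apply: is_derive_eq; rewrite /GRing.scale /=; ring.
Qed.

(** In place of the Cauchy-Schwarz inequality, |g| <= (lambda g^2 + 1 / lambda) / 2. On each
    interval of length 1 / N the Sobolev bound controls g^2 and the Hoelder bound controls the mass,
    while the masses multiplying 1 / lambda add up to 1. *)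
Lemma large_sieve (g U V u v E1 E2 : R -> R) (N : nat) (lambda : R) :
  (0 < N)%N -> 0 < lambda -> continuous01 g ->
  (forall x : R, 0 <= x <= 1 -> g x ^+ 2 <= U x ^+ 2 + V x ^+ 2) ->
  primitive_on 0 1 U u -> primitive_on 0 1 V v ->
  primitive_on 0 1 E1 (fun z => U z ^+ 2 + V z ^+ 2) ->
  primitive_on 0 1 E2 (fun z => u z ^+ 2 + v z ^+ 2) ->
  `|qm_int g| <= (lambda * (2 * 8 `^ alpha * N%:R^-1 `^ alpha) *
     (2 * N%:R * (E1 1 - E1 0) + N%:R^-1 * (E2 1 - E2 0)) + lambda^-1) / 2.
Proof.
move=> N0 l0 cg gUV dU dV dE1 dE2.
have n0 : 0 < N%:R :> R by rewrite ltr0n.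
have nN : N%:R != 0 :> R by rewrite gt_eqF.
pose x (k : nat) : R := k%:R / N%:R.
have xS k : x k.+1 = x k + N%:R^-1 by rewrite /x -natr1 mulrDl mul1r.
pose Phi (y : R) : R := 2 * N%:R * E1 y + N%:R^-1 * E2 y.
pose s (k : nat) : R := (lambda * (Phi (x k.+1) - Phi (x k)) + lambda^-1) / 2.
have x01 k : (k <= N)%N -> 0 <= x k <= 1.
  by move=> kN; rewrite /x divr_ge0//= ler_pdivrMr// mul1r ler_nat.
have hN : 0 < N%:R^-1 :> R by rewrite invr_gt0.
have key k (y : R) : (k < N)%N -> x k <= y <= x k.+1 -> U y ^+ 2 + V y ^+ 2 <= Phi (x k.+1) - Phi (x k).
  move=> kN; rewrite xS => hy.
  have /andP[k0 _] := x01 k (ltnW kN); have /andP[_ k1] := x01 k.+1 kN.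
  rewrite xS in k1.
  have := sqr_le_increment hN (primitive_onS k0 k1 dU) (primitive_onS k0 k1 dV)
    (primitive_onS k0 k1 dE1) (primitive_onS k0 k1 dE2) hy.
  rewrite invrK => h; apply: (le_trans h); rewrite /Phi.
  by rewrite le_eqVlt; apply/orP; left; apply/eqP; ring.
have Phi_ge0 k : (k < N)%N -> 0 <= Phi (x k.+1) - Phi (x k).
  move=> kN; apply: (le_trans _ (key k (x k) kN _)); first by rewrite addr_ge0 ?sqr_ge0.
  by rewrite lexx xS lerDl ltW.
apply: (le_trans (@qm_int_partition _ g s x N cg _ _ _ _)).
- by rewrite /x mul0r.
- by rewrite /x divff.
- by move=> k; rewrite xS lerDl ltW.
- move=> k y kN hy.
  have y01 : 0 <= y <= 1.
    have /andP[k0 _] := x01 k (ltnW kN); have /andP[_ k1] := x01 k.+1 kN.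
    by move: hy => /andP[h1 h2]; rewrite (le_trans k0)//= (le_trans h2).
  have h := le_trans (gUV y y01) (key k y kN hy).
  rewrite /s -ler_pdivrMr// invrK.
  rewrite -real_normK ?num_real// in h.
  have := normr_ge0 (g y); move: h; move: (`|g y|) (Phi _ - Phi _) => z p h z0.
  have e0 : 0 <= lambda * (z - lambda^-1) ^+ 2 by rewrite mulr_ge0 ?sqr_ge0// ltW.
  have e1 : lambda * (z - lambda^-1) ^+ 2 = lambda * z ^+ 2 - z * 2 + lambda^-1.
    by field; rewrite gt_eqF.
  have e2 : lambda * z ^+ 2 <= lambda * p by rewrite ler_wpM2l// ltW.
  by rewrite e1 in e0; lra.
set H := 2 * 8 `^ alpha * N%:R^-1 `^ alpha.
have QH k : (k < N)%N -> Q01 (x k.+1) - Q01 (x k) <= H.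
  move=> kN; have /andP[k0 _] := x01 k (ltnW kN); have /andP[_ k1] := x01 k.+1 kN.
  apply: (le_trans (question_mark_Hoelder k0 _ k1)); first by rewrite xS lerDl ltW.
  by rewrite xS addrAC subrr add0r.
have tele (G : R -> R) : \sum_(k < N) (G (x k.+1) - G (x k)) = G 1 - G 0.
  rewrite -(big_mkord xpredT (fun k => G (x k.+1) - G (x k))).
  by rewrite (telescope_sumr (G \o x))//= /x mul0r divff.
apply: (@le_trans _ _ (\sum_(k < N) (lambda * H * (Phi (x k.+1) - Phi (x k)) / 2 + lambda^-1 / 2 * (Q01 (x k.+1) - Q01 (x k))))).
  apply: ler_sum => -[k kN] _ /=; rewrite /s.
  have h1 := Phi_ge0 k kN; have h2 := QH k kN.
  have h3 : 0 <= lambda * (Phi (x k.+1) - Phi (x k)) * (H - (Q01 (x k.+1) - Q01 (x k))).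
    by rewrite mulr_ge0 ?subr_ge0// mulr_ge0// ltW.
  rewrite -subr_ge0.
  have -> : lambda * H * (Phi (x k.+1) - Phi (x k)) / 2 + lambda^-1 / 2 * (Q01 (x k.+1) - Q01 (x k)) -
     (lambda * (Phi (x k.+1) - Phi (x k)) + lambda^-1) / 2 * (Q01 (x k.+1) - Q01 (x k)) =
     lambda * (Phi (x k.+1) - Phi (x k)) * (H - (Q01 (x k.+1) - Q01 (x k))) / 2 by ring.
  by rewrite divr_ge0.
rewrite big_split /= -mulr_suml -!mulr_sumr !tele question_mark1 question_mark0 subr0 mulr1.
by rewrite le_eqVlt; apply/orP; left; apply/eqP; rewrite /Phi; ring.
Qed.

(** A Schur type argument: each row is bounded uniformly, by a P for the diagonal entry and by
    [pair_sum] for the others, and the outer weights add up to at most 1. *)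
Lemma double_sum_bound (W : seq (seq bool)) U (P B a : R) (G : seq bool -> seq bool -> R) :
  uniq W -> (0 < U)%N -> 0 <= P -> 0 <= B -> 0 <= a ->
  (forall w, w \in W -> 2 ^- size w <= P) ->
  \sum_(w <- W) 2 ^- size w <= 1 :> R ->
  (forall w, w \in W -> `|G w w| <= a) ->
  (forall w v, w \in W -> v \in W -> v != w ->
     `|G w v| <= a * (B * (Num.sqrt (den_dist v w)%:R)^-1)) ->
  \sum_(w <- W) 2 ^- size w * (\sum_(v <- W) 2 ^- size v * G w v) <=
  a * (P + B * (15 * P * (U%:R * Num.sqrt U%:R) + (Num.sqrt U%:R)^-1)).
Proof.
move=> uW U0 P0 B0 a0 Pw sw Gd Go.
set X := a * _.
have i0 n : 0 <= 2 ^- n :> R by rewrite invr_ge0 exprn_ge0.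
have X0 : 0 <= X.
  rewrite mulr_ge0// addr_ge0// mulr_ge0// addr_ge0 ?invr_ge0 ?sqrtr_ge0//.
  by rewrite !mulr_ge0// sqrtr_ge0.
apply: (@le_trans _ _ (\sum_(w <- W) 2 ^- size w * X)); last first.
  by rewrite -mulr_suml -[leRHS]mul1r ler_wpM2r.
rewrite big_seq [leRHS]big_seq; apply: ler_sum => w wW; rewrite ler_wpM2l//.
rewrite (bigD1_seq w)//= /X mulrDr; apply: lerD.
  apply: (le_trans (ler_norm _)); rewrite normrM mulrC (ger0_norm (i0 _)).
  by apply: ler_pM => //; [exact: Gd|exact: Pw].
apply: (@le_trans _ _ (a * (B * (\sum_(v <- W | v != w) 2 ^- size v * (Num.sqrt (den_dist v w)%:R)^-1)))).
  rewrite !mulr_sumr big_seq_cond [leRHS]big_seq_cond; apply: ler_sum => v /andP[vW vw].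
  have := Go w v wW vW vw => h.
  have -> : a * (B * (2 ^- size v / Num.sqrt (den_dist v w)%:R)) = 2 ^- size v * (a * (B * (Num.sqrt (den_dist v w)%:R)^-1)).
    by ring.
  by rewrite ler_wpM2l// (le_trans (ler_norm _)).
by rewrite ler_wpM2l// ler_wpM2l//; exact: pair_sum.
Qed.

Lemma ndistE (m n : nat) : (ndist m n)%:R = `|m%:R - n%:R| :> R.
Proof.
rewrite /ndist; case: (leqP m n) => h.
  rewrite (eqP (_ : (m - n == 0)%N)) ?subn_eq0// add0n natrB// distrC ger0_norm//.
  by rewrite subr_ge0 ler_nat.
have h' := ltnW h; rewrite [(n - m)%N](eqP (_ : (n - m == 0)%N)) ?subn_eq0// addn0 natrB//.
by rewrite ger0_norm// subr_ge0 ler_nat.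
Qed.

(* Here 32 = 2 * 16, from [(l l')^2 <= 16 Q^4] and the distance [m / 2] in
   [dist_dichotomy]. *)
Definition osc_const (Q D : nat) (t : R) : R :=
  12 * Num.sqrt (32 * Q%:R ^+ 5 / (D%:R ^+ 2 * `|t|)).

(** * Oscillation estimates for a pair of words *)

Section PairBounds.
Variables (b : bool) (w v : seq bool) (Q D : nat) (t : R).

(** The half is lost when |z| < 2 |u|: there the maximum of |u| and |z| is at most 2 |u|. *)
Lemma dist_dichotomy : v != w ->
  let m := (den_dist v w)%:R / 2 : R in
  let u := (den v).1%:R - (den w).1%:R : R in
  let z := (den v).2%:R - (den w).2%:R : R in
  2 * `|u| <= `|z| /\ m <= `|z| \/ `|z| < 2 * `|u| /\ m <= `|u|.
Proof.
move=> vw m u z; have m0 := den_dist_gt0 vw; rewrite /m /u /z -!ndistE /den_dist.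
set i := ndist _ _; set j := ndist _ _.
rewrite -natrM ler_nat ltr_nat.
have h (p q : nat) : (p <= 2 * q)%N -> p%:R / 2 <= q%:R :> R.
  by move=> pq; rewrite ler_pdivrMr// mulrC -natrM ler_nat.
have [ij|ij] := leqP (2 * i) j; [left|right]; split => //; apply: h; lia.
Qed.

Hypotheses (vw : v != w) (tn0 : t != 0) (Dgt0 : (0 < D)%N) (DQ : (D <= Q)%N)
  (sgE : odd (b + count id w) = odd (b + count id v))
  (hw : (height w < 2 * Q)%N) (hv : (height v < 2 * Q)%N)
  (dw : (D <= (den w).2)%N) (dv : (D <= (den v).2)%N).

Lemma linden_itv (x : R) u : (height u < 2 * Q)%N -> 0 <= x <= 1 -> (D <= (den u).2)%N ->
  D%:R <= linden u x <= 2 * Q%:R.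
Proof.
move=> hu /andP[x0 x1] du; rewrite (le_trans _ (linden_ge u x0)) ?ler_nat//=.
apply: (@le_trans _ _ (height u)%:R); last by rewrite -natrM ler_nat ltnW.
by rewrite /height natrD /linden lerD2r ler_piMr.
Qed.

Lemma den1_itv u : (height u < 2 * Q)%N -> 0 <= ((den u).1%:R : R) <= 2 * Q%:R.
Proof.
move=> hu; rewrite ler0n -natrM ler_nat (leq_trans _ (ltnW hu))//.
by rewrite /height leq_addr.
Qed.

Lemma branchB_derive : primitive_on 0 1 (fun x => branch b w x - branch b v x)
  (fun x : R => (-1) ^+ (b + count id w) *
     ((((den w).1%:R * x + (den w).2%:R) ^+ 2)^-1 - (((den v).1%:R * x + (den v).2%:R) ^+ 2)^-1)).
Proof.
move=> x /andP[x0 _]; have h1 := is_derive_branch b w x0; have h2 := is_derive_branch b v x0.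
apply: (is_derive_eq (is_deriveB h1 h2)).
rewrite -/(linden w x) -/(linden v x) -[in (-1) ^+ (b + count id v)]signr_odd -sgE signr_odd; ring.
Qed.

(** A pair term of |F|^2. Its amplitude 1 is written N / (l l')^2 with N = (l l')^2, and l, l' <= 2
    Q gives N0 = 16 Q^4. *)
Lemma pair_bound (Psi : R -> R) :
  primitive_on 0 1 Psi (fun x => cos (t * (branch b w x - branch b v x))) ->
  `|Psi 1 - Psi 0| <= osc_const Q D t * (Num.sqrt (den_dist v w)%:R)^-1.
Proof.
move=> dPsi.
have D0 : 0 < D%:R :> R by rewrite ltr0n.
have DQ' : D%:R <= Q%:R :> R by rewrite ler_nat.
have Q0 : 0 < Q%:R :> R by exact: lt_le_trans DQ'.
have m0 : 0 < (den_dist v w)%:R :> R by rewrite ltr0n den_dist_gt0.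
have at0 : 0 < `|t| by rewrite normr_gt0.
pose N (x : R) : R := (linden w x * linden v x) ^+ 2.
pose n (x : R) : R := 2 * (linden w x * linden v x) *
  ((den w).1%:R * linden v x + linden w x * (den v).1%:R).
have dN : primitive_on 0 1 N n.
  move=> x _; rewrite /N /n /linden; apply: is_derive_eq; rewrite /GRing.scale /=; ring.
have lw (x : R) : 0 <= x <= 1 -> 0 <= linden w x <= 2 * Q%:R.
  by move=> x01; have /andP[h1 ->] := linden_itv hw x01 dw; rewrite (le_trans _ h1)// ltW.
have lv (x : R) : 0 <= x <= 1 -> 0 <= linden v x <= 2 * Q%:R.
  by move=> x01; have /andP[h1 ->] := linden_itv hv x01 dv; rewrite (le_trans _ h1)// ltW.
have /andP[c0 c1] := den1_itv hw; have /andP[c'0 c'1] := den1_itv hv.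
have NE (q : R) : 16 * q ^+ 4 = (2 * q * (2 * q)) ^+ 2 by ring.
have e0 : (-1) ^+ (b + count id w) * (-1) ^+ (b + count id w) = 1 :> R.
  by rewrite -expr2 sqrr_sign.
have e1 : 0 < 16 * Q%:R ^+ 4 :> R by rewrite mulr_gt0 ?exprn_gt0.
apply: (le_trans (@oscillatory_pair R (den w).1%:R (den w).2%:R (den v).1%:R (den v).2%:R
  Q%:R D%:R ((-1) ^+ (b + count id w)) t 1 (16 * Q%:R ^+ 4) ((den_dist v w)%:R / 2)
  (fun x => branch b w x - branch b v x) Psi (fun=> 1) N n D0 DQ' tn0
  e0 e1 ltr01 (den1_itv hw) (den1_itv hv) _ _ branchB_derive dN _ _ _ _ _ _ (dist_dichotomy vw))).
- by move=> x x01; have /andP[] := linden_itv hw x01 dw.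
- by move=> x x01; have /andP[] := linden_itv hv x01 dv.
- move=> x x01; have /andP[l0 l1] := lw x x01; have /andP[l'0 l'1] := lv x x01.
  rewrite ger0_norm ?sqr_ge0// NE /N !expr2.
  by apply: ler_pM; rewrite ?mulr_ge0//; apply: ler_pM.
- move=> x x01; have /andP[l0 l1] := lw x x01; have /andP[l'0 l'1] := lv x x01.
  rewrite ger0_norm /n; last by rewrite !mulr_ge0// addr_ge0// mulr_ge0.
  have -> : 4 * (16 * Q%:R ^+ 4) = 2 * (2 * Q%:R * (2 * Q%:R)) * (2 * Q%:R * (2 * Q%:R) + 2 * Q%:R * (2 * Q%:R)) :> R by ring.
  apply: ler_pM; rewrite ?addr_ge0 ?mulr_ge0//; first by rewrite ler_pM2l// ler_pM.
  by apply: lerD; apply: ler_pM.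
- move=> x /andP[x0 _]; rewrite /N -/(linden w x) -/(linden v x) divff//.
  by rewrite expf_neq0// mulf_neq0// gt_eqF// linden_gt0.
- by move=> x _; rewrite normr1.
- by move=> x x01; rewrite mul1r; exact: dPsi.
- by rewrite divr_gt0.
rewrite /osc_const -[leRHS]mulrA ler_pM2l// -sqrtrV ?ler0n// -sqrtrM; last first.
  by rewrite !mulr_ge0 ?invr_ge0 ?mulr_ge0 ?exprn_ge0// ltW.
rewrite le_eqVlt; apply/orP; left; apply/eqP; congr Num.sqrt.
by field; rewrite !gt_eqF.
Qed.

(** A pair term of |F'|^2 / t^2: now N = 1 and the amplitude is at most D^-4. The estimate is
    weakened by powers of Q / D >= 1 to D^-4 times that of [pair_bound], so that one double sum
    serves both. *)
Lemma pair_bound_derive (Psi : R -> R) :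
  primitive_on 0 1 Psi (fun x => (linden w x * linden v x) ^- 2 *
     cos (t * (branch b w x - branch b v x))) ->
  `|Psi 1 - Psi 0| <= D%:R ^- 4 * (osc_const Q D t * (Num.sqrt (den_dist v w)%:R)^-1).
Proof.
move=> dPsi.
have D0 : 0 < D%:R :> R by rewrite ltr0n.
have DQ' : D%:R <= Q%:R :> R by rewrite ler_nat.
have Q0 : 0 < Q%:R :> R by exact: lt_le_trans DQ'.
have m0 : 0 < (den_dist v w)%:R :> R by rewrite ltr0n den_dist_gt0.
have at0 : 0 < `|t| by rewrite normr_gt0.
have e0 : (-1) ^+ (b + count id w) * (-1) ^+ (b + count id w) = 1 :> R.
  by rewrite -expr2 sqrr_sign.
have a0 : 0 < D%:R ^- 4 :> R by rewrite invr_gt0 exprn_gt0.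
have dN : primitive_on 0 1 (fun=> 1 : R) (fun=> 0 : R).
  by move=> x _; exact: is_derive_cst.
apply: (le_trans (@oscillatory_pair R (den w).1%:R (den w).2%:R (den v).1%:R (den v).2%:R
  Q%:R D%:R ((-1) ^+ (b + count id w)) t (D%:R ^- 4) 1 ((den_dist v w)%:R / 2)
  (fun x => branch b w x - branch b v x) Psi (fun x => (linden w x * linden v x) ^- 2)
  (fun=> 1) (fun=> 0) D0 DQ' tn0
  e0 ltr01 a0 (den1_itv hw) (den1_itv hv) _ _ branchB_derive dN _ _ _ _ dPsi _ (dist_dichotomy vw))).
- by move=> x x01; have /andP[] := linden_itv hw x01 dw.
- by move=> x x01; have /andP[] := linden_itv hv x01 dv.
- by move=> x _; rewrite normr1.
- by move=> x _; rewrite normr0 mulr1.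
- by move=> x _; rewrite mul1r.
- move=> x x01; have /andP[l0 _] := linden_itv hw x01 dw; have /andP[l'0 _] := linden_itv hv x01 dv.
  rewrite ger0_norm ?invr_ge0 ?sqr_ge0//.
  have DD : 0 < D%:R ^+ 4 :> R by rewrite exprn_gt0.
  have h : D%:R ^+ 4 <= (linden w x * linden v x) ^+ 2.
    rewrite -[4%N]/(2 * 2)%N exprM !expr2.
    have h : D%:R * D%:R <= linden w x * linden v x by apply: ler_pM => //; exact: ltW.
    by apply: ler_pM => //; rewrite mulr_ge0// ltW.
  by rewrite lef_pV2// posrE (lt_le_trans DD).
- by rewrite divr_gt0.
pose X : R := 32 * Q%:R ^+ 5 / (D%:R ^+ 2 * `|t|).
have X0 : 0 <= X by rewrite divr_ge0 ?mulr_ge0 ?exprn_ge0// ltW.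
have -> : D%:R ^- 4 * (osc_const Q D t * (Num.sqrt (den_dist v w)%:R)^-1) =
    12 * Num.sqrt (D%:R ^- 4 ^+ 2 * (X / (den_dist v w)%:R)).
  rewrite sqrtrM ?sqr_ge0// sqrtr_sqr (ger0_norm (ltW a0)) sqrtrM// sqrtrV ?ler0n//.
  by rewrite /osc_const -/X; ring.
rewrite ler_pM2l//; apply: ler_wsqrtr.
have r1 : 1 <= Q%:R ^+ 4 / D%:R ^+ 4 :> R.
  by rewrite ler_pdivlMr ?exprn_gt0// mul1r lerXn2r// nnegrE ltW.
pose Y : R := D%:R ^- 4 * (Q%:R / (D%:R ^+ 2 * `|t|)) / (den_dist v w)%:R.
have Y0 : 0 <= Y by rewrite !mulr_ge0 ?invr_ge0 ?mulr_ge0 ?exprn_ge0// ltW.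
have -> : D%:R ^- 4 * (1 * Q%:R / (D%:R ^+ 2 * `|t|)) / ((den_dist v w)%:R / 2) = 2 * Y.
  by rewrite /Y; field; rewrite !gt_eqF.
have -> : D%:R ^- 4 ^+ 2 * (X / (den_dist v w)%:R) = 32 * (Q%:R ^+ 4 / D%:R ^+ 4) * Y.
  by rewrite /Y /X; field; rewrite !gt_eqF.
by rewrite ler_wpM2r//; lra.
Qed.
End PairBounds.
End Core.

Section Assembly.
Context {R : realType}.
Local Notation alpha := (decay_alpha R).

Lemma primitive_on_eq (a b : R) (P p q : R -> R) :
  (forall x, a <= x <= b -> p x = q x) -> primitive_on a b P p -> primitive_on a b P q.
Proof. by move=> pq dP x xab; rewrite -pq//; exact: dP. Qed.

Lemma sqr_weighted_sum (I : Type) (W : seq I) (p x : I -> R) :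
  (\sum_(w <- W) p w * x w) ^+ 2 = \sum_(w <- W) p w * (\sum_(v <- W) p v * (x w * x v)).
Proof.
rewrite expr2 big_distrl /=; apply: eq_bigr => w _.
by rewrite !big_distrr /=; apply: eq_bigr => v _; ring.
Qed.

Lemma is_derive_cosM (t : R) (f : R -> R) (df x : R) : is_derive x (1 : R) f df ->
  is_derive x (1 : R) (fun y => cos (t * f y)) (- sin (t * f x) * (t * df)).
Proof.
move=> d; have d2 : is_derive x (1 : R) (fun y => t * f y) (t * df).
  by apply: is_derive_eq; rewrite /GRing.scale /=; ring.
exact: (@is_derive1_comp _ cos (fun y => t * f y)).
Qed.

Lemma is_derive_sinM (t : R) (f : R -> R) (df x : R) : is_derive x (1 : R) f df ->
  is_derive x (1 : R) (fun y => sin (t * f y)) (cos (t * f x) * (t * df)).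
Proof.
move=> d; have d2 : is_derive x (1 : R) (fun y => t * f y) (t * df).
  by apply: is_derive_eq; rewrite /GRing.scale /=; ring.
exact: (@is_derive1_comp _ sin (fun y => t * f y)).
Qed.

Lemma continuous01_osc b w v (t : R) :
  continuous01 (fun x => cos (t * (branch b w x - branch b v x))).
Proof.
move=> x /andP[x0 _]; have d1 := is_derive_branch b w x0; have d2 := is_derive_branch b v x0.
have d3 : is_derive x (1 : R) (fun y => branch b w y - branch b v y) _ := is_deriveB d1 d2.
exact: is_derive_continuous (is_derive_cosM t d3).
Qed.

Lemma continuous01_osc_derive b w v (t : R) :
  continuous01 (fun x => (linden w x * linden v x) ^- 2 *
     cos (t * (branch b w x - branch b v x))).
Proof.
move=> x x01; have /andP[x0 _] := x01; apply: continuousM; last exact: continuous01_osc.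
have l0 : (linden w x * linden v x) ^+ 2 != 0 by rewrite expf_neq0// mulf_neq0// gt_eqF// linden_gt0.
have d1 : is_derive x (1 : R) (fun x => (linden w x * linden v x) ^+ 2)
    (2 * (linden w x * linden v x) * ((den w).1%:R * linden v x + linden w x * (den v).1%:R)).
  by rewrite /linden; apply: is_derive_eq; rewrite /GRing.scale /=; ring.
by apply: is_derive_continuous; exact: is_derive_cosM t d3.
Qed.

(** The cosine sum and the sine sum are the two components of F, and either square is at most |F|^2
    = [Uf]^2 + [Vf]^2, so both are treated at once. [Psi1] and [Psi2] are primitives of the pair
    terms of |F|^2 and |F'|^2 / t^2. *)
Theorem branch_sum_bound (b sg : bool) (cs : R -> R) (W : seq (seq bool)) (Q D N U : nat) (t P lambda : R) :
  cs = cos \/ cs = sin ->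
  uniq W -> t != 0 -> (0 < D)%N -> (D <= Q)%N -> (0 < N)%N -> (0 < U)%N -> 0 <= P -> 0 < lambda ->
  (forall w, w \in W -> [/\ (height w < 2 * Q)%N, (D <= (den w).2)%N,
      odd (b + count id w) = sg & 2 ^- size w <= P]) ->
  \sum_(w <- W) 2 ^- size w <= 1 :> R ->
  `|\sum_(w <- W) 2 ^- size w * qm_int (fun x => cs (t * branch b w x))| <=
    (lambda * (2 * 8 `^ alpha * N%:R^-1 `^ alpha) *
     ((2 * N%:R + N%:R^-1 * (t ^+ 2 * D%:R ^- 4)) *
      (P + osc_const Q D t * (15 * P * (U%:R * Num.sqrt U%:R) + (Num.sqrt U%:R)^-1)))
      + lambda^-1) / 2.
Proof.
move=> cscs uW t0 D0 DQ N0 U0 P0 l0 hW sW.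
have d0 : 0 < D%:R :> R by rewrite ltr0n.
pose p (w : seq bool) : R := 2 ^- size w.
pose f := branch (R := R) b.
pose df w (x : R) : R := (-1) ^+ (b + count id w) / linden w x ^+ 2.
have d_f w (x : R) : 0 <= x <= 1 -> is_derive x (1 : R) (f w) (df w x).
  by case/andP=> x0 _; exact: is_derive_branch.
pose Uf (x : R) : R := \sum_(w <- W) p w * cos (t * f w x).
pose Vf (x : R) : R := \sum_(w <- W) p w * sin (t * f w x).
pose uf (x : R) : R := \sum_(w <- W) p w * (- sin (t * f w x) * (t * df w x)).
pose vf (x : R) : R := \sum_(w <- W) p w * (cos (t * f w x) * (t * df w x)).
have dU : primitive_on 0 1 Uf uf.
  by apply: primitive_on_sum => w x x01; apply: is_derive_cosM; exact: d_f.
have dV : primitive_on 0 1 Vf vf.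
  by apply: primitive_on_sum => w x x01; apply: is_derive_sinM; exact: d_f.
have [Psi1 dPsi1] : exists Psi : seq bool -> seq bool -> R -> R, forall w v,
    primitive_on 0 1 (Psi w v) (fun x => cos (t * (f w x - f v x))).
  have /choice[Psi hPsi] : forall wv : seq bool * seq bool, exists P : R -> R,
      primitive_on 0 1 P (fun x => cos (t * (f wv.1 x - f wv.2 x))).
    by move=> wv; apply: exists_primitive; exact: continuous01_osc.
  by exists (fun w v => Psi (w, v)) => w v; exact: (hPsi (w, v)).
have [Psi2 dPsi2] : exists Psi : seq bool -> seq bool -> R -> R, forall w v,
    primitive_on 0 1 (Psi w v) (fun x => (linden w x * linden v x) ^- 2 * cos (t * (f w x - f v x))).
  have /choice[Psi hPsi] : forall wv : seq bool * seq bool, exists P : R -> R,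
      primitive_on 0 1 P (fun x => (linden wv.1 x * linden wv.2 x) ^- 2 * cos (t * (f wv.1 x - f wv.2 x))).
    by move=> wv; apply: exists_primitive; exact: continuous01_osc_derive.
  by exists (fun w v => Psi (w, v)) => w v; exact: (hPsi (w, v)).
pose E (Psi : seq bool -> seq bool -> R -> R) (x : R) : R := \sum_(w <- W) p w * (\sum_(v <- W) p v * Psi w v x).
have dE1 : primitive_on 0 1 (E Psi1) (fun x => Uf x ^+ 2 + Vf x ^+ 2).
  apply: (@primitive_on_eq _ _ _ (fun x => \sum_(w <- W) p w * (\sum_(v <- W) p v * cos (t * (f w x - f v x))))).
    move=> x _; rewrite /Uf /Vf !sqr_weighted_sum -big_split /=; apply: eq_bigr => w _.
    rewrite -mulrDr -big_split /=; congr (_ * _); apply: eq_bigr => v _.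
    by rewrite -mulrDr mulrBr cosB.
  by do 2!apply: primitive_on_sum => ?; exact: dPsi1.
have dE2 : primitive_on 0 1 (fun x => t ^+ 2 * E Psi2 x) (fun x => uf x ^+ 2 + vf x ^+ 2).
  apply: (@primitive_on_eq _ _ _ (fun x => t ^+ 2 * \sum_(w <- W) p w * (\sum_(v <- W) p v * ((linden w x * linden v x) ^- 2 * cos (t * (f w x - f v x)))))).
    move=> x /andP[x0 _]; rewrite /uf /vf !sqr_weighted_sum -big_split /= mulr_sumr.
    rewrite big_seq [RHS]big_seq; apply: eq_bigr => w wW.
    rewrite -mulrDr -big_split /= mulrCA mulr_sumr; congr (_ * _).
    rewrite big_seq [RHS]big_seq; apply: eq_bigr => v vW.
    rewrite -mulrDr mulrCA; congr (_ * _).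
    (* Equal parity of [b + count id w] means equal signs of the derivatives, so the signs cancel in
       the product. *)
    have dd : df w x * df v x = (linden w x * linden v x) ^- 2.
      have [_ _ sw _] := hW w wW; have [_ _ sv _] := hW v vW.
      rewrite /df -[in (-1) ^+ (b + count id w)]signr_odd -[in (-1) ^+ (b + count id v)]signr_odd sw sv.
      by rewrite mulrACA -expr2 sqrr_sign mul1r -invfM -exprMn.
    by rewrite -dd mulrBr cosB; ring.
  have dd2 : primitive_on 0 1 (E Psi2) (fun x => \sum_(w <- W) p w * (\sum_(v <- W) p v * ((linden w x * linden v x) ^- 2 * cos (t * (f w x - f v x))))).
    by do 2!apply: primitive_on_sum => ?; exact: dPsi2.
  move=> x x01; have := dd2 x x01 => dx.
  by apply: is_derive_eq; rewrite /GRing.scale /=; ring.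
have EB Psi : E Psi 1 - E Psi 0 = \sum_(w <- W) p w * (\sum_(v <- W) p v * (Psi w v 1 - Psi w v 0)).
  rewrite /E -sumrB; apply: eq_bigr => w _; rewrite -mulrBr -sumrB; congr (_ * _).
  by apply: eq_bigr => v _; rewrite -mulrBr.
have B0 : 0 <= osc_const Q D t by rewrite mulr_ge0// sqrtr_ge0.
have hP w : w \in W -> p w <= P by move=> /hW[].
set m2 := P + _.
have b1 : E Psi1 1 - E Psi1 0 <= m2.
  rewrite EB -[m2]mul1r; apply: double_sum_bound => //.
    move=> w wW.
    have := @norm_increment R 0 1 (Psi1 w w) _ id (fun=> 1) ler01 (dPsi1 w w).
    rewrite subr0; apply; first by move=> x _; exact: is_derive_id.
    by move=> x _; rewrite subrr mulr0 cos0 normr1.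
  move=> w v wW vW vw; rewrite mul1r.
  have [h1 h2 h3 _] := hW w wW; have [k1 k2 k3 _] := hW v vW.
  by apply: (@pair_bound R b w v Q D t) => //; rewrite h3 k3.
have b2 : E Psi2 1 - E Psi2 0 <= D%:R ^- 4 * m2.
  have D40 : 0 < D%:R ^- 4 :> R by rewrite invr_gt0 exprn_gt0.
  rewrite EB; apply: double_sum_bound => //.
    move=> w wW; have [h1 h2 h3 _] := hW w wW.
    have := @norm_increment R 0 1 (Psi2 w w) _ (fun x => D%:R ^- 4 * x) (fun=> D%:R ^- 4) ler01 (dPsi2 w w).
    rewrite mulr1 mulr0 subr0; apply.
      by move=> x _; apply: is_derive_eq; rewrite /GRing.scale /=; ring.
    move=> x x01; rewrite subrr mulr0 cos0 mulr1.
    have /andP[x0 _] := x01; have := linden_ge w x0 => hl.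
    have lD : D%:R <= linden w x by apply: le_trans hl; rewrite ler_nat.
    rewrite ger0_norm ?invr_ge0 ?sqr_ge0// -expr2 -exprM.
    have l00 : 0 < linden w x by exact: lt_le_trans lD.
    by rewrite lef_pV2 ?posrE ?exprn_gt0// lerXn2r// nnegrE ltW.
  move=> w v wW vW vw.
  have [h1 h2 h3 _] := hW w wW; have [k1 k2 k3 _] := hW v vW.
  by apply: (@pair_bound_derive R b w v Q D t) => //; rewrite h3 k3.
pose g (x : R) : R := \sum_(w <- W) p w * cs (t * f w x).
have ccs : continuous cs by case: cscs => ->; [exact: continuous_cos|exact: continuous_sin].
have cw w : continuous01 (fun x => cs (t * f w x)).
  move=> x x01; apply: (@continuous_comp _ _ _ (fun x => t * f w x) cs); last exact: ccs.
  apply: continuousM; first exact: cst_continuous.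
  exact: continuous01_branch.
have cpw w : continuous01 (fun x => p w * cs (t * f w x)).
  by apply: continuous01M; [exact: continuous01_cst|exact: cw].
have -> : \sum_(w <- W) 2 ^- size w * qm_int (fun x => cs (t * branch b w x)) = qm_int g.
  rewrite /g qm_int_sum//; apply: eq_bigr => w _; rewrite qm_intZ//; exact: cw.
apply: (le_trans (@large_sieve R g Uf Vf uf vf (E Psi1) (fun x => t ^+ 2 * E Psi2 x) N lambda N0 l0 _ _ dU dV dE1 dE2)).
- exact: continuous01_sum.
- move=> x _; rewrite /g; case: cscs => ->; rewrite -/(Uf x) -/(Vf x).
    by rewrite lerDl sqr_ge0.
  by rewrite lerDr sqr_ge0.
rewrite ler_pM2r ?invr_gt0// lerD2r ler_wpM2l//.
  by rewrite !mulr_ge0 ?powR_ge0 ?(ltW l0).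
rewrite [leRHS]mulrDl; apply: lerD; first by rewrite ler_wpM2l ?mulr_ge0.
by rewrite -[leRHS]mulrA ler_wpM2l ?invr_ge0// -mulrBr -[leRHS]mulrA ler_wpM2l ?sqr_ge0.
Qed.
End Assembly.

(** * Choice of the parameters *)

Section Final.
Context {R : realType}.
Local Notation alpha := (decay_alpha R).

Definition sum_bound (Q D N U : nat) (t P lambda : R) : R :=
  (lambda * (2 * 8 `^ alpha * N%:R^-1 `^ alpha) *
     ((2 * N%:R + N%:R^-1 * (t ^+ 2 * D%:R ^- 4)) *
      (P + osc_const Q D t * (15 * P * (U%:R * Num.sqrt U%:R) + (Num.sqrt U%:R)^-1)))
      + lambda^-1) / 2.

(** For each first letter [b], words whose second denominator is below D contribute at most their
    weight, and the others form two classes according to the sign of the derivative: hence 2 *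
    [sum_bound]. The two values of [b] are averaged. *)
Lemma fourier_bound (cs : R -> R) (A D N U : nat) (t lambda : R) :
  cs = cos \/ cs = sin -> (1 < A)%N -> (0 < D)%N -> (0 < N)%N -> (0 < U)%N ->
  t != 0 -> 0 < lambda ->
  `|qm_int (fun x => cs (t * x))| <= ((A * D)%:R + 2) * 2 ^- A.-1 +
     2 * sum_bound (A * D) D N U t (4 * D%:R `^ (- (2 * alpha))) lambda.
Proof.
move=> cscs A1 D0 N0 U0 t0 l0; set Q := (A * D)%N; set P := 4 * _.
have A0 : (0 < A)%N by exact: ltnW.
have Q2 : (2 <= Q)%N by rewrite /Q -[2%N]muln1 leq_mul.
have DQ : (D <= Q)%N by rewrite /Q leq_pmull.
have P0 : 0 <= P by rewrite mulr_ge0// powR_ge0.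
have ccs : continuous cs by case: cscs => ->; [exact: continuous_cos|exact: continuous_sin].
pose g (x : R) : R := cs (t * x).
have cg : continuous g.
  move=> x; apply: (@continuous_comp _ _ _ (fun x => t * x) cs); last exact: ccs.
  by apply: continuousM; [exact: cst_continuous|exact: cvg_id].
have cs1 (x : R) : `|cs x| <= 1.
  case: cscs => ->; first by rewrite ler_norml cos_geN1 cos_le1.
  by rewrite ler_norml sin_geN1 sin_le1.
have i0 n : 0 <= 2 ^- n :> R by rewrite invr_ge0 exprn_ge0.
pose W := leaves Q Q [::].
have uW : uniq W by exact: leaves_uniq.
have sW : \sum_(w <- W) 2 ^- size w = 1 :> R by rewrite leaves_weight expr0 invr1.
have hW w : w \in W -> (Q <= height w < 2 * Q)%N.
  by apply: leaves_height; rewrite /height /=; lia.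
have half (b : bool) : `|qm_int (g \o mob b)| <= (Q%:R + 2) * 2 ^- A.-1 + 2 * sum_bound Q D N U t P lambda.
  rewrite (@qm_int_leaves R g b Q Q cg) -/W.
  rewrite (bigID (fun w => ((den w).2 < D)%N)) /=.
  apply: (le_trans (ler_normD _ _)); apply: lerD.
    apply: (le_trans (ler_norm_sum _ _ _)); apply: (le_trans _ (@leaves_bad_weight0 R A D A0 D0)).
    apply: ler_sum => w _; rewrite normrM ger0_norm// -[leRHS]mulr1 ler_wpM2l//.
    apply: qm_int_le; last by move=> x _; exact: cs1.
    by move=> x x01; apply: continuous_comp; [exact: continuous01_branch|exact: cg].
  rewrite (bigID (fun w => odd (b + count id w))) /= mulr_natl mulr2n.
  have part (sg : bool) : `|\sum_(w <- [seq w <- W | ~~ ((den w).2 < D)%N && (odd (b + count id w) == sg)])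
      2 ^- size w * qm_int (g \o branch b w)| <= sum_bound Q D N U t P lambda.
    apply: (@branch_sum_bound R b sg cs _ Q D N U t P lambda) => //.
    - exact: filter_uniq.
    - move=> w; rewrite mem_filter -leqNgt => /andP[/andP[dw /eqP ow] /hW /andP[h1 h2]].
      split=> //; apply: (le_trans (@weight_le R w Q _ h1)); first by lia.
      rewrite ler_pM2l// !powRN lef_pV2 ?posrE ?powR_gt0 ?ltr0n//; last by lia.
      by apply: ge0_ler_powR; rewrite ?nnegrE ?ler_nat// mulr_ge0// ltW// alpha_gt0.
    - apply: (@le_trans _ _ (\sum_(w <- W) 2 ^- size w)); last by rewrite sW.
      rewrite big_filter [leRHS](bigID (fun w => ~~ ((den w).2 < D)%N && (odd (b + count id w) == sg))) /=.
      by rewrite lerDl sumr_ge0.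
  apply: (le_trans (ler_normD _ _)); apply: lerD.
    have := part true; rewrite big_filter.
    by under eq_bigl do rewrite eqb_id.
  have := part false; rewrite big_filter.
  by under eq_bigl do rewrite eqbF_neg.
have -> : qm_int (fun x => cs (t * x)) = (qm_int (g \o mob false) + qm_int (g \o mob true)) / 2.
  by rewrite -qm_int_mob//; move=> x _; exact: cg.
rewrite normrM [X in _ * X]ger0_norm ?invr_ge0// ler_pdivrMr//.
apply: (le_trans (ler_normD _ _)); apply: (le_trans (lerD (half false) (half true))).
by rewrite le_eqVlt; apply/orP; left; apply/eqP; ring.
Qed.

Lemma nat_approx (r : R) : 1 <= r -> exists n : nat, [/\ (1 < n)%N, r <= n%:R & n%:R <= 2 * r].
Proof.
move=> r1; have r0 : 0 <= r by lra.
have /truncn_itv /andP[h1 h2] := r0.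
exists (Num.truncn r).+1; split; first by rewrite ltnS truncn_gt0.
  exact: ltW.
by rewrite -natr1; lra.
Qed.

Section Exponents.
Variables (x : R) (A D N U : nat) (t : R).
(** Exponents in powers of x, where |t| = x^(3 + 3 alpha). Without the loss between D and A D one
    would reach [beta / 2]; the target is [kap] = 3 (1 + alpha) [decay_eta R]. The loss is A^(5/2)
    in mean square, so for A = x^gam the equation 2 kap = beta - 5/2 gam determines [gam]. *)
Let beta : R := 3 * alpha ^+ 2 - 1.
Let kap : R := beta / (3 - alpha).
Let gam : R := 4 / 5 * (beta / 2 - kap).

Lemma exponent_pos : [/\ 0 < beta, 0 < kap & 0 < gam].
Proof.
have a1 := alpha_ge (R := R); have a2 := alpha_lt1 (R := R).
have b0 : 0 < beta by rewrite /beta; nra.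
have k0 : 0 < kap by rewrite /kap divr_gt0//; lra.
split=> //; rewrite /gam mulr_gt0//.
have -> : beta / 2 - kap = beta * (1 - alpha) / (2 * (3 - alpha)).
  by rewrite /kap; field; lra.
by rewrite divr_gt0 ?mulr_gt0//; lra.
Qed.

(** N is of order |t| / D^2, which balances N with t^2 / (N D^4). U of order x^alpha balances P
    U^(3/2) with U^(-1/2), both x^(-alpha/2). Up to powers of A, the oscillation factor is x^(-3
    alpha/2), so the off-diagonal part matches the diagonal x^(-2 alpha). *)
Lemma sum_bound_le : 1 <= x ->
  x <= D%:R <= 2 * x -> x `^ gam <= A%:R <= 2 * x `^ gam ->
  x `^ (1 + 3 * alpha) <= N%:R <= 2 * x `^ (1 + 3 * alpha) ->
  x `^ alpha <= U%:R <= 2 * x `^ alpha ->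
  `|t| = x `^ (3 + 3 * alpha) ->
  sum_bound (A * D) D N U t (4 * D%:R `^ (- (2 * alpha))) (x `^ kap) <= (80 * (12 * 91 * 241 + 4) + 1) * x `^ (- kap).
Proof.
move=> x1 /andP[Dl Du] /andP[Al Au] /andP[Nl Nu] /andP[Ul Uu] tE.
have [b0 k0 g0] := exponent_pos.
have a1 := alpha_ge (R := R); have a2 := alpha_lt1 (R := R).
have x0 : 0 < x by lra.
have xN : x != 0 by rewrite gt_eqF.
have X0 e : 0 < x `^ e by exact: powR_gt0.
have XM e f : x `^ e * x `^ f = x `^ (e + f) by rewrite powRD// xN implybT.
have XV e : (x `^ e)^-1 = x `^ (- e) by rewrite powRN.
have XP e (n : nat) : (x `^ e) ^+ n = x `^ (e * n%:R).
  by rewrite -powR_mulrn ?powR_ge0// -powRrM.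
have D0 : 0 < D%:R :> R by lra.
have A0 : 0 < A%:R :> R by exact: lt_le_trans Al.
have N0 : 0 < N%:R :> R by exact: lt_le_trans Nl.
have U0 : 0 < U%:R :> R by exact: lt_le_trans Ul.
set P := 4 * _.
have Xn n : x ^+ n = x `^ n%:R by rewrite powR_mulrn// ltW.
have P_le : P <= 4 * x `^ (- (2 * alpha)).
  rewrite ler_pM2l// !powRN lef_pV2 ?posrE ?powR_gt0//.
  by apply: ge0_ler_powR; rewrite ?nnegrE ?(ltW x0) ?(ltW D0)//; lra.
have osc_le : osc_const (A * D) D t <= 12 * 91 * x `^ (5 / 2 * gam - 3 / 2 * alpha).
  rewrite /osc_const -[leRHS]mulrA ler_pM2l//.
  have e1 : 32 * (A * D)%:R ^+ 5 / (D%:R ^+ 2 * `|t|) = 32 * (A%:R ^+ 5 * D%:R ^+ 3) / `|t|.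
    by rewrite natrM; field; rewrite !gt_eqF// tE.
  rewrite e1 tE XV.
  have AD : A%:R ^+ 5 * D%:R ^+ 3 <= (2 * x `^ gam) ^+ 5 * (2 * x) ^+ 3.
    by apply: ler_pM; rewrite ?exprn_ge0// ?lerXn2r ?nnegrE ?mulr_ge0// ltW.
  have e2 : (2 * x `^ gam) ^+ 5 * (2 * x) ^+ 3 = 256 * x `^ (5 * gam + 3).
    have g5 : (x `^ gam) ^+ 5 = x `^ (5 * gam).
      by rewrite XP mulrC.
    rewrite !exprMn (Xn 3) g5 -(XM (5 * gam) 3); ring.
  (* Here 91^2 = 8281 exceeds 32 * 256 = 8192. *)
  have le1 : 32 * (A%:R ^+ 5 * D%:R ^+ 3) * x `^ (- (3 + 3 * alpha)) <= (91 * x `^ (5 / 2 * gam - 3 / 2 * alpha)) ^+ 2.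
    apply: (@le_trans _ _ (32 * (256 * x `^ (5 * gam + 3)) * x `^ (- (3 + 3 * alpha)))).
      by rewrite ler_wpM2r ?powR_ge0// ler_pM2l// -e2.
    have w2 : (x `^ (5 / 2 * gam - 3 / 2 * alpha)) ^+ 2 = x `^ (5 * gam + 3 + (- (3 + 3 * alpha))).
      by rewrite XP; congr (_ `^ _); field.
    rewrite exprMn w2 -mulrA -[_ * _ * x `^ _]mulrA XM mulrA ler_wpM2r ?powR_ge0//; lra.
  by apply: (le_trans (ler_wsqrtr le1)); rewrite sqrtr_sqr ger0_norm// mulr_ge0// powR_ge0.
have sU : Num.sqrt U%:R <= 2 * x `^ (alpha / 2).
  have -> : 2 * x `^ (alpha / 2) = Num.sqrt (4 * x `^ alpha).
    have -> : 4 * x `^ alpha = (2 * x `^ (alpha / 2)) ^+ 2.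
      by rewrite exprMn XP divfK//; ring.
    by rewrite sqrtr_sqr ger0_norm// mulr_ge0// powR_ge0.
  by apply: ler_wsqrtr; have := X0 alpha; lra.
have sU' : (Num.sqrt U%:R)^-1 <= x `^ (- (alpha / 2)).
  rewrite powRN lef_pV2 ?posrE ?sqrtr_gt0//.
  have -> : x `^ (alpha / 2) = Num.sqrt (x `^ alpha).
    have -> : x `^ alpha = (x `^ (alpha / 2)) ^+ 2.
      by rewrite XP divfK.
    by rewrite sqrtr_sqr ger0_norm// powR_ge0.
  exact: ler_wsqrtr.
have P0 : 0 <= P by rewrite mulr_ge0// powR_ge0.
(* 241 = 15 * 16 + 1, the 16 coming from 4 in P and 2 * 2 in U and its root. *)
have near_le : 15 * P * (U%:R * Num.sqrt U%:R) + (Num.sqrt U%:R)^-1 <= 241 * x `^ (- (alpha / 2)).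
  have h : P * (U%:R * Num.sqrt U%:R) <= 4 * x `^ (- (2 * alpha)) * (2 * x `^ alpha * (2 * x `^ (alpha / 2))).
    by apply: ler_pM; rewrite ?mulr_ge0 ?sqrtr_ge0//; apply: ler_pM; rewrite ?sqrtr_ge0.
  have e : 4 * x `^ (- (2 * alpha)) * (2 * x `^ alpha * (2 * x `^ (alpha / 2))) = 16 * x `^ (- (alpha / 2)).
    have -> : - (alpha / 2) = - (2 * alpha) + (alpha + alpha / 2) by field.
    by rewrite -(XM (- (2 * alpha))) -(XM alpha); ring.
  by rewrite e in h; rewrite -mulrA; lra.
pose K : R := 12 * 91 * 241 + 4.
have m2_le : P + osc_const (A * D) D t * (15 * P * (U%:R * Num.sqrt U%:R) + (Num.sqrt U%:R)^-1) <=
    K * x `^ (5 / 2 * gam - 2 * alpha).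
  have h1 : osc_const (A * D) D t * (15 * P * (U%:R * Num.sqrt U%:R) + (Num.sqrt U%:R)^-1) <=
     12 * 91 * x `^ (5 / 2 * gam - 3 / 2 * alpha) * (241 * x `^ (- (alpha / 2))).
    apply: ler_pM => //; first by rewrite mulr_ge0// sqrtr_ge0.
    by rewrite addr_ge0 ?invr_ge0 ?sqrtr_ge0// !mulr_ge0 ?sqrtr_ge0.
  have e1 : 12 * 91 * x `^ (5 / 2 * gam - 3 / 2 * alpha) * (241 * x `^ (- (alpha / 2))) =
      12 * 91 * 241 * x `^ (5 / 2 * gam - 2 * alpha).
    have -> : 5 / 2 * gam - 2 * alpha = 5 / 2 * gam - 3 / 2 * alpha - alpha / 2 by field.
    by rewrite -(XM _ (- (alpha / 2))); ring.
  have h2 : x `^ (- (2 * alpha)) <= x `^ (5 / 2 * gam - 2 * alpha) by apply: ler_powR => //; lra.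
  rewrite e1 in h1; rewrite /K mulrDl; move: P_le h1 h2; lra.
have mid_le : 2 * N%:R + N%:R^-1 * (t ^+ 2 * D%:R ^- 4) <= 5 * x `^ (1 + 3 * alpha).
  have h1 : N%:R^-1 <= x `^ (- (1 + 3 * alpha)) by rewrite powRN lef_pV2 ?posrE.
  have h2 : D%:R ^- 4 <= x `^ (- 4).
    rewrite powRN lef_pV2 ?posrE ?exprn_gt0// powR_mulrn ?(ltW x0)//.
    by rewrite lerXn2r// nnegrE ltW.
  have h3 : t ^+ 2 = x `^ (2 * (3 + 3 * alpha)).
    by rewrite -real_normK ?num_real// tE XP mulrC.
  have h4 : N%:R^-1 * (t ^+ 2 * D%:R ^- 4) <= x `^ (- (1 + 3 * alpha)) * (x `^ (2 * (3 + 3 * alpha)) * x `^ (- 4)).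
    rewrite h3; apply: ler_pM; rewrite ?invr_ge0 ?mulr_ge0 ?invr_ge0 ?exprn_ge0 ?powR_ge0//.
    by rewrite ler_wpM2l ?powR_ge0.
  have e : x `^ (- (1 + 3 * alpha)) * (x `^ (2 * (3 + 3 * alpha)) * x `^ (- 4)) = x `^ (1 + 3 * alpha).
    by rewrite !XM; congr (_ `^ _); ring.
  by rewrite e in h4; lra.
have H_le : 2 * 8 `^ alpha * N%:R^-1 `^ alpha <= 16 * x `^ (- ((1 + 3 * alpha) * alpha)).
  have h8 : 8 `^ alpha <= 8 :> R by apply: ler1_powR => //; [lra|exact: ltW].
  have hN : N%:R^-1 `^ alpha <= x `^ (- ((1 + 3 * alpha) * alpha)).
    have -> : x `^ (- ((1 + 3 * alpha) * alpha)) = (x `^ (- (1 + 3 * alpha))) `^ alpha.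
      by rewrite -powRrM mulNr.
    apply: ge0_ler_powR; rewrite ?nnegrE ?powR_ge0 ?invr_ge0//; first by lra.
    by rewrite powRN lef_pV2 ?posrE.
  have := ler_pM (powR_ge0 _ _) (powR_ge0 _ _) h8 hN; rewrite -mulrA; lra.
have K0 : 0 < K by rewrite /K; lra.
rewrite /sum_bound.
(* The constant is 16 * 5 * K. The exponents kap, -alpha (1 + 3 alpha), 1 + 3 alpha and 5/2 gam - 2
   alpha add up to kap - beta + 5/2 gam = -kap. *)
have main : x `^ kap * (2 * 8 `^ alpha * N%:R^-1 `^ alpha) *
     ((2 * N%:R + N%:R^-1 * (t ^+ 2 * D%:R ^- 4)) *
      (P + osc_const (A * D) D t * (15 * P * (U%:R * Num.sqrt U%:R) + (Num.sqrt U%:R)^-1))) <= 80 * K * x `^ (- kap).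
  have t2 : 0 <= t ^+ 2 by rewrite sqr_ge0.
  have oc0 : 0 <= osc_const (A * D) D t by rewrite mulr_ge0// sqrtr_ge0.
  have mid0 : 0 <= 2 * N%:R + N%:R^-1 * (t ^+ 2 * D%:R ^- 4).
    apply: addr_ge0; first by rewrite mulr_ge0.
    by apply: mulr_ge0; [rewrite invr_ge0|rewrite mulr_ge0// invr_ge0 exprn_ge0].
  have m20 : 0 <= P + osc_const (A * D) D t * (15 * P * (U%:R * Num.sqrt U%:R) + (Num.sqrt U%:R)^-1).
    apply: addr_ge0 => //; apply: mulr_ge0 => //; apply: addr_ge0; last by rewrite invr_ge0 sqrtr_ge0.
    by rewrite !mulr_ge0 ?sqrtr_ge0.
  apply: (@le_trans _ _ (x `^ kap * (16 * x `^ (- ((1 + 3 * alpha) * alpha))) * (5 * x `^ (1 + 3 * alpha) * (K * x `^ (5 / 2 * gam - 2 * alpha))))).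
    apply: ler_pM.
    - by rewrite !mulr_ge0 ?powR_ge0.
    - exact: mulr_ge0.
    - by rewrite ler_wpM2l ?powR_ge0.
    exact: ler_pM.
  have -> : x `^ (- kap) = x `^ kap * x `^ (- ((1 + 3 * alpha) * alpha)) *
      (x `^ (1 + 3 * alpha) * x `^ (5 / 2 * gam - 2 * alpha)).
    by rewrite !XM; congr (_ `^ _); rewrite /gam /beta; field.
  by rewrite le_eqVlt; apply/orP; left; apply/eqP; ring.
rewrite XV ler_pdivrMr//; move: main (X0 (- kap)); rewrite -/K mulrDl mul1r.
move: (x `^ kap * _ * _) (x `^ (- kap)) => a1' a2'; nra.
Qed.
End Exponents.
End Final.

Section Decay.
Context {R : realType}.
Local Notation alpha := (decay_alpha R).

Lemma exp2_decay (k : nat) : exists2 C : R, 0 < C &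
  forall A : nat, (0 < A)%N -> 2 ^- A <= C * A%:R ^- k.+1.
Proof.
have l2 : 0 < ln 2 :> R by rewrite ln_gt0// ltr1n.
have c0 : 0 < (k.+1)`!%:R / ln 2 ^+ k.+1 :> R.
  by rewrite divr_gt0 ?exprn_gt0// ltr0n fact_gt0.
exists ((k.+1)`!%:R / ln 2 ^+ k.+1) => // A A0.
have a0 : 0 < A%:R :> R by rewrite ltr0n.
have e : 2 ^+ A = expR (A%:R * ln 2) :> R.
  by rewrite -powR_mulrn// /powR gt_eqF.
have h := @expR_ge1Dxn R (A%:R * ln 2) k ltac:(by rewrite mulr_ge0// ltW).
have f0 : 0 < (k.+1)`!%:R :> R by rewrite ltr0n fact_gt0.
have pos : 0 < (k.+1)`!%:R / ln 2 ^+ k.+1 * A%:R ^- k.+1 :> R.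
  by rewrite mulr_gt0// invr_gt0 exprn_gt0.
rewrite e -[leRHS]invrK lef_pV2 ?posrE ?expR_gt0 ?(invr_gt0 _)//.
apply: (le_trans _ h); rewrite ler_wpDl//.
rewrite le_eqVlt; apply/orP; left; apply/eqP; rewrite exprMn.
by field; rewrite !expf_neq0 ?(gt_eqF f0) ?(gt_eqF a0) ?(gt_eqF l2).
Qed.

(** A is at least a fixed positive power of x, so 2^-A decays faster than any power of x. The choice
    gam (k + 1) >= 1 + gam + kap pays for the factor A D, of order x^(1 + gam), and leaves
    x^(-kap). *)
Lemma bad_weight_decay : exists2 C : R, 0 < C & forall (x : R) (A D : nat), 1 <= x ->
  let kap := (3 * alpha ^+ 2 - 1) / (3 - alpha) in
  let gam := 4 / 5 * ((3 * alpha ^+ 2 - 1) / 2 - kap) in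
  (0 < A)%N -> (0 < D)%N ->
  D%:R <= 2 * x -> x `^ gam <= A%:R <= 2 * x `^ gam ->
  ((A * D)%:R + 2) * 2 ^- A.-1 <= C * x `^ (- kap).
Proof.
have [_ k0 g0] := exponent_pos (R := R).
set kap := (3 * alpha ^+ 2 - 1) / (3 - alpha) in k0 *.
set gam := 4 / 5 * (_ - _) in g0 *.
pose k := Num.truncn ((1 + gam + kap) / gam).
have hk : 1 + gam + kap <= gam * k.+1%:R.
  by rewrite mulrC -ler_pdivrMr// ltW// truncnS_gt.
have [C C0 hC] := exp2_decay k.
exists (24 * C); first by rewrite mulr_gt0.
move=> x A D x1 /= A0 D0 Dx /andP[Al Au].
have x0 : 0 < x by lra.
have X0 e : 0 < x `^ e by exact: powR_gt0.
have a0 : 0 < A%:R :> R by rewrite ltr0n.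
have AD1 : 1 <= (A * D)%:R :> R by rewrite ler1n muln_gt0 A0.
have i0 n : 0 < 2 ^- n :> R by rewrite invr_gt0 exprn_gt0.
have h1 : 2 ^- A <= C * x `^ (- (gam * k.+1%:R)).
  apply: (le_trans (hC A A0)); rewrite ler_pM2l// powRN lef_pV2 ?posrE ?exprn_gt0//.
  by rewrite powRrM powR_mulrn ?powR_ge0// lerXn2r// nnegrE ?powR_ge0// ltW.
have e1 : 2 ^- A.-1 = 2 * 2 ^- A :> R.
  by rewrite -[in RHS](prednK A0) exprS invfM mulrA divff ?mul1r.
have h2 : (A * D)%:R <= 2 * x `^ gam * (2 * x) :> R by rewrite natrM ler_pM.
have h3 : x `^ gam * x * x `^ (- (gam * k.+1%:R)) <= x `^ (- kap).
  have -> : x `^ gam * x * x `^ (- (gam * k.+1%:R)) = x `^ (gam + 1 - gam * k.+1%:R).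
    by rewrite !powRD ?powRr1 ?(gt_eqF x0) ?implybT// ltW.
  by apply: ler_powR => //; lra.
rewrite e1.
apply: (@le_trans _ _ (3 * (2 * x `^ gam * (2 * x)) * (2 * (C * x `^ (- (gam * k.+1%:R)))))).
  apply: ler_pM; [lra|by rewrite mulr_ge0// ltW|lra|by rewrite ler_pM2l].
rewrite -[leRHS]mulrA; have := ler_wpM2l (ltW C0) h3.
have -> : 3 * (2 * x `^ gam * (2 * x)) * (2 * (C * x `^ (- (gam * k.+1%:R)))) =
  24 * (C * (x `^ gam * x * x `^ (- (gam * k.+1%:R)))) by ring.
lra.
Qed.

Lemma fourier_decay : exists2 C : R, 0 < C & forall (cs : R -> R) (t : R),
  cs = cos \/ cs = sin -> 1 <= `|t| ->
  `|qm_int (fun x => cs (t * x))| <= C * `|t| `^ (- decay_eta R).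
Proof.
have [C C0 hC] := bad_weight_decay.
have K0 : 0 < 2 * (80 * (12 * 91 * 241 + 4) + 1) :> R by lra.
exists (C + 2 * (80 * (12 * 91 * 241 + 4) + 1)); first by rewrite addr_gt0.
move=> cs t cscs t1.
have a1 := alpha_ge (R := R); have a2 := alpha_lt1 (R := R).
have [_ k0 g0] := exponent_pos (R := R).
set kap := (3 * alpha ^+ 2 - 1) / (3 - alpha) in k0 g0.
set gam := 4 / 5 * (_ - _) in g0.
(* This normalization makes |t| = x^(3 + 3 alpha), and x^(-kap) becomes |t|^(-eta). *)
pose x := `|t| `^ (3 + 3 * alpha)^-1.
have tau0 : 0 < 3 + 3 * alpha by lra.
have x1 : 1 <= x.
  by rewrite -[leLHS](powRr0 `|t|); apply: ler_powR => //; rewrite invr_ge0 ltW.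
have X1 e : 0 <= e -> 1 <= x `^ e.
  by move=> e0; rewrite -[leLHS](powRr0 x); exact: ler_powR.
have tE : `|t| = x `^ (3 + 3 * alpha).
  by rewrite -powRrM mulVf ?gt_eqF// powRr1.
have eE : x `^ (- kap) = `|t| `^ (- decay_eta R).
  rewrite -powRrM; congr (_ `^ _); rewrite /decay_eta /kap; field.
  by apply/andP; split; [|apply/andP; split]; rewrite gt_eqF//; lra.
have [D [D1 Dl Du]] := nat_approx x1.
have [A [A1 Al Au]] := nat_approx (X1 gam (ltW g0)).
have [N [N1 Nl Nu]] := nat_approx (X1 (1 + 3 * alpha) ltac:(lra)).
have [U [U1 Ul Uu]] := nat_approx (X1 alpha ltac:(lra)).
have t0 : t != 0 by rewrite -normr_gt0 (lt_le_trans ltr01).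
have l0 : 0 < x `^ kap by rewrite powR_gt0// (lt_le_trans ltr01).
apply: (le_trans (@fourier_bound R cs A D N U t (x `^ kap) cscs A1 (ltnW D1) (ltnW N1) (ltnW U1) t0 l0)).
rewrite -eE [leRHS]mulrDl; apply: lerD.
  by apply: hC => //; [exact: ltnW|exact: ltnW|rewrite Al].
rewrite -[leRHS]mulrA ler_pM2l//; apply: sum_bound_le => //; exact/andP.
Qed.
End Decay.

Local Open Scope complex_scope.

Theorem mainTheorem2 (R : realType) :
  exists C T0 : R, [/\ 0 < C, 0 < T0 &
    forall t : R, T0 <= `|t| ->
      `|question_mark_fourier t| <= (C * `|t| `^ (- decay_eta R))%:C].
Proof.
have [C C0 hC] := fourier_decay (R := R).
(* Both components are at most C |t|^(-eta) as soon as |t| >= 1, and 2 majorizes sqrt 2. *)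
exists (2 * C), 1; split => //; first by rewrite mulr_gt0.
move=> t t1.
have hcos := hC cos t (or_introl erefl) t1.
have hsin := hC sin t (or_intror erefl) t1.
have -> : question_mark_fourier t =
    Complex (qm_int (fun x => cos (t * x))) (qm_int (fun x => sin (t * x))).
  by congr Complex; apply: qm_int_eq => x _; rewrite mulrC.
rewrite normc_def lecR /=.
move: hcos hsin; move: (qm_int _) (qm_int _) => b a ha hb.
set B := C * _ in ha hb.
have -> : 2 * C * `|t| `^ (- decay_eta R) = 2 * B by rewrite /B mulrA.
have B0 : 0 <= B by exact: le_trans ha.
have -> : 2 * B = Num.sqrt ((2 * B) ^+ 2) by rewrite sqrtr_sqr ger0_norm// mulr_ge0.
apply: ler_wsqrtr.
have sq (z : R) : `|z| <= B -> z ^+ 2 <= B ^+ 2.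
  by move=> hz; rewrite -real_normK ?num_real// lerXn2r// nnegrE.
have -> : (2 * B) ^+ 2 = 4 * B ^+ 2 by ring.
by have := sq a ha; have := sq b hb; have := sqr_ge0 B; lra.
Qed.
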